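(* Assume condition (F), and that $g(s)\leq g'(0)s$ and $f(s)\geq f'(0)s$ for all $s\geq0$. Let $\zeta_2>0$ satisfy $f(\zeta_2)>\sup_{s\geq0}g(s)$, let $G=f^{-1}\circ g$, and let $\zeta_1\in(0,\zeta_2)$ be such that $G([\zeta_1,\zeta_2])\subseteq[\zeta_1,\zeta_2]$, $\min_{s\in[\zeta_1,\zeta_2]}G(s)=G(\zeta_1)$ and $G(s)>s$ for $s\in(0,\zeta_1]$. Then for each real $c\in(-\infty,c_*^-]\cup[c_*^+,+\infty)$, equation (TW) has at least one semi-wavefront $\phi_c$ with $\phi_c\leq\zeta_2$ (so that $u(x,t)=\phi_c(x+ct)$ solves (RD)). Moreover, if $c\leq c_*^-$ then $\phi_c(+\infty)=0$ and $\liminf_{s\to-\infty}\phi_c(s)>\zeta_1$; if $c\geq c_*^+$ then $\phi_c(-\infty)=0$ and $\liminf_{s\to+\infty}\phi_c(s)>\zeta_1$. Finally, if the equation $f(s)=g(s)$ has only two solutions $0,\kappa$ in $[0,\infty)$ and $\kappa$ is globally attracting with respect to the map $f^{-1}\circ g:(0,\zeta_2]\to(0,\zeta_2]$, then each of these semi-wavefronts converges to $\kappa$ at the end of $\mathbb{R}$ where it does not vanish (i.e. it is a wavefront).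
   Context: Let $h\geq0$. Let $K:\mathbb{R}\to[0,\infty)$ be integrable with $\int_{\mathbb{R}}K(s)ds=1$. Condition (F): $f,g:[0,\infty)\to[0,\infty)$; $f$ is locally Lipschitz and strictly increasing with $f(0)=g(0)=0$, $f'(0)>0$ and $f(+\infty)>\sup_{s\geq0}g(s)$; $g$ is continuous, $g(t)>0$ for $t>0$, and $f'(0)<g'(0)<+\infty$. (RD): $u_t(t,x)=u_{xx}(t,x)-f(u(t,x))+\int_{\mathbb{R}}K(x-y)g(u(t-h,y))dy$. (TW): $y''(t)-cy'(t)-f(y(t))+\int_{\mathbb{R}}K(s)g(y(t-s-ch))ds=0$, $t\in\mathbb{R}$. A semi-wavefront is a positive bounded $C^2$ solution $\phi$ of (TW) with $\phi(-\infty)=0$ or $\phi(+\infty)=0$. Let $\chi_1(z,c)=z^2-cz-f'(0)+g'(0)e^{-zch}\int_{\mathbb{R}}K(s)e^{-zs}ds$, defined for real $z$ where the integral converges. Critical speeds: $c_*^+=\inf\{c\in\mathbb{R}:\chi_1(z,c)=0$ for some $z>0$ in the domain$\}$ (with $c_*^+=+\infty$ if this set is empty, in particular if the integral diverges for all $z>0$), and $c_*^-=\sup\{c\in\mathbb{R}:\chi_1(z,c)=0$ for some $z<0$ in the domain$\}$ (with $c_*^-=-\infty$ if empty). ''Globally attracting'' means iterates of every $s\in(0,\zeta_2]$ converge to $\kappa$. *)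

(* Defs.v *)
From HB Require Import structures.
From mathcomp Require Import all_boot all_order all_algebra.
From mathcomp Require Import all_classical all_reals all_analysis.
Set Implicit Arguments. Unset Strict Implicit. Unset Printing Implicit Defensive.
Import Order.TTheory GRing.Theory Num.Theory.
Import numFieldNormedType.Exports.
Local Open Scope classical_set_scope.
Local Open Scope ring_scope.

Section Defs.
Variable R : realType.
Local Notation mu := (@lebesgue_measure R).

(* fp0 is the right derivative of f at 0 (f is only considered on [0,oo)) *)
Definition right_deriv0 (f : R -> R) (l : R) : Prop :=
  (fun x => (f x - f 0) / x) x @[x --> 0^'+] --> l.

Definition loc_lipschitz_nonneg (f : R -> R) : Prop :=
  forall M : R, exists L : R, forall x y : R,
    0 <= x -> x <= M -> 0 <= y -> y <= M -> `|f x - f y| <= L * `|x - y|.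

(* f(+oo) as an extended real (f increasing, so the limit exists in \bar R) *)
Definition f_at_pinfty (f : R -> R) : \bar R :=
  lim ((f x)%:E @[x --> +oo]).

Definition sup_nonneg (g : R -> R) : \bar R :=
  ereal_sup [set (g s)%:E | s in `[0, +oo[%classic].

Definition condF (f g : R -> R) (fp0 gp0 : R) : Prop :=
  loc_lipschitz_nonneg f /\
  (forall x y, 0 <= x -> x < y -> f x < f y) /\
  f 0 = 0 /\ g 0 = 0 /\
  right_deriv0 f fp0 /\ 0 < fp0 /\
  (sup_nonneg g < f_at_pinfty f)%E /\
  {within `[0, +oo[%classic, continuous g} /\
  (forall t, 0 < t -> 0 < g t) /\
  right_deriv0 g gp0 /\ fp0 < gp0.

Definition chi_dom (K : R -> R) (z : R) : Prop :=
  mu.-integrable setT (fun s => (K s * expR (- (z * s)))%:E).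

Definition chi1 (K : R -> R) (fp0 gp0 h : R) (z c : R) : R :=
  z ^+ 2 - c * z - fp0
  + gp0 * expR (- (z * c * h)) * (\int[mu]_s (K s * expR (- (z * s)))).

(* critical speeds (inf of empty = +oo, sup of empty = -oo) *)
Definition c_star_plus (K : R -> R) (fp0 gp0 h : R) : \bar R :=
  ereal_inf [set c%:E | c in
    [set c : R | exists z, 0 < z /\ chi_dom K z /\ chi1 K fp0 gp0 h z c = 0]].

Definition c_star_minus (K : R -> R) (fp0 gp0 h : R) : \bar R :=
  ereal_sup [set c%:E | c in
    [set c : R | exists z, z < 0 /\ chi_dom K z /\ chi1 K fp0 gp0 h z c = 0]].

Definition solves_TW (K f g : R -> R) (c h : R) (y : R -> R) : Prop :=
  forall t : R,
    derive1 (derive1 y) t - c * derive1 y t - f (y t)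
    + (\int[mu]_s (K s * g (y (t - s - c * h)))) = 0.

Definition C2 (y : R -> R) : Prop :=
  (forall x, derivable y x 1) /\ (forall x, derivable (derive1 y) x 1)
  /\ continuous (derive1 (derive1 y)).

Definition semi_wavefront (K f g : R -> R) (c h : R) (y : R -> R) : Prop :=
  [/\ (forall t, 0 < y t),
      (exists M, forall t, `|y t| <= M),
      C2 y,
      solves_TW K f g c h y &
      (y t @[t --> -oo] --> 0) \/ (y t @[t --> +oo] --> 0)].

Definition liminf_ninfty (y : R -> R) : \bar R :=
  ereal_sup [set ereal_inf [set (y s)%:E | s in `]-oo, t]%classic] | t in [set: R]].

Definition liminf_pinfty (y : R -> R) : \bar R :=
  ereal_sup [set ereal_inf [set (y s)%:E | s in `[t, +oo[%classic] | t in [set: R]].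

End Defs.

(* Main.v *)
Require Import Defs.
From HB Require Import structures.
From mathcomp Require Import all_boot all_order all_algebra.
From mathcomp Require Import all_classical all_reals all_analysis.
From mathcomp Require Import measurable_realfun.
From mathcomp Require Import ring lra.
Set Implicit Arguments. Unset Strict Implicit. Unset Printing Implicit Defensive.
Import Order.TTheory GRing.Theory Num.Theory.
Import numFieldNormedType.Exports.
Local Open Scope classical_set_scope.
Local Open Scope ring_scope.

(** By reflection [t -> -t] it suffices to treat [c >= c_*^+]. There Fatou's lemma gives a real
    [z0 > 0] with [chi_1(z0, c) <= 0], so that [e^(z0 t)] is a supersolution. No subsolution is used:
    the nonlinear term is bounded below by a vanishing source [min(1/n, e^(z0 t))], and Brouwer's
    theorem on finitely many nodes, followed by a compactness argument, gives a fixed point [y_n] of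
    the Green operator below [min(zeta2, e^(z0 t))]. The source forces [y_n] above [zeta1] at [+oo],
    so [y_n] can be shifted to equal a small [delta] at [0]; the shifts are equi-Lipschitz and
    converge to a positive solution of (TW). Since [chi_1] is convex in [z], positive at [0] and
    nonpositive at [z0], it is positive for all [z <= eps]; hence a Gaussian touching a small
    solution from below must have logarithmic slope at least [eps]. This forces exponential
    decay at [-oo] and a positive lower limit at [+oo], which the fluctuation argument then raises
    above [zeta1]. Finally the lower and upper limits [m <= M] at [+oo] satisfy
    [[m, M] <= G([m, M])], which is only possible for [m = M = kappa]. *)

(** * Kuhn's lemma and Brouwer's theorem *)

(** The usual subsolution e^(z t) - M e^((z + r) t) needs the Laplace transform of K beyond a root
    of chi_1, the sign of chi_1 there, and more of g at 0 than a derivative; at c = c_*^+ the root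
    may be double or end the domain of convergence. It is replaced by a decay estimate for small
    solutions, whose constants are the same for all positive profiles, so that the height delta can
    be fixed before n -> oo. The source destroys translation invariance, but it is O(1/n) uniformly
    in t, so shifting it by uncontrolled amounts does no harm in the limit. Since g need not be
    monotone, the fixed points come from a topological theorem and not from monotone iteration. The
    Green operator has rates a, b > 0 with b - a = c and a b >= L: the first condition yields the
    drift c, the second makes a b y - f(y) nondecreasing, so that [0, zeta2] is preserved. Its
    images are equi-Lipschitz, which is why finitely many nodes suffice for Brouwer's theorem. For z
    < 0 the transform of K may diverge; convexity in z is therefore used on a bounded window of K,
    where it is an elementary inequality between exponentials. *)

Definition grid_set (x : nat -> nat) (a j : nat) : nat -> nat :=
  fun i => if i == a then j else x i.
Definition grid_step (x : nat -> nat) (a : nat) : nat -> nat :=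
  grid_set x a (x a).+1.

(* The cup product of the coboundaries of the labels [ls], as a mod 2 cochain on the cube at [x] spanned by the directions [A]. *)
Fixpoint cup (ls : seq ((nat -> nat) -> 'F_2)) (A : seq nat) (x : nat -> nat)
  : 'F_2 :=
  if ls is l :: ls' then
    \sum_(a <- A) (l (grid_step x a) + l x) *
       cup ls' [seq b <- A | b != a] (grid_step x a)
  else 1.

Fixpoint box_sum (p : nat) (A : seq nat) (F : (nat -> nat) -> 'F_2)
  (x : nat -> nat) : 'F_2 :=
  if A is a :: A' then \sum_(j < p) box_sum p A' F (grid_set x a j) else F x.

Lemma grid_setxx x a j : grid_set x a j a = j.
Proof. by rewrite /grid_set eqxx. Qed.

Lemma addF2xx (x : 'F_2) : x + x = 0.
Proof. by apply: val_inj; case: x => [[|[|]]]. Qed.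

(** Each unordered pair of indices occurs twice, and 2 = 0. *)
Lemma sum_sym_F2 (A : seq nat) (F : nat -> nat -> 'F_2) :
  uniq A -> (forall a b, F a b = F b a) ->
  \sum_(a <- A) \sum_(b <- A | b != a) F a b = 0.
Proof.
move=> + Fsym; elim: A => [|c A IH] /=; first by rewrite big_nil.
move=> /andP[cA uA]; rewrite big_cons big_cons eqxx /=.
have -> : \sum_(a <- A) \sum_(b <- c :: A | b != a) F a b =
          \sum_(a <- A) F a c + \sum_(a <- A) \sum_(b <- A | b != a) F a b.
  rewrite -big_split /= big_seq [RHS]big_seq; apply: eq_bigr => a aA.
  rewrite big_cons; case: eqP => // ca; by rewrite ca aA in cA.
rewrite IH // addr0.
have -> : \sum_(b <- A | b != c) F c b = \sum_(a <- A) F a c.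
  rewrite [LHS]big_seq_cond [RHS]big_seq_cond.
  apply: eq_big => [b|b _]; last exact: Fsym.
  by rewrite andbT; case bA: (b \in A) => //=; apply: contraNneq cA => <-.
exact: addF2xx.
Qed.

Lemma grid_stepC x a b :
  grid_step (grid_step x a) b = grid_step (grid_step x b) a.
Proof.
apply: funext => i; rewrite /grid_step /grid_set /=.
case: (eqVneq b a) => [->|ba] //.
by case: (eqVneq i b) => // ->; rewrite (negbTE ba).
Qed.

Lemma filter_neqC (A : seq nat) a b :
  [seq d <- [seq d <- A | d != a] | d != b] =
  [seq d <- [seq d <- A | d != b] | d != a].
Proof. by rewrite -!filter_predI; apply: eq_filter => d /=; rewrite andbC. Qed.

(** Cocycle property: a product of coboundaries has zero coboundary; the two sides are its sums over
    the far and the near facets of the cube at [x]. Expanding one factor leaves sums over ordered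
    pairs of removed directions. Steps in two directions commute, so these sums are symmetric and
    cancel mod 2. *)
Lemma cup_closed ls (A : seq nat) x : uniq A ->
  \sum_(a <- A) cup ls [seq b <- A | b != a] (grid_step x a) =
  \sum_(a <- A) cup ls [seq b <- A | b != a] x.
Proof.
elim: ls A x => [//|l ls IH] A x uA /=.
pose C a b y := cup ls [seq d <- [seq d <- A | d != a] | d != b] y.
pose x1 a := grid_step x a. pose x2 a b := grid_step (x1 a) b.
have Cs a b y : C a b y = C b a y by rewrite /C filter_neqC.
have x2s a b : x2 a b = x2 b a by rewrite /x2 /x1 grid_stepC.
transitivity (\sum_(a <- A) \sum_(b <- A | b != a) l (x2 a b) * C a b (x2 a b) +
              \sum_(a <- A) \sum_(b <- A | b != a) l (x1 a) * C a b (x2 a b)).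
  rewrite -big_split; apply: eq_bigr => a _ /=.
  rewrite big_filter -big_split; apply: eq_bigr => b _ /=.
  by rewrite -mulrDl.
transitivity (\sum_(a <- A) \sum_(b <- A | b != a) l (x1 b) * C a b (x1 b) +
              \sum_(a <- A) \sum_(b <- A | b != a) l x * C a b (x1 b)); last first.
  rewrite -big_split; apply: eq_bigr => a _ /=.
  rewrite big_filter -big_split; apply: eq_bigr => b _ /=.
  by rewrite -mulrDl.
rewrite sum_sym_F2 // ?add0r; last by move=> a b; rewrite Cs x2s.
have IH' y a : \sum_(b <- A | b != a) C a b (grid_step y b) =
               \sum_(b <- A | b != a) C a b y.
  by rewrite -[LHS]big_filter -[RHS]big_filter; apply/IH/filter_uniq.
have -> : \sum_(a <- A) \sum_(b <- A | b != a) l x * C a b (x1 b) = 0.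
  transitivity (\sum_(a <- A) \sum_(b <- A | b != a) l x * C a b x).
    by apply: eq_bigr => a _; rewrite -[LHS]mulr_sumr IH' mulr_sumr.
  by apply: sum_sym_F2 => // a b; rewrite Cs.
rewrite addr0.
have -> : \sum_(a <- A) \sum_(b <- A | b != a) l (x1 b) * C a b (x1 b) =
          \sum_(b <- A) \sum_(a <- A | a != b) l (x1 b) * C b a (x1 b).
  transitivity (\sum_(a <- A) \sum_(b <- A) if b != a then l (x1 b) * C a b (x1 b) else 0).
    by apply: eq_bigr => a _; rewrite big_mkcond.
  rewrite exchange_big /=; apply: eq_bigr => b _; rewrite [RHS]big_mkcond.
  by apply: eq_bigr => a _; rewrite eq_sym Cs.
by apply: eq_bigr => a _; rewrite -!mulr_sumr IH'.
Qed.

Lemma box_sumD p A F G x :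
  box_sum p A (fun z => F z + G z) x = box_sum p A F x + box_sum p A G x.
Proof.
elim: A x => [//|a A IH] x /=.
by rewrite -big_split; apply: eq_bigr => j _.
Qed.

Lemma box_sum0 p A x : box_sum p A (fun=> 0) x = 0.
Proof. by elim: A x => [//|a A IH] x /=; rewrite big1. Qed.

Lemma box_sum_sum p A (I : Type) (r : seq I) (F : I -> (nat -> nat) -> 'F_2) x :
  box_sum p A (fun z => \sum_(i <- r) F i z) x =
  \sum_(i <- r) box_sum p A (F i) x.
Proof.
elim: r => [|i r IH].
  rewrite big_nil -[RHS](box_sum0 p A x); congr box_sum.
  by apply: funext => z; rewrite big_nil.
rewrite big_cons -IH -box_sumD; congr box_sum.
by apply: funext => z; rewrite big_cons.
Qed.

Lemma grid_setC x a b i j : a != b ->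
  grid_set (grid_set x a i) b j = grid_set (grid_set x b j) a i.
Proof.
move=> ab; apply: funext => k; rewrite /grid_set.
by case: (eqVneq k b) => // ->; rewrite eq_sym (negbTE ab).
Qed.

Lemma box_sum_set p A F a j x : a \notin A ->
  box_sum p A F (grid_set x a j) = box_sum p A (fun z => F (grid_set z a j)) x.
Proof.
elim: A x => [//|b A IH] x /=; rewrite inE negb_or => /andP[ab aA].
by apply: eq_bigr => i _; rewrite grid_setC // IH.
Qed.

Lemma telescope_F2 p (u : nat -> 'F_2) :
  \sum_(j < p) (u j.+1 + u j) = u p + u 0%N.
Proof.
elim: p => [|p IH]; first by rewrite big_ord0 addF2xx.
by rewrite big_ord_recr /= IH addrC -addrA (addrA (u p)) addF2xx add0r.
Qed.

(** Discrete Stokes formula in one direction: every inner layer occurs twice. *)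
Lemma box_sum_telescope p A a F x : uniq A -> a \in A ->
  box_sum p A (fun z => F (grid_step z a) + F z) x =
  box_sum p [seq b <- A | b != a]
    (fun z => F (grid_set z a p) + F (grid_set z a 0)) x.
Proof.
elim: A x => [//|c A IH] x /= /andP[cA uA]; rewrite inE.
case: (eqVneq a c) => [ac _|ac /= aA]; last by apply: eq_bigr => j _; rewrite IH.
rewrite -ac in cA *.
have -> : [seq b <- A | b != a] = A.
  by apply/all_filterP/allP => b bA; apply: contraNneq cA => <-.
under eq_bigr do rewrite box_sum_set //.
rewrite -box_sum_sum; congr box_sum; apply: funext => z.
rewrite -(telescope_F2 p (fun j => F (grid_set z a j))).
apply: eq_bigr => j _; congr (F _ + _); apply: funext => i.
by rewrite /grid_step /grid_set eqxx; case: eqP.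
Qed.

Lemma grid_step_other x a b : a != b -> grid_step x b a = x a.
Proof. by rewrite /grid_step /grid_set => /negbTE ->. Qed.

(** The cube spanned by [B] at [x] stays in the hyperplane where coordinate [a] equals [k]; there
    the label [a] is constant and its coboundary vanishes. *)
Lemma cup_const0 (lab : nat -> (nat -> nat) -> 'F_2) (A' B : seq nat) a v k x :
  a \in A' -> a \notin B -> x a = k -> (forall y, y a = k -> lab a y = v) ->
  cup [seq lab i | i <- A'] B x = 0.
Proof.
move=> aA' + + labv; elim: A' B x aA' => [//|c A' IH] B x; rewrite inE.
case: (eqVneq a c) => [<- _ aB xk|ac /= aA' aB xk];
  rewrite /= big_seq big1 // => b bB;
  have ab : a != b by apply: contraNneq aB => ->.
  by rewrite !labv ?grid_step_other // addF2xx mul0r.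
rewrite [X in _ * X]IH ?mulr0 ?grid_step_other //.
by rewrite mem_filter negb_and aB orbT.
Qed.

(** Induction on the dimension. The label of the first direction times the product of the other
    coboundaries is a primitive of the summand, so only boundary faces remain. On the faces of
    another direction the label of that direction is constant and kills the product; on the two
    faces of the first direction its label is 0 and 1, which leaves the sum in one dimension
    less. *)
Lemma box_sum_cup (lab : nat -> (nat -> nat) -> 'F_2) p A x : uniq A ->
  (forall i y, y i = 0%N -> lab i y = 0) ->
  (forall i y, y i = p -> lab i y = 1) ->
  box_sum p A (cup [seq lab i | i <- A] A) x = 1.
Proof.
move=> + lab0 labp; elim: A x => [//|k A IH] x uA.
have uA' : uniq A by case/andP: uA.
have kA : k \notin A by case/andP: uA.
pose Phi a z := lab k z * cup [seq lab i | i <- A] [seq b <- k :: A | b != a] z.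
transitivity (box_sum p (k :: A)
    (fun z => \sum_(a <- k :: A) (Phi a (grid_step z a) + Phi a z)) x).
  congr box_sum; apply: funext => z; rewrite map_cons.
  rewrite big_split /= -[X in _ = _ + X]mulr_sumr.
  rewrite -cup_closed // mulr_sumr -big_split /=.
  by apply: eq_bigr => a _; rewrite -mulrDl.
rewrite box_sum_sum.
have -> : \sum_(a <- k :: A) box_sum p (k :: A)
            (fun z => Phi a (grid_step z a) + Phi a z) x =
          \sum_(a <- k :: A) box_sum p [seq b <- k :: A | b != a]
            (fun z => Phi a (grid_set z a p) + Phi a (grid_set z a 0)) x.
  rewrite big_seq [RHS]big_seq; apply: eq_bigr => a aA.
  by rewrite box_sum_telescope.
rewrite big_cons [X in _ + X]big_seq [X in _ + X]big1 ?addr0; last first.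
  move=> a aA.
  have naB : a \notin [seq b <- k :: A | b != a] by rewrite mem_filter eqxx.
  rewrite -[RHS](box_sum0 p [seq b <- k :: A | b != a] x).
  congr box_sum; apply: funext => z; rewrite /Phi.
  rewrite (@cup_const0 _ _ _ a 1 p) ?grid_setxx //; last exact: labp.
  rewrite (@cup_const0 _ _ _ a 0 0) ?grid_setxx //; last exact: lab0.
  by rewrite !mulr0 addr0.
have AE : [seq b <- k :: A | b != k] = A.
  have fA : [seq b <- A | b != k] = A.
    by apply/all_filterP/allP => b bA; apply: contraNneq kA => <-.
  by rewrite -[RHS]fA /= ?eqxx.
rewrite AE -[RHS](IH (grid_set x k p)) // box_sum_set //.
congr box_sum; apply: funext => z; rewrite /Phi AE.
by rewrite labp ?lab0 ?mul1r ?mul0r ?addr0 ?grid_setxx.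
Qed.

Lemma box_sum_neq0 p A F x : uniq A -> box_sum p A F x != 0 ->
  exists y, [/\ F y != 0, forall i, i \in A -> (y i < p)%N &
                forall i, i \notin A -> y i = x i].
Proof.
elim: A x => [|a A IH] x /= uA; first by move=> Fx; exists x.
move=> s0; have [j sj] : exists j : 'I_p, box_sum p A F (grid_set x a j) != 0.
  apply/existsP; apply: contraNT s0; rewrite negb_exists => /forallP h.
  by rewrite big1 // => j _; apply/eqP; move: (h j); rewrite negbK.
case/andP: uA => aA uA; have [y [Fy yA ynA]] := IH _ uA sj.
exists y; split=> // i.
  rewrite inE => /orP[/eqP ->|]; last exact: yA.
  by rewrite ynA // /grid_set eqxx.
by rewrite inE negb_or => /andP[ia iA]; rewrite ynA // /grid_set (negbTE ia).
Qed.

(** A nonzero summand has a nonzero factor for each label, that is, an edge of the cube along which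
    this label changes. *)
Lemma cup_neq0 (lab : nat -> (nat -> nat) -> 'F_2) A' B y : uniq B ->
  cup [seq lab i | i <- A'] B y != 0 -> forall i, i \in A' ->
  exists u w, [/\ lab i u != lab i w,
    forall j, (y j <= u j <= y j + (j \in B))%N &
    forall j, (y j <= w j <= y j + (j \in B))%N].
Proof.
elim: A' B y => [//|c A' IH] B y uB /= s0 i.
have [b bB] : exists2 b, b \in B & (lab c (grid_step y b) + lab c y) *
    cup [seq lab i | i <- A'] [seq b' <- B | b' != b] (grid_step y b) != 0.
  apply/hasP; apply: contraNT s0 => /hasPn h; rewrite big_seq big1 // => b bB.
  by apply/eqP; move: (h b bB); rewrite negbK.
rewrite mulf_eq0 negb_or => /andP[lab_ne cup_ne].
have step_le j : (y j <= grid_step y b j <= y j + (j \in B))%N.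
  rewrite /grid_step /grid_set; case: eqP => [->|_].
    by rewrite bB addn1 leqnSn leqnn.
  by rewrite leqnn leq_addr.
rewrite inE => /orP[/eqP ->|iA'].
  exists (grid_step y b), y; split => // [|j]; last by rewrite leqnn leq_addr.
  by apply: contraNneq lab_ne => ->; rewrite addF2xx.
have [u [w [luw uP wP]]] := IH _ _ (filter_uniq _ uB) cup_ne i iA'.
have P v : (forall j, (grid_step y b j <= v j <=
      grid_step y b j + (j \in [seq b' <- B | b' != b]))%N) ->
    forall j, (y j <= v j <= y j + (j \in B))%N.
  move=> vP j; have := vP j; have := step_le j.
  rewrite mem_filter /grid_step /grid_set; case: eqP => [->|_] /=.
    rewrite addn0 bB => /andP[h1 h2] /andP[h3 h4].
    by rewrite (leq_trans h1 h3) (leq_trans h4 h2).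
  by move=> _ ->.
by exists u, w; split=> //; exact: P.
Qed.

(* Stokes' theorem for the closed cochain [cup]: its sum over the grid equals its boundary value 1, so some cube has both labels in every direction. *)
Lemma kuhn_cube (N p : nat) (lab : nat -> (nat -> nat) -> bool) :
  (forall i y, y i = 0%N -> lab i y = false) ->
  (forall i y, y i = p -> lab i y = true) ->
  exists y : nat -> nat, (forall i, (i < N)%N -> (y i < p)%N) /\
    forall i, (i < N)%N -> exists u w, [/\ lab i u, ~~ lab i w,
      forall j, (y j <= u j <= (y j).+1)%N & forall j, (y j <= w j <= (y j).+1)%N].
Proof.
move=> lab0 labp; pose labF i y : 'F_2 := if lab i y then 1 else 0.
have uA := iota_uniq 0 N.
have : box_sum p (iota 0 N) (cup [seq labF i | i <- iota 0 N] (iota 0 N))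
         (fun=> 0%N) != 0.
  rewrite box_sum_cup ?oner_neq0 // => i y.
    by move=> /lab0 labE; rewrite /labF labE.
  by move=> /labp labE; rewrite /labF labE.
move=> /(box_sum_neq0 uA)[y [cup_ne yp _]]; exists y; split=> [i iN|i iN].
  by apply: yp; rewrite mem_iota.
have [|u [w [luw uP wP]]] := cup_neq0 uA cup_ne (i := i).
  by rewrite mem_iota.
have le v : (forall j, (y j <= v j <= y j + (j \in iota 0 N))%N) ->
    forall j, (y j <= v j <= (y j).+1)%N.
  move=> vP j; have /andP[-> h] /= := vP j; rewrite (leq_trans h) //.
  by rewrite -addn1 leq_add2l; case: (_ \in _).
move: luw; rewrite /labF; case lu: (lab i u); case lw: (lab i w); rewrite ?eqxx //.
  by move=> _; exists u, w; rewrite lu lw; split=> //; exact: le.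
by move=> _; exists w, u; rewrite lu lw; split=> //; exact: le.
Qed.

Lemma exists_natr_gt (R : realType) (x : R) : exists n : nat, x < n.+1%:R.
Proof.
exists (Num.bound `|x|); apply: (le_lt_trans (ler_norm x)).
by apply: (lt_le_trans (archi_boundP (normr_ge0 x))); rewrite ler_nat.
Qed.

Lemma approx_brouwer (R : realType) (N : nat) (M : R)
    (F : (nat -> R) -> nat -> R) :
  0 < M ->
  (forall v, (forall i, 0 <= v i <= M) -> forall i, 0 <= F v i <= M) ->
  (forall e, 0 < e -> exists2 d, 0 < d & forall v w,
     (forall i, 0 <= v i <= M) -> (forall i, 0 <= w i <= M) ->
     (forall i, (i < N)%N -> `|v i - w i| <= d) ->
     forall i, (i < N)%N -> `|F v i - F w i| <= e) ->
  forall e, 0 < e -> exists2 v, (forall i, 0 <= v i <= M) &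
    forall i, (i < N)%N -> `|F v i - v i| <= e.
Proof.
move=> M0 FM Fc e e0.
have e20 : 0 < e / 2 by rewrite divr_gt0.
have [d d0 Fd] := Fc _ e20.
have c0 : 0 < Num.min d (e / 2) by rewrite lt_min d0.
have [n Mn] := exists_natr_gt (M / Num.min d (e / 2)).
pose p := n.+1; pose s := M / p%:R.
have p0 : 0 < p%:R :> R by rewrite ltr0n.
have /andP[sd se] : (s <= d) && (s <= e / 2).
  by rewrite -le_min /s ler_pdivrMr // mulrC -ler_pdivrMr // ltW.
(* Labels are defined on all integer points, also beyond the grid; cutting at [p] keeps the
   corresponding points in the box. *)
pose pt (y : nat -> nat) i : R := (minn (y i) p)%:R * s.
have ptp y i : y i = p -> pt y i = M.
  by move=> yi; rewrite /pt yi minnn /s mulrC divfK // gt_eqF.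
have s0 : 0 <= s by rewrite divr_ge0 // ltW.
have ptM y i : 0 <= pt y i <= M.
  rewrite mulr_ge0 //= -[leRHS](ptp (fun=> p) 0%N) // ler_wpM2r // ler_nat.
  by rewrite minnn geq_minr.
(* The label says that [F] pushes coordinate [i] down. Its values on the faces 0 and [p] are imposed
   by [kuhn_cube]; they agree weakly with the sign of F - id because [F] maps the box into
   itself. *)
pose lab i y := (y i != 0%N) && ((y i == p) || (F (pt y) i < pt y i)).
have lab0 i y : y i = 0%N -> lab i y = false by rewrite /lab => ->.
have labp i y : y i = p -> lab i y = true by rewrite /lab => ->; rewrite eqxx.
have [y [yp yP]] := kuhn_cube N lab0 labp.
exists (pt y) => // i iN.
have close v : (forall j, (y j <= v j <= (y j).+1)%N) ->
    forall j, (j < N)%N -> `|pt y j - pt v j| <= s.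
  move=> vP j jN; rewrite /pt -mulrBl normrM (ger0_norm s0) ler_piMl //.
  have /andP[h1 h2] := vP j; have yj := yp j jN.
  rewrite distrC (minn_idPl (ltnW yj)) (minn_idPl (leq_trans h2 yj)) -natrB //.
  by rewrite normr_nat (ler_nat _ _ 1) leq_subLR addn1.
have [u [w [lu lw uP wP]]] := yP i iN.
have cu := close _ uP; have cw := close _ wP.
have Fu : `|F (pt y) i - F (pt u) i| <= e / 2.
  by apply: Fd => // j jN; apply: le_trans sd; exact: cu.
have Fw : `|F (pt y) i - F (pt w) i| <= e / 2.
  by apply: Fd => // j jN; apply: le_trans sd; exact: cw.
have Hu : F (pt u) i <= pt u i.
  case/andP: lu => _ /orP[/eqP up|/ltW //].
  by rewrite ptp //; case/andP: (FM _ (ptM u) i).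
have Hw : pt w i <= F (pt w) i.
  move: lw; rewrite /lab negb_and negbK => /orP[/eqP w0|].
    rewrite /pt w0 min0n mul0r; by case/andP: (FM _ (ptM w) i).
  by rewrite negb_or -leNgt => /andP[].
have {}cu := cu i iN; have {}cw := cw i iN.
move: Fu Fw cu cw; rewrite !ler_norml => /andP[a1 a2] /andP[b1 b2].
by move=> /andP[c1 c2] /andP[d1 d2]; apply/andP; split; lra.
Qed.

(** * Extraction of locally convergent subsequences *)

Definition rat_seq (R : realType) (i : nat) : R :=
  if unpickle i is Some q then ratr (q : rat) else 0.

Lemma rat_seq_dense (R : realType) (t e : R) : 0 < e ->
  exists i, `|t - rat_seq R i| < e.
Proof.
move=> e0; have /rat_in_itvoo[q] : t - e < t + e by lra.
rewrite in_itv /= => /andP[q1 q2]; exists (pickle q).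
rewrite /rat_seq pickleK ltr_norml; apply/andP; split; lra.
Qed.

Lemma ultra_bounded_lim (R : realType) (U : set_system nat) (UU : UltraFilter U)
    (x : nat -> R) (M : R) : (forall n, `|x n| <= M) ->
  exists l, forall e, 0 < e -> U [set n | `|x n - l| < e].
Proof.
move=> xM.
have UP : ProperFilter U by apply: ultra_proper.
have FA : (x @ U) `[-M, M]%classic.
  by apply: (@filterE _ U) => n /=; rewrite in_itv /= -ler_norml.
have [l [_ cl]] := segment_compact _ FA.
exists l => e e0; have [//|UC] := in_ultra_setVsetC [set n | `|x n - l| < e] UU.
have FC : (x @ U) (~` ball l e).
  apply: (@filterS _ U) UC => n /= h; apply: contra_not h.
  by rewrite /ball /= distrC.
by have [z [] ] := cl _ _ FC (nbhsx_ballx l e e0).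
Qed.

(** An ultrafilter at infinity yields a limit [u t] for all real [t] at once. Then [phi k] is chosen
    so that [y (phi k)] is close to [u] at the first [k] rationals, and the common Lipschitz
    constant carries the convergence to every [t]. *)
Lemma equilipschitz_subsequence (R : realType) (y : nat -> R -> R) (M L : R) :
  0 < L -> (forall n t, `|y n t| <= M) ->
  (forall n s t, `|y n s - y n t| <= L * `|s - t|) ->
  exists (phi : nat -> nat) (u : R -> R), (forall k, (k <= phi k)%N) /\
    forall t, y (phi k) t @[k --> \oo] --> u t.
Proof.
move=> L0 yM yL.
have [U [UU ooU]] := ultraFilterLemma (@eventually_filter).
have UP : ProperFilter U by apply: ultra_proper.
have /choice[u uP] t : exists l, forall e, 0 < e ->
    U [set n | `|y n t - l| < e] by exact: (ultra_bounded_lim UU (fun n => yM n t)).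
have uL s t : `|u s - u t| <= L * `|s - t|.
  apply/ler_addgt0Pr => e e0; have e20 : 0 < e / 2 by rewrite divr_gt0.
  have [n /= [h1 h2]] := filter_ex (filterI (uP s _ e20) (uP t _ e20)).
  have := yL n s t; move: h1 h2; rewrite ler_norml !ltr_norml.
  move=> /andP[a1 a2] /andP[b1 b2]; rewrite ler_norml.
  by move=> /andP[c1 c2]; apply/andP; split; lra.
have /choice[phi phiP] k : exists n, (k <= n)%N /\
    forall i, (i < k)%N -> `|y n (rat_seq R i) - u (rat_seq R i)| < k.+1%:R^-1.
  have Uall j : U [set n | forall i, (i < j)%N ->
      `|y n (rat_seq R i) - u (rat_seq R i)| < k.+1%:R^-1].
    elim: j => [|j IH]; first by apply: filterE.
    have k0 : 0 < k.+1%:R^-1 :> R by rewrite invr_gt0.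
    apply: filterS (filterI IH (uP (rat_seq R j) _ k0)) => n /= [h1 h2] i.
    by rewrite ltnS leq_eqVlt => /orP[/eqP ->|/h1].
  have Uk : U [set n | (k <= n)%N] by apply: ooU; exact: nbhs_infty_ge.
  by have [n [h1 h2]] := filter_ex (filterI Uk (Uall k)); exists n.
exists phi, u; split=> [k|t]; first by case: (phiP k).
apply/cvgrPdist_lt => e e0.
have d0 : 0 < e / (4 * L) by rewrite divr_gt0 // mulr_gt0.
have [i ti] := rat_seq_dense t d0.
have {}ti : L * `|t - rat_seq R i| < e / 4.
  rewrite mulrC -ltr_pdivlMr // (lt_le_trans ti) //.
  by rewrite -mulrA invfM.
have [m em] := exists_natr_gt (4 / e).
near=> k.
have [_ /(_ i)] := phiP k.
have ik : (i < k)%N by near: k; exact: nbhs_infty_gt.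
move=> /(_ ik) h.
have {}h : `|y (phi k) (rat_seq R i) - u (rat_seq R i)| < e / 4.
  apply: (lt_le_trans h); rewrite -[leRHS]invrK lef_pV2 ?posrE ?invr_gt0 //;
    last by rewrite divr_gt0.
  rewrite invf_div; apply: ltW; apply: (lt_le_trans em); rewrite ler_nat ltnS.
  by near: k; exact: nbhs_infty_ge.
have h1 := yL (phi k) t (rat_seq R i); have h2 := uL t (rat_seq R i).
move: h h1 h2; rewrite !ler_norml !ltr_norml.
move=> /andP[a1 a2] /andP[b1 b2] /andP[c1 c2]; apply/andP; split; lra.
Unshelve. all: by end_near. Qed.

(** * Weighted integrals and derivatives *)

Section RealIntegrable.
Variable R : realType.
Local Notation mu := (@lebesgue_measure R).
Variable D : set R.
Hypothesis mD : measurable D.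

Lemma integrable_funZ (f : R -> R) k : mu.-integrable D (fun s => (f s)%:E) ->
  mu.-integrable D (fun s => (k * f s)%:E).
Proof.
move=> fi; have : mu.-integrable D (fun s => k%:E * (f s)%:E)%E by exact: integrableZl.
by apply: eq_integrable => // s _; rewrite EFinM.
Qed.

Lemma integrable_funB (f g : R -> R) : mu.-integrable D (fun s => (f s)%:E) ->
  mu.-integrable D (fun s => (g s)%:E) ->
  mu.-integrable D (fun s => (f s - g s)%:E).
Proof.
move=> fi gi; have : mu.-integrable D (fun s => (f s)%:E - (g s)%:E)%E.
  exact: integrableB.
by apply: eq_integrable => // s _; rewrite EFinB.
Qed.

End RealIntegrable.

Section WeightedIntegral.
Variable R : realType.
Local Notation mu := (@lebesgue_measure R).
Variables (D : set R) (W : R -> R).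
Hypothesis mD : measurable D.
Hypothesis W0 : forall s, D s -> 0 <= W s.
Hypothesis iW : mu.-integrable D (fun s => (W s)%:E).
Implicit Types (u v : R -> R) (B e : R).

Lemma measurable_weight : measurable_fun D W.
Proof. by apply/measurable_EFinP; exact: measurable_int iW. Qed.

Lemma integrable_weightM u B : measurable_fun D u ->
  (forall s, D s -> `|u s| <= B) ->
  mu.-integrable D (fun s => (W s * u s)%:E).
Proof.
move=> um uB.
have iBW : mu.-integrable D (fun s => (B * W s)%:E) by exact: integrable_funZ.
apply: le_integrable iBW => //.
  by apply/measurable_EFinP; apply: measurable_funM => //; exact: measurable_weight.
move=> s Ds; rewrite lee_fin !normrM mulrC ler_wpM2r //.
by rewrite (le_trans (uB s Ds)) // ler_norm.
Qed.

Lemma le_weight_integral u v B C :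
  measurable_fun D u -> (forall s, D s -> `|u s| <= B) ->
  measurable_fun D v -> (forall s, D s -> `|v s| <= C) ->
  (forall s, D s -> u s <= v s) ->
  \int[mu]_(s in D) (W s * u s) <= \int[mu]_(s in D) (W s * v s).
Proof.
move=> um uB mv vC uv; apply: le_Rintegral => //.
- exact: integrable_weightM uB.
- exact: integrable_weightM vC.
- by move=> s Ds; rewrite ler_wpM2l ?W0 ?uv.
Qed.

Lemma weight_integral_cst k :
  \int[mu]_(s in D) (W s * k) = \int[mu]_(s in D) W s * k.
Proof. by rewrite RintegralZr. Qed.

Lemma weight_integralB_le u v B C e :
  measurable_fun D u -> (forall s, D s -> `|u s| <= B) ->
  measurable_fun D v -> (forall s, D s -> `|v s| <= C) ->
  (forall s, D s -> `|u s - v s| <= e) ->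
  `|\int[mu]_(s in D) (W s * u s) - \int[mu]_(s in D) (W s * v s)|
     <= \int[mu]_(s in D) W s * e.
Proof.
move=> um uB mv vC uv.
rewrite -RintegralB //; [|exact: integrable_weightM uB|exact: integrable_weightM vC].
have -> : \int[mu]_(s in D) (W s * u s - W s * v s) =
          \int[mu]_(s in D) (W s * (u s - v s)).
  by apply: eq_Rintegral => s _; rewrite mulrBr.
have mB : measurable_fun D (fun s => u s - v s) by exact: measurable_funB.
have iB := integrable_weightM mB uv.
apply: le_trans; first by apply: le_normr_Rintegral => //; exact: iB.
rewrite -weight_integral_cst; apply: le_Rintegral => //.
- apply: le_integrable iB => //.
    apply/measurable_EFinP; apply: measurableT_comp => //.
    by apply: measurable_funM => //; exact: measurable_weight.
  by move=> s Ds; rewrite /= normr_id.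
- apply: (@integrable_weightM (cst e) `|e|) => // s Ds.
- by move=> s Ds; rewrite normrM ger0_norm ?W0 // ler_wpM2l ?W0 ?uv.
Qed.

Lemma weight_integral_cvg (u : nat -> R -> R) v B :
  (forall n, measurable_fun D (u n)) -> (forall n s, D s -> `|u n s| <= B) ->
  (forall s, D s -> u n s @[n --> \oo] --> v s) ->
  \int[mu]_(s in D) (W s * u n s) @[n --> \oo] -->
  \int[mu]_(s in D) (W s * v s).
Proof.
move=> um uB uv.
have vB s : D s -> `|v s| <= B.
  move=> Ds; have cn : `|u n s| @[n --> \oo] --> `|v s| by apply: cvg_norm; exact: uv.
  by apply: (cvgr_to_le cn); apply: nearW => n; exact: uB.
have mv : measurable_fun D v by exact: measurable_fun_cvg uv.
apply: fine_cvg; rewrite fineK; last first.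
  by apply: integrable_fin_num (integrable_weightM mv vB).
apply: (@dominated_cvg _ _ _ mu D mD (fun n s => (W s * u n s)%:E)
  (fun s => (W s * v s)%:E) (fun s => (W s * B)%:E)) => //.
- move=> n; apply/measurable_EFinP; apply: measurable_funM.
    exact: measurable_weight.
  exact: um.
- move=> s Ds; apply: cvg_EFin; first exact: nearW.
  by apply: cvgMr; exact: uv.
- apply: (@integrable_weightM (cst B) `|B|) => //.
- by move=> n s Ds; rewrite lee_fin normrM ger0_norm ?W0 // ler_wpM2l ?W0 ?uB.
Qed.

End WeightedIntegral.

Section Calculus.
Variable R : realType.
Implicit Types (f g df dg : R -> R) (a b c t x y : R).

Lemma is_derive_funM f g t a b : is_derive t 1 f a -> is_derive t 1 g b ->
  is_derive t 1 (fun s => f s * g s) (a * g t + f t * b).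
Proof.
move=> fa gb; have h := is_deriveM fa gb.
by apply: is_derive_eq h _; rewrite /GRing.scale /=; ring.
Qed.

Lemma is_derive_funD f g t a b : is_derive t 1 f a -> is_derive t 1 g b ->
  is_derive t 1 (fun s => f s + g s) (a + b).
Proof. by move=> fa gb; exact: is_deriveD. Qed.

Lemma is_derive_funB f g t a b : is_derive t 1 f a -> is_derive t 1 g b ->
  is_derive t 1 (fun s => f s - g s) (a - b).
Proof. by move=> fa gb; exact: is_deriveB. Qed.

Lemma is_derive_funN f t a : is_derive t 1 f a ->
  is_derive t 1 (fun s => - f s) (- a).
Proof. by move=> fa; exact: is_deriveN. Qed.

Lemma is_derive_funZ f t a k : is_derive t 1 f a ->
  is_derive t 1 (fun s => k * f s) (k * a).
Proof. by move=> fa; exact: is_deriveZ. Qed.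

Lemma is_derive_fun_comp f g t a b : is_derive (g t) 1 f a ->
  is_derive t 1 g b -> is_derive t 1 (fun s => f (g s)) (a * b).
Proof. by move=> fa gb; exact: is_derive1_comp. Qed.

Lemma is_derive_fun_cst k t : is_derive t 1 (fun=> k : R) 0.
Proof. exact: is_derive_cst. Qed.

Lemma is_derive_fun_id t : is_derive t 1 (fun s : R => s) 1.
Proof. exact: is_derive_id. Qed.

Lemma is_derive_expZ a t : is_derive t 1 (fun s => expR (a * s)) (a * expR (a * t)).
Proof.
rewrite mulrC; apply: is_derive_fun_comp.
by have := is_derive_funZ a (is_derive_fun_id t); rewrite mulr1.
Qed.

Lemma is_derive_continuous f t a : is_derive t 1 f a -> {for t, continuous f}.
Proof.
by move=> [fd _]; apply: differentiable_continuous; exact/derivable1_diffP.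
Qed.

Lemma derive_continuous f df : (forall t, is_derive t 1 f (df t)) -> continuous f.
Proof. by move=> h t; exact: is_derive_continuous (h t). Qed.

Lemma derive1_eq f t a : is_derive t 1 f a -> derive1 f t = a.
Proof. by move=> h; rewrite derive1E derive_val. Qed.

Lemma mean_value f df a b : (forall t, is_derive t 1 f (df t)) -> a < b ->
  exists c, a < c < b /\ f b - f a = df c * (b - a).
Proof.
move=> fd ab.
have cf : {within `[a, b], continuous f}.
  by apply: continuous_subspaceT; exact: derive_continuous fd.
have [c cab ->] := MVT ab (fun x _ => fd x) cf.
by exists c; split=> //; move: cab; rewrite in_itv.
Qed.

Lemma derive_ge0_le f df a b : (forall t, is_derive t 1 f (df t)) ->
  (forall t, a < t < b -> 0 <= df t) -> a <= b -> f a <= f b.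
Proof.
move=> fd df0; rewrite le_eqVlt => /orP[/eqP -> //|ab].
have [c [cab fab]] := mean_value fd ab.
by rewrite -subr_ge0 fab mulr_ge0 ?df0 // subr_ge0 ltW.
Qed.

Lemma lipschitz_derive f df L : (forall t, is_derive t 1 f (df t)) ->
  (forall t, `|df t| <= L) -> forall s t, `|f s - f t| <= L * `|s - t|.
Proof.
move=> fd dL s t; case: (ltgtP s t) => [st|ts|->]; last by rewrite !subrr normr0 mulr0.
  have [c [_ ]] := mean_value fd st.
  by rewrite [`|f s - _|]distrC [`|s - _|]distrC => ->; rewrite normrM ler_wpM2r.
by have [c [_ ->]] := mean_value fd ts; rewrite normrM ler_wpM2r.
Qed.

Lemma is_derive_shift_fun f df d : (forall t, is_derive t 1 f (df t)) ->
  forall t, is_derive t 1 (fun s => f (s + d)) (df (t + d)).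
Proof.
move=> fd t; rewrite -[df _]mulr1; apply: is_derive_fun_comp.
by have := is_derive_funD (is_derive_fun_id t) (is_derive_fun_cst d t); rewrite addr0.
Qed.

Lemma is_derive_reflect f df : (forall t, is_derive t 1 f (df t)) ->
  forall t, is_derive t 1 (fun s => f (- s)) (- df (- t)).
Proof.
by move=> fd t; rewrite -mulrN1; apply: is_derive_fun_comp.
Qed.

(** [ddf] need not be continuous: a negative [ddf t0] is excluded through the sign of [df] just to
    the right of [t0] and the mean value theorem. *)
Lemma local_min_derive f df ddf t0 r : 0 < r ->
  (forall t, is_derive t 1 f (df t)) -> (forall t, is_derive t 1 df (ddf t)) ->
  (forall t, `|t - t0| < r -> f t0 <= f t) -> df t0 = 0 /\ 0 <= ddf t0.
Proof.
move=> r0 fd dfd fmin.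
have itvP t : t \in `]t0 - r, t0 + r[%R -> `|t - t0| < r.
  by rewrite in_itv /= ltr_distl.
have df0 : df t0 = 0.
  have h : is_derive t0 1 f 0.
    apply: (@derive1_at_min _ f (t0 - r) (t0 + r)); first lra.
    - by move=> t _; case: (fd t).
    - by rewrite in_itv /=; apply/andP; split; lra.
    - by move=> t /itvP; exact: fmin.
  by rewrite -(derive1_eq (fd t0)) (derive1_eq h).
split=> //; rewrite leNgt; apply/negP => dd0.
have [d d0 dfneg] : exists2 d, 0 < d & forall t, t0 < t < t0 + d -> df t < 0.
  have [dfder _] := dfd t0.
  have cv : (df (h + t0) - df t0) / h @[h --> 0^'] --> ddf t0.
    have := dfd t0 => -[dv <-]; move: dv => /cvg_ex[l].
    rewrite /derive; set F := (X in X @ _ --> _) => Fl.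
    have -> : (fun h => (df (h + t0) - df t0) / h) = F.
      by apply: funext => h; rewrite /F /= /GRing.scale /= mulr1 mulrC.
    by rewrite (cvg_lim _ Fl).
  have : \forall h \near 0^', (df (h + t0) - df t0) / h < 0 by exact: (cvgr_lt _ cv).
  move=> /nbhs_ballP[e /= e0 he]; exists e => // t /andP[t1 t2].
  have := he (t - t0); rewrite /ball /= sub0r normrN subrK df0 subr0.
  have tt : 0 < t - t0 by rewrite subr_gt0.
  rewrite gtr0_norm // ltrBlDl => /(_ t2); rewrite gt_eqF // => /(_ isT).
  by rewrite pmulr_llt0 // invr_gt0.
pose m := Num.min d r / 2.
have [m0 md mr] : [/\ 0 < m, m < d & m < r].
  have dr0 : 0 < Num.min d r by rewrite lt_min d0.
  have : Num.min d r <= d by rewrite ge_min lexx.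
  have : Num.min d r <= r by rewrite ge_min lexx orbT.
  by rewrite /m => h1 h2; split; lra.
have [|c [/andP[c1 c2] fE]] := @mean_value f df t0 (t0 + m) fd; first lra.
have c0 : df c < 0 by apply: dfneg; apply/andP; split; lra.
have : f t0 <= f (t0 + m) by apply: fmin; rewrite addrC addKr gtr0_norm.
rewrite -subr_ge0 fE addrC addKr leNgt => /negP; apply.
by rewrite nmulr_rlt0.
Qed.

End Calculus.

(** * The Green operator of y'' - c y' - ab y *)

Section Green.
Variable R : realType.
Local Notation mu := (@lebesgue_measure R).
Implicit Types (H : R -> R) (a b c d t z B C : R).

Lemma continuous_bounded_measurable (D : set R) H : continuous H ->
  measurable_fun D H.
Proof. by move=> cH; apply: measurable_funTS; exact: continuous_measurable_fun. Qed.

Lemma continuous_expZ a : continuous (fun s : R => expR (a * s)).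
Proof. exact: derive_continuous (is_derive_expZ a). Qed.

Lemma cvg_expNZ a : 0 < a -> expR (- (a * x)) @[x --> +oo] --> (0 : R).
Proof.
move=> a0.
apply: (@cvg_comp _ _ _ (fun x => a * x) (fun x => expR (- x)) _ (pinfty_nbhs R));
  last exact: cvgr_expR.
by apply: gt0_cvgMry => //; exact: cvg_id.
Qed.

Lemma integral_expNy a t : 0 < a ->
  (\int[mu]_(s in `]-oo, t]) (expR (a * s))%:E = (expR (a * t) / a)%:E)%E.
Proof.
move=> a0; rewrite -[t]opprK ge0_integration_by_substitutionNy; first last.
- by move=> x _; exact: expR_ge0.
- by apply: continuous_subspaceT; exact: continuous_expZ.
have dF (x : R) : is_derive x 1 (fun x : R => - (expR (- a * x) / a)) (expR (- a * x)).
  have := is_derive_funN (is_derive_funZ a^-1 (is_derive_expZ (- a) x)).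
  by rewrite mulNr mulrN opprK mulKf ?gt_eqF //; under eq_fun do rewrite mulrC.
rewrite (@ge0_continuous_FTC2y _ _ (fun x => - (expR (- a * x) / a)) _ 0).
- by rewrite EFinN oppeK add0e opprK mulrNN.
- by move=> x _; exact: expR_ge0.
- apply: continuous_subspaceT => x.
  have -> : (fun x0 : R => expR (a * x0)) \o -%R = (fun x => expR (- a * x)).
    by apply: funext => y /=; rewrite mulrN mulNr.
  exact: continuous_expZ.
- rewrite -[0](_ : - (0 / a) = 0); last by rewrite mul0r oppr0.
  apply: cvgN; apply: cvgMl.
  by under eq_fun do rewrite mulNr; exact: cvg_expNZ.
- by move=> x _; case: (dF x).
- by apply: cvg_at_right_filter; exact: is_derive_continuous (dF _).
- by move=> x _; rewrite (derive1_eq (dF x)) /= mulrN mulNr.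
Qed.

Lemma integrable_expNy a t : 0 < a ->
  mu.-integrable `]-oo, t] (fun s => (expR (a * s))%:E).
Proof.
move=> a0; apply/integrableP; split.
  apply/measurable_EFinP; apply: continuous_bounded_measurable => x.
  exact: continuous_expZ.
under eq_integral do rewrite gee0_abs ?lee_fin ?expR_ge0 //.
by rewrite integral_expNy // ltry.
Qed.

(** The bounded solution of w' + a w = H. *)
Definition exp_past a H t : R :=
  expR (- a * t) * \int[mu]_(s in `]-oo, t]) (expR (a * s) * H s).

(** The bounded solution of v' - a v = - H, by reversal of time. *)
Definition exp_future a H t : R := exp_past a (fun s => H (- s)) (- t).

(* [green a b H] is the bounded solution of y'' - (b - a) y' - a b y = - H. *)
Definition green a b H : R -> R := exp_future b (exp_past a H).

Section OneSided.
Variable a : R.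
Hypothesis a0 : 0 < a.

Let mD t : measurable (`]-oo, t] : set R). Proof. exact: measurable_itv. Qed.
Hint Extern 0 (is_true (0 <= expR _)) => exact: expR_ge0 : core.

Lemma exp_past_cst t k : exp_past a (fun=> k) t = k / a.
Proof.
rewrite /exp_past weight_integral_cst ?integrable_expNy //.
rewrite /Rintegral integral_expNy //= !mulrA -expRD mulNr addNr expR0 mul1r.
by rewrite mulrC.
Qed.

Lemma exp_past_le H1 H2 B C t : continuous H1 -> (forall s, `|H1 s| <= B) ->
  continuous H2 -> (forall s, `|H2 s| <= C) ->
  (forall s, H1 s <= H2 s) -> exp_past a H1 t <= exp_past a H2 t.
Proof.
move=> c1 H1B c2 H2C H12; rewrite ler_wpM2l ?expR_ge0 //.
apply: (@le_weight_integral _ _ _ _ _ _ _ _ B C) => //.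
- exact: integrable_expNy.
- exact: continuous_bounded_measurable.
- exact: continuous_bounded_measurable.
Qed.

Lemma exp_past_bound H B t : continuous H -> (forall s, `|H s| <= B) ->
  `|exp_past a H t| <= B / a.
Proof.
move=> cH HB; rewrite ler_norml -mulNr -!(exp_past_cst t).
have cc k : continuous (fun _ : R => k : R) by move=> k'; exact: cst_continuous.
apply/andP; split.
  apply: (@exp_past_le _ _ `|- B| B) => // s.
  by have := HB s; rewrite ler_norml => /andP[].
apply: (@exp_past_le _ _ B `|B|) => // s.
by have := HB s; rewrite ler_norml => /andP[].
Qed.

Lemma exp_past_cvg (H : nat -> R -> R) G B t :
  (forall n, continuous (H n)) -> (forall n s, `|H n s| <= B) ->
  (forall s, H n s @[n --> \oo] --> G s) ->
  exp_past a (H n) t @[n --> \oo] --> exp_past a G t.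
Proof.
move=> cH HB HG; apply: cvgMr.
apply: (@weight_integral_cvg _ _ _ _ _ _ H G B) => //.
- exact: integrable_expNy.
- by move=> n; exact: continuous_bounded_measurable.
Qed.

Lemma exp_past_derive H B : continuous H -> (forall s, `|H s| <= B) ->
  forall t, is_derive t 1 (exp_past a H) (H t - a * exp_past a H t).
Proof.
move=> cH HB t.
have iH u : mu.-integrable `]-oo, u] (EFin \o (fun s => expR (a * s) * H s)).
  apply: (@integrable_weightM _ _ _ _ _ _ B) => //.
  - exact: integrable_expNy.
  - exact: continuous_bounded_measurable.
have cI : {for t, continuous (fun s => expR (a * s) * H s)}.
  by apply: continuousM; [exact: continuous_expZ|exact: cH].
have [|d1 d2] := @continuous_FTC1 _ _ -oo%O t (t + 1) _ (iH _) (ltNyr _) cI.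
  by rewrite ltrDl.
have dI : is_derive t 1 (fun x => \int[mu]_(s in `]-oo, x]) (expR (a * s) * H s))
    (expR (a * t) * H t).
  by rewrite -d2 derive1E; exact: derivableP.
have h := is_derive_funM (is_derive_expZ (- a) t) dI.
apply: (is_derive_eq h).
rewrite /exp_past addrC mulrA -expRD mulNr addNr expR0 mul1r; congr (_ + _).
by rewrite !mulNr mulrA.
Qed.

(** The function exp (a t) p(t) is nondecreasing, and it cannot stay below a negative constant near
    -oo because [p] is bounded below. This principle replaces changes of variables in the integrals
    below. *)
Lemma comparisonL (p dp : R -> R) B :
  (forall t, is_derive t 1 p (dp t)) -> (forall t, 0 <= dp t + a * p t) ->
  (forall t, - B <= p t) -> forall t, 0 <= p t.
Proof.
move=> pd pa pB t; rewrite leNgt; apply/negP => pt.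
have qd (s : R) : is_derive s 1 (fun s : R => expR (a * s) * p s)
                          (a * expR (a * s) * p s + expR (a * s) * dp s).
  by apply: is_derive_funM => //; exact: is_derive_expZ.
have mono s : s <= t -> expR (a * s) * p s <= expR (a * t) * p t.
  apply: (derive_ge0_le qd) => x _.
  have -> : a * expR (a * x) * p x + expR (a * x) * dp x =
            expR (a * x) * (dp x + a * p x) by ring.
  by rewrite mulr_ge0 ?expR_ge0.
have : expR (- (a * x)) @[x --> +oo] --> (0 : R) by exact: cvg_expNZ.
have B0 : 0 < B by have := pB t; lra.
have k0 : 0 < - (expR (a * t) * p t) / B.
  by rewrite divr_gt0 // oppr_gt0 nmulr_llt0 // expR_gt0.
move=> /(cvgr_lt _) /(_ _ k0) small.
have : \forall x \near +oo, - t <= x.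
  by apply: nbhs_pinfty_ge; exact: num_real.
move=> big; have [x /= [h1 h2]] := filter_ex (filterI small big).
have xt : - x <= t by rewrite lerNl.
have := mono _ xt.
rewrite leNgt => /negP; apply; rewrite mulrN.
have h3 : - (expR (- (a * x)) * B) <= expR (- (a * x)) * p (- x).
  by rewrite -mulrN ler_wpM2l ?expR_ge0.
apply: (lt_le_trans _ h3); rewrite ltrNr.
by rewrite -ltr_pdivlMr.
Qed.

(** Both sides are bounded solutions of the same first-order equation, so [comparisonL] applies to
    their difference with either sign. *)
Lemma exp_past_shift H B d t : continuous H -> (forall s, `|H s| <= B) ->
  exp_past a H (t + d) = exp_past a (fun s => H (s + d)) t.
Proof.
move=> cH HB.
have cS : continuous (fun s => H (s + d)).
  move=> s; apply: continuous_comp; last exact: cH.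
  by apply: cvgD; [exact: cvg_id|exact: cvg_cst].
have dL := is_derive_shift_fun d (exp_past_derive cH HB).
have dR := exp_past_derive cS (fun s => HB _).
have Bnd s : `|exp_past a H (s + d) - exp_past a (fun s => H (s + d)) s| <= B / a + B / a.
  rewrite (le_trans (ler_normB _ _)) // lerD //; first exact: exp_past_bound.
  by apply: exp_past_bound => // x; exact: HB.
have h1 := comparisonL (fun s => is_derive_funB (dL s) (dR s)) (B := B / a + B / a).
have h2 := comparisonL (fun s => is_derive_funB (dR s) (dL s)) (B := B / a + B / a).
apply/eqP; rewrite eq_le -subr_ge0 -[X in _ && X]subr_ge0; apply/andP; split.
  apply: h2 => s; first by rewrite le_eqVlt; apply/orP; left; apply/eqP; ring.
  by have := Bnd s; rewrite distrC ler_norml => /andP[].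
apply: h1 => s; first by rewrite le_eqVlt; apply/orP; left; apply/eqP; ring.
by have := Bnd s; rewrite ler_norml => /andP[].
Qed.

(** The right-hand side is a nonnegative solution of w' + a w = C exp (z t), so that its difference
    with the left-hand side is bounded below as [comparisonL] requires. *)
Lemma exp_past_le_exp H B C z t : continuous H -> (forall s, `|H s| <= B) ->
  0 <= C -> 0 < a + z -> (forall s, H s <= C * expR (z * s)) ->
  exp_past a H t <= C / (a + z) * expR (z * t).
Proof.
move=> cH HB C0 az HC; rewrite -subr_ge0.
have pd s := is_derive_funB (is_derive_funZ (C / (a + z)) (is_derive_expZ z s))
                            (exp_past_derive cH HB s).
apply: (comparisonL pd (B := B / a)) => s.
  have -> : C / (a + z) * (z * expR (z * s)) - (H s - a * exp_past a H s) +
     a * (C / (a + z) * expR (z * s) - exp_past a H s) = C * expR (z * s) - H s.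
    by field; rewrite gt_eqF.
  by rewrite subr_ge0.
have := exp_past_bound s cH HB; rewrite ler_norml => /andP[_ h].
have : 0 <= C / (a + z) * expR (z * s).
  by rewrite mulr_ge0 ?expR_ge0 // divr_ge0 // ltW.
lra.
Qed.

End OneSided.

Lemma continuous_reflect H : continuous H -> continuous (fun s => H (- s)).
Proof. by move=> cH s; apply: continuous_comp; [exact: opp_continuous|exact: cH]. Qed.

Lemma continuous_shift H d : continuous H -> continuous (fun s => H (s + d)).
Proof.
move=> cH s; apply: continuous_comp; last exact: cH.
by apply: cvgD; [exact: cvg_id|exact: cvg_cst].
Qed.

Lemma comparisonR a (p dp : R -> R) B : 0 < a ->
  (forall t, is_derive t 1 p (dp t)) -> (forall t, dp t - a * p t <= 0) ->
  (forall t, - B <= p t) -> forall t, 0 <= p t.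
Proof.
move=> a0 pd pa pB t; rewrite -[t]opprK.
apply: (comparisonL a0 (is_derive_reflect pd) (B := B)) => s //.
by have := pa (- s); lra.
Qed.

Section TwoSided.
Variables a b : R.
Hypotheses (a0 : 0 < a) (b0 : 0 < b).
Variables (H : R -> R) (B : R).
Hypotheses (cH : continuous H) (HB : forall s, 0 <= H s <= B).

Let HBn s : `|H s| <= B.
Proof. by have /andP[h1 h2] := HB s; rewrite ger0_norm. Qed.

Lemma continuous_exp_past : continuous (exp_past a H).
Proof. exact: derive_continuous (exp_past_derive a0 cH HBn). Qed.

Lemma exp_past_itv t : 0 <= exp_past a H t <= B / a.
Proof.
have cc k : continuous (fun _ : R => k : R) by move=> k'; exact: cst_continuous.
apply/andP; split; last first.
  exact: le_trans (ler_norm _) (exp_past_bound a0 t cH HBn).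
rewrite -(mul0r a^-1) -(exp_past_cst a0 t).
by apply: (@exp_past_le _ a0 _ _ 0 B) => // s; [rewrite normr0|case/andP: (HB s)].
Qed.

Lemma exp_future_derive (U : R -> R) C : continuous U -> (forall s, `|U s| <= C) ->
  forall t, is_derive t 1 (exp_future b U) (b * exp_future b U t - U t).
Proof.
move=> cU UC t.
have h := is_derive_reflect
  (exp_past_derive b0 (continuous_reflect cU) (fun s => UC (- s))) t.
by apply: (is_derive_eq h); rewrite opprK opprB.
Qed.

Lemma green_derive t :
  is_derive t 1 (green a b H) (b * green a b H t - exp_past a H t).
Proof.
apply: (exp_future_derive (C := B / a)); first exact: continuous_exp_past.
by move=> s; exact: exp_past_bound.
Qed.

Lemma green_itv t : 0 <= green a b H t <= B / (a * b).
Proof.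
have cr := continuous_reflect continuous_exp_past.
have cc k : continuous (fun _ : R => k : R) by move=> k'; exact: cst_continuous.
have wB s := exp_past_bound a0 s cH HBn.
have e2 k := exp_past_cst b0 (- t) k.
apply/andP; split.
  rewrite -(mul0r b^-1) -e2.
  apply: (@exp_past_le _ b0 _ _ 0 (B / a)) => // s; first by rewrite normr0.
  by case/andP: (exp_past_itv (- s)).
rewrite invfM mulrA -e2.
apply: (@exp_past_le _ b0 _ _ (B / a) `|B / a|) => // s.
by case/andP: (exp_past_itv (- s)).
Qed.

Lemma green_derive2 t :
  is_derive t 1 (fun s => b * green a b H s - exp_past a H s)
   ((b - a) * (b * green a b H t - exp_past a H t) + a * b * green a b H t - H t).
Proof.
apply: (is_derive_eq (is_derive_funB (is_derive_funZ b (green_derive t))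
  (exp_past_derive a0 cH HBn t))).
ring.
Qed.

(** With y = [green a b H] and w = [exp_past a H], the function p = (a + b) y - w satisfies p' - b p
    = - H <= 0, hence p >= 0 by [comparisonR]; therefore - a y <= b y - w <= b y. *)
Lemma green_harnack t :
  `|b * green a b H t - exp_past a H t| <= (a + b) * green a b H t.
Proof.
have /andP[w0 wB] := exp_past_itv t; have /andP[y0 yB] := green_itv t.
have pd s := is_derive_funB (is_derive_funZ (a + b) (green_derive s))
  (exp_past_derive a0 cH HBn s).
have pB s : - (B / a) <= (a + b) * green a b H s - exp_past a H s.
  have /andP[_ h] := exp_past_itv s; have /andP[h' _] := green_itv s.
  have : 0 <= (a + b) * green a b H s by rewrite mulr_ge0 // addr_ge0 // ltW.
  by move: h; lra.
have := comparisonR b0 pd _ pB t.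
have K s : (a + b) * (b * green a b H s - exp_past a H s) -
  (H s - a * exp_past a H s) - b * ((a + b) * green a b H s - exp_past a H s) <= 0.
  have /andP[h _] := HB s.
  rewrite (_ : _ - _ = - H s) ?oppr_le0 //; ring.
move=> /(_ K) h; rewrite ler_norml; apply/andP; split; last first.
  by have := mulr_ge0 (ltW a0) y0; nra.
have := mulr_ge0 (ltW b0) y0; nra.
Qed.

(** For - a < z < b the exponential exp (z t) is an eigenfunction of the Green operator with
    eigenvalue 1 / ((a + z)(b - z)). *)
Lemma green_le_exp C z t : 0 <= C -> - a < z -> z < b ->
  (forall s, H s <= C * expR (z * s)) ->
  green a b H t <= C / ((a + z) * (b - z)) * expR (z * t).
Proof.
move=> C0 az zb HC.
have az' : 0 < a + z by lra.
have bz' : 0 < b + - z by lra.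
have := @exp_past_le_exp b b0 (fun s => exp_past a H (- s)) (B / a)
  (C / (a + z)) (- z) (- t) (continuous_reflect continuous_exp_past).
rewrite mulrNN invfM mulrA; apply=> //.
- by move=> s; exact: exp_past_bound.
- by rewrite divr_ge0 // ltW.
- by move=> s; rewrite mulNr -mulrN; exact: (exp_past_le_exp a0 _ cH HBn).
Qed.

Lemma green_shift d t : green a b H (t + d) = green a b (fun s => H (s + d)) t.
Proof.
rewrite /green /exp_future opprD.
rewrite (exp_past_shift b0 (B := B / a)); first last.
- by move=> s; exact: exp_past_bound.
- exact: continuous_reflect continuous_exp_past.
congr (exp_past b _ _); apply: funext => s.
by rewrite opprD opprK (exp_past_shift a0 _ _ cH HBn).
Qed.

End TwoSided.

Lemma green_cvg a b (H : nat -> R -> R) G B t : 0 < a -> 0 < b ->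
  (forall n, continuous (H n)) -> (forall n s, 0 <= H n s <= B) ->
  (forall s, H n s @[n --> \oo] --> G s) ->
  green a b (H n) t @[n --> \oo] --> green a b G t.
Proof.
move=> a0 b0 cH HB HG.
have HBn n s : `|H n s| <= B by have /andP[h1 h2] := HB n s; rewrite ger0_norm.
apply: (@exp_past_cvg b b0 (fun n s => exp_past a (H n) (- s)) _ (B / a)).
- by move=> n; apply: continuous_reflect; exact: continuous_exp_past (HB n).
- by move=> n s; exact: exp_past_bound.
- by move=> s; exact: (@exp_past_cvg a a0 H G B (- s) cH HBn HG).
Qed.

Lemma exp_past_dist a H1 H2 B e t : 0 < a ->
  continuous H1 -> (forall s, `|H1 s| <= B) ->
  continuous H2 -> (forall s, `|H2 s| <= B) ->
  (forall s, `|H1 s - H2 s| <= e) -> `|exp_past a H1 t - exp_past a H2 t| <= e / a.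
Proof.
move=> a0 c1 H1B c2 H2B He.
rewrite /exp_past -mulrBr normrM (ger0_norm (expR_ge0 _)).
rewrite -(exp_past_cst a0 t) /exp_past ler_wpM2l ?expR_ge0 //.
rewrite weight_integral_cst ?integrable_expNy //.
apply: (@weight_integralB_le _ _ _ _ _ _ _ _ B B) => //.
- exact: integrable_expNy.
- exact: continuous_bounded_measurable.
- exact: continuous_bounded_measurable.
Qed.

Lemma green_dist a b H1 H2 B e t : 0 < a -> 0 < b ->
  continuous H1 -> (forall s, 0 <= H1 s <= B) ->
  continuous H2 -> (forall s, 0 <= H2 s <= B) ->
  (forall s, `|H1 s - H2 s| <= e) ->
  `|green a b H1 t - green a b H2 t| <= e / (a * b).
Proof.
move=> a0 b0 c1 H1B c2 H2B He.
have n1 s : `|H1 s| <= B by have /andP[h1 h2] := H1B s; rewrite ger0_norm.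
have n2 s : `|H2 s| <= B by have /andP[h1 h2] := H2B s; rewrite ger0_norm.
rewrite invfM mulrA; apply: (@exp_past_dist _ _ _ (B / a)) => //.
- by apply: continuous_reflect; exact: continuous_exp_past H1B.
- by move=> s; exact: exp_past_bound.
- by apply: continuous_reflect; exact: continuous_exp_past H2B.
- by move=> s; exact: exp_past_bound.
- by move=> s; exact: (@exp_past_dist _ _ _ B).
Qed.

End Green.

(** * The profile operator and its approximate fixed points *)

Section Convolution.
Variable R : realType.
Local Notation mu := (@lebesgue_measure R).
Variable K : R -> R.
Hypothesis K0 : forall s, 0 <= K s.
Hypothesis iK : mu.-integrable setT (fun s => (K s)%:E).
Hypothesis K1 : \int[mu]_s K s = 1.
Variable d : R.

Definition conv (q : R -> R) (t : R) : R := \int[mu]_s (K s * q (t - s - d)).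

Lemma continuous_conv_arg (q : R -> R) (t : R) : continuous q ->
  continuous (fun s => q (t - s - d)).
Proof.
move=> cq s; apply: (@continuous_comp _ _ _ (fun s => t - s - d) q); last exact: cq.
apply: cvgB; last exact: cvg_cst.
by apply: cvgB; [exact: cvg_cst|exact: cvg_id].
Qed.

Lemma conv_cvg (q : nat -> R -> R) (v : R -> R) Q t :
  (forall n, continuous (q n)) -> (forall n s, `|q n s| <= Q) ->
  (forall s, q n s @[n --> \oo] --> v s) ->
  conv (q n) t @[n --> \oo] --> conv v t.
Proof.
move=> cq qQ qv.
apply: (@weight_integral_cvg _ setT K _ _ _ (fun n s => q n (t - s - d)) _ Q) => //.
by move=> n; apply: continuous_bounded_measurable; exact: continuous_conv_arg.
Qed.

Lemma continuous_conv (q : R -> R) Q : continuous q -> (forall s, `|q s| <= Q) ->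
  continuous (conv q).
Proof.
move=> cq qQ t; apply/(@cvg_nbhsP _ R^o) => w wt.
apply: (@weight_integral_cvg _ setT K _ _ _ (fun n s => q (w n - s - d)) _ Q) => //.
- by move=> n; apply: continuous_bounded_measurable; exact: continuous_conv_arg.
- move=> s _; apply: (@cvg_comp _ _ _ (fun n => w n - s - d) q _ (nbhs (t - s - d)));
    last exact: cq.
  by apply: cvgB; [apply: cvgB => //; exact: cvg_cst|exact: cvg_cst].
Qed.

Lemma conv_le (q1 q2 : R -> R) Q t : continuous q1 -> (forall s, `|q1 s| <= Q) ->
  continuous q2 -> (forall s, `|q2 s| <= Q) -> (forall s, q1 s <= q2 s) ->
  conv q1 t <= conv q2 t.
Proof.
move=> c1 q1Q c2 q2Q q12.
apply: (@le_weight_integral _ setT K _ _ _ _ _ Q Q) => //.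
- apply: continuous_bounded_measurable; exact: continuous_conv_arg.
- apply: continuous_bounded_measurable; exact: continuous_conv_arg.
Qed.

Lemma conv_cst k t : conv (fun=> k) t = k.
Proof. by rewrite /conv weight_integral_cst // K1 mul1r. Qed.

Lemma conv_itv (q : R -> R) l Q t : continuous q -> (forall s, l <= q s <= Q) ->
  l <= conv q t <= Q.
Proof.
move=> cq qQ; rewrite -[X in X <= _ <= _](conv_cst l t) -[X in _ <= _ <= X](conv_cst Q t).
have cc k : continuous (fun _ : R => k : R) by move=> k'; exact: cst_continuous.
have B s : `|q s| <= `|l| + `|Q|.
  have /andP[h1 h2] := qQ s; rewrite ler_norml.
  have := ler_norm Q; have := ler_norm (- l); rewrite normrN => h3 h4.
  have := normr_ge0 l; have := normr_ge0 Q => h5 h6.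
  by apply/andP; split; lra.
have ? : `|l| <= `|l| + `|Q| by rewrite lerDl.
have ? : `|Q| <= `|l| + `|Q| by rewrite lerDr.
by apply/andP; split; apply: (@conv_le _ _ (`|l| + `|Q|)) => // s; case/andP: (qQ s).
Qed.

Lemma conv_dist (q1 q2 : R -> R) Q e t :
  continuous q1 -> (forall s, `|q1 s| <= Q) ->
  continuous q2 -> (forall s, `|q2 s| <= Q) -> (forall s, `|q1 s - q2 s| <= e) ->
  `|conv q1 t - conv q2 t| <= e.
Proof.
move=> c1 q1Q c2 q2Q q12; rewrite -[leRHS]mul1r -K1.
apply: (@weight_integralB_le _ setT K _ _ _ _ _ Q Q) => //.
- apply: continuous_bounded_measurable; exact: continuous_conv_arg.
- apply: continuous_bounded_measurable; exact: continuous_conv_arg.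
Qed.

Lemma conv_shift (q : R -> R) e t : conv q (t + e) = conv (fun s => q (s + e)) t.
Proof. by apply: eq_Rintegral => s _; congr (_ * q _); ring. Qed.

End Convolution.

Section ProfileOperator.
Variable R : realType.
Local Notation mu := (@lebesgue_measure R).
Variable K : R -> R.
Hypothesis K0 : forall s, 0 <= K s.
Hypothesis iK : mu.-integrable setT (fun s => (K s)%:E).
Hypothesis K1 : \int[mu]_s K s = 1.
Variables (d a b Z L : R) (f : R -> R).
Hypotheses (a0 : 0 < a) (b0 : 0 < b) (Z0 : 0 < Z) (Lab : L <= a * b).
Hypothesis fL : forall x y, `|f x - f y| <= L * `|x - y|.
Hypothesis f0 : f 0 = 0.
Hypothesis fmono : forall x y, x <= y -> f x <= f y.

(** The equation p'' - (b - a) p' - f(p) + K * q = 0 reads p'' - (b - a) p' - a b p = -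
    [forcing p q], so its solutions are sought as fixed points p = [profile_op p q]. The delayed
    term [q] is a separate argument in order to be g(p), with or without a source. *)
Definition forcing (p q : R -> R) (t : R) : R := a * b * p t - f (p t) + conv K d q t.
Definition profile_op (p q : R -> R) : R -> R := green a b (forcing p q).

Definition admissible (p q : R -> R) : Prop :=
  [/\ continuous p, forall s, 0 <= p s <= Z, continuous q &
      forall s, 0 <= q s <= f Z].

Lemma lipschitz_continuous (u : R -> R) M :
  (forall x y, `|u x - u y| <= M * `|x - y|) -> continuous u.
Proof.
move=> uM x; apply/cvgrPdist_le => e e0.
have M0 : 0 < `|M| + 1 by rewrite ltr_wpDl.
near=> y; apply: (le_trans (uM x y)).
apply: (@le_trans _ _ ((`|M| + 1) * `|x - y|)).
  by rewrite ler_wpM2r // (le_trans (ler_norm M)) // lerDl.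
rewrite mulrC -ler_pdivlMr //; near: y.
by apply: cvgr_dist_le; [exact: cvg_id|rewrite divr_gt0].
Unshelve. all: by end_near. Qed.

Let cf : continuous f. Proof. exact: lipschitz_continuous fL. Qed.

Lemma continuous_forcing p q : admissible p q -> continuous (forcing p q).
Proof.
move=> [cp pZ cq qQ] t.
have cfp : {for t, continuous (fun s => f (p s))}.
  by apply: continuous_comp; [exact: cp|exact: cf].
have cpq : continuous (conv K d q).
  apply: (continuous_conv K0 iK (Q := f Z)) => // s.
  by have /andP[h1 h2] := qQ s; rewrite ger0_norm.
apply: (@continuousD _ _ _ (fun s => a * b * p s - f (p s)) (conv K d q));
  last exact: cpq.
apply: (@continuousB _ _ _ (fun s => a * b * p s) (fun s => f (p s))) => //.
by apply: continuousM; [exact: cst_continuous|exact: cp].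
Qed.

(** Since L <= a b, the map a b x - f x is nondecreasing on [0, Z]. Together with q <= f Z this
    makes the constant Z a supersolution. *)
Lemma reaction_itv x : 0 <= x <= Z -> 0 <= a * b * x - f x <= a * b * Z - f Z.
Proof.
move=> /andP[x0 xZ].
have h1 : f x <= L * x.
  have := fL x 0; rewrite f0 !subr0 (ger0_norm x0).
  exact: le_trans (ler_norm _).
have h2 : f Z - f x <= L * (Z - x).
  have := fL Z x; rewrite (@ger0_norm _ (Z - x)) ?subr_ge0 //.
  exact: le_trans (ler_norm _).
have h3 : L * x <= a * b * x by rewrite ler_wpM2r.
have h4 : L * (Z - x) <= a * b * (Z - x) by rewrite ler_wpM2r // subr_ge0.
by apply/andP; split; lra.
Qed.

Lemma forcing_itv p q : admissible p q -> forall t, 0 <= forcing p q t <= a * b * Z.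
Proof.
move=> [cp pZ cq qQ] t; have /andP[h1 h2] := reaction_itv (pZ t).
have /andP[h3 h4] := conv_itv K0 iK K1 d t cq qQ.
by rewrite /forcing; apply/andP; split; lra.
Qed.

Lemma profile_op_itv p q : admissible p q -> forall t, 0 <= profile_op p q t <= Z.
Proof.
move=> pq t; have /andP[-> h] := green_itv a0 b0 (continuous_forcing pq) (forcing_itv pq) t.
by rewrite (le_trans h) // mulrAC divff ?mul1r // gt_eqF // mulr_gt0.
Qed.

Definition profile_op_derivative p q t : R := b * profile_op p q t - exp_past a (forcing p q) t.

Lemma profile_op_derive p q : admissible p q ->
  forall t : R, is_derive t 1 (profile_op p q) (profile_op_derivative p q t).
Proof.
by move=> pq t; exact: (@green_derive _ a b a0 b0 _ _ (continuous_forcing pq) (forcing_itv pq) t).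
Qed.

Lemma profile_op_derive2 p q : admissible p q -> forall t : R,
  is_derive t 1 (profile_op_derivative p q)
    ((b - a) * profile_op_derivative p q t + a * b * profile_op p q t - forcing p q t).
Proof.
by move=> pq t; exact: (@green_derive2 _ a b a0 b0 _ _ (continuous_forcing pq) (forcing_itv pq) t).
Qed.

Lemma profile_op_harnack p q : admissible p q ->
  forall t, `|profile_op_derivative p q t| <= (a + b) * profile_op p q t.
Proof.
by move=> pq t; exact: (@green_harnack _ a b a0 b0 _ _ (continuous_forcing pq) (forcing_itv pq) t).
Qed.

Lemma profile_op_lipschitz p q : admissible p q ->
  forall s t, `|profile_op p q s - profile_op p q t| <= (a + b) * Z * `|s - t|.
Proof.
move=> pq; apply: (lipschitz_derive (profile_op_derive pq)) => t.
apply: (le_trans (profile_op_harnack pq t)); apply: ler_wpM2l.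
  by rewrite addr_ge0 // ltW.
by case/andP: (profile_op_itv pq t).
Qed.

(** Serves both for interpolated Brouwer points and for the vanishing source. The images are
    equi-Lipschitz even where the arguments [p n] are not, so the subsequence is extracted from the
    images; pointwise vanishing defects then suffice by dominated convergence. *)
Lemma profile_op_limit (p q : nat -> R -> R) (Gam : R -> R -> R) :
  (forall n, admissible (p n) (q n)) ->
  (forall t, continuous (Gam t)) ->
  (forall t, p n t - profile_op (p n) (q n) t @[n --> \oo] --> (0 : R)) ->
  (forall t, q n t - Gam t (p n t) @[n --> \oo] --> (0 : R)) ->
  exists (phi : nat -> nat) (u : R -> R), [/\ forall k, (k <= phi k)%N,
    forall t, profile_op (p (phi k)) (q (phi k)) t @[k --> \oo] --> u t,
    forall t, 0 <= u t <= Z,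
    forall s t, `|u s - u t| <= (a + b) * Z * `|s - t| &
    u = profile_op u (fun t => Gam t (u t))].
Proof.
move=> pq cG pt qG.
have L0 : 0 < (a + b) * Z by rewrite mulr_gt0 // addr_gt0.
have tZ n t : `|profile_op (p n) (q n) t| <= Z.
  by have /andP[h1 h2] := profile_op_itv (pq n) t; rewrite ger0_norm.
have [phi [u [phik uP]]] :=
  equilipschitz_subsequence L0 tZ (fun n => profile_op_lipschitz (pq n)).
have phioo : phi k @[k --> \oo] --> \oo.
  by apply/cvgnyPge => m; near=> k; apply: leq_trans (phik k);
    near: k; exact: nbhs_infty_ge.
have {}pu t : p (phi k) t @[k --> \oo] --> u t.
  have h : (p (phi k) t - profile_op (p (phi k)) (q (phi k)) t) @[k --> \oo] --> (0 : R).
    exact: (cvg_comp _ _ phioo (pt t)).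
  have : (p (phi k) t - profile_op (p (phi k)) (q (phi k)) t +
      profile_op (p (phi k)) (q (phi k)) t) @[k --> \oo] --> 0 + u t by exact: cvgD.
  by rewrite add0r; under eq_fun do rewrite subrK.
have {}qu t : q (phi k) t @[k --> \oo] --> Gam t (u t).
  have h : (q (phi k) t - Gam t (p (phi k) t)) @[k --> \oo] --> (0 : R).
    exact: (cvg_comp _ _ phioo (qG t)).
  have h' : Gam t (p (phi k) t) @[k --> \oo] --> Gam t (u t).
    by apply: (cvg_comp _ _ (pu t)); exact: cG.
  have : (q (phi k) t - Gam t (p (phi k) t) + Gam t (p (phi k) t))
      @[k --> \oo] --> 0 + Gam t (u t) by exact: cvgD.
  by rewrite add0r; under eq_fun do rewrite subrK.
exists phi, u; split=> //.
- move=> t; apply/andP; split.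
    apply: (cvgr_to_ge (uP t)); apply: nearW => k.
    by case/andP: (profile_op_itv (pq (phi k)) t).
  apply: (cvgr_to_le (uP t)); apply: nearW => k.
  by case/andP: (profile_op_itv (pq (phi k)) t).
- move=> s t.
  have h : `|profile_op (p (phi k)) (q (phi k)) s - profile_op (p (phi k)) (q (phi k)) t|
      @[k --> \oo] --> `|u s - u t| by apply: cvg_norm; exact: cvgB.
  apply: (cvgr_to_le h); apply: nearW => k.
  exact: (profile_op_lipschitz (pq (phi k))).
apply: funext => t; apply: (cvg_unique _ (uP t)) => //.
apply: (green_cvg a0 b0 (H := fun k => forcing (p (phi k)) (q (phi k)))
   (B := a * b * Z)) => [k|k|s].
- exact: continuous_forcing.
- exact: forcing_itv.
apply: cvgD; last first.
  apply: (@conv_cvg _ K K0 iK d _ _ (f Z)) => // [k|k x].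
    by case: (pq (phi k)).
  by have [_ _ _ /(_ x)/andP[h1 h2]] := pq (phi k); rewrite ger0_norm.
apply: cvgB; first by apply: cvgMr; exact: pu.
by apply: (cvg_comp _ _ (pu s)); exact: cf.
Unshelve. all: by end_near. Qed.

End ProfileOperator.

Section MinMax.
Variable R : realType.
Implicit Types x y z w e : R.

Lemma dist_min_le x y z w e : `|x - y| <= e -> `|z - w| <= e ->
  `|Num.min x z - Num.min y w| <= e.
Proof.
rewrite !ler_norml => /andP[h1 h2] /andP[h3 h4].
by apply/andP; split; case: (leP x z) => ?; case: (leP y w) => ?; lra.
Qed.

Lemma dist_max_le x y z w e : `|x - y| <= e -> `|z - w| <= e ->
  `|Num.max x z - Num.max y w| <= e.
Proof.
rewrite !ler_norml => /andP[h1 h2] /andP[h3 h4].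
by apply/andP; split; case: (leP x z) => ?; case: (leP y w) => ?; lra.
Qed.

Lemma continuous_fun_max (f g : R -> R) : continuous f -> continuous g ->
  continuous (fun t => Num.max (f t) (g t)).
Proof. by move=> cf cg x; apply: continuous_max; [exact: cf|exact: cg]. Qed.

Lemma continuous_fun_min (f g : R -> R) : continuous f -> continuous g ->
  continuous (fun t => Num.min (f t) (g t)).
Proof. by move=> cf cg x; apply: continuous_min; [exact: cf|exact: cg]. Qed.

End MinMax.

Section Interpolation.
Variable R : realType.
Variables (Z Lam : R) (E : R -> R).
Hypotheses (Z0 : 0 < Z) (Lam0 : 0 < Lam).
Hypotheses (cE : continuous E) (E0 : forall t, 0 <= E t).

(* McShane extension of the data v_i at the points [rat_seq R i], truncated by [Z] and [E]. *)
Fixpoint mcshane (N : nat) (v : nat -> R) (t : R) : R :=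
  if N is i.+1 then Num.min (mcshane i v t) (v i + Lam * `|t - rat_seq R i|)
  else Num.min Z (E t).

Lemma continuous_mcshane N v : continuous (mcshane N v).
Proof.
elim: N => [|N IH] /=.
  by apply: continuous_fun_min => // x; exact: cst_continuous.
apply: continuous_fun_min => // x.
apply: cvgD; first exact: cvg_cst.
apply: cvgMr; apply: cvg_norm.
by apply: cvgB; [exact: cvg_id|exact: cvg_cst].
Qed.

Lemma mcshane_ge0 N v t : (forall i, 0 <= v i) -> 0 <= mcshane N v t.
Proof.
move=> v0; elim: N => [|N IH] /=; first by rewrite le_min (ltW Z0) E0.
rewrite le_min IH /=.
by rewrite addr_ge0 // mulr_ge0 // ltW.
Qed.

Lemma mcshane_le N v t : mcshane N v t <= Num.min Z (E t).
Proof. by elim: N => [//|N IH] /=; rewrite ge_min IH. Qed.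

Lemma mcshane_leZ N v t : mcshane N v t <= Z.
Proof. by apply: (le_trans (mcshane_le N v t)); rewrite ge_min lexx. Qed.

Lemma mcshane_leE N v t : mcshane N v t <= E t.
Proof. by apply: (le_trans (mcshane_le N v t)); rewrite ge_min lexx orbT. Qed.

Lemma mcshane_ub N v t i : (i < N)%N ->
  mcshane N v t <= v i + Lam * `|t - rat_seq R i|.
Proof.
elim: N => [//|N IH]; rewrite ltnS leq_eqVlt => /orP[/eqP ->|iN] /=.
  by rewrite ge_min lexx orbT.
by rewrite ge_min IH.
Qed.

Lemma mcshane_lb N v t x : x <= Z -> x <= E t ->
  (forall i, (i < N)%N -> x <= v i + Lam * `|t - rat_seq R i|) ->
  x <= mcshane N v t.
Proof.
move=> xZ xE; elim: N => [_|N IH h] /=; rewrite le_min ?xZ //.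
by rewrite IH ?h // => i iN; apply: h; exact: ltnW.
Qed.

Lemma mcshane_dist N v w t e : 0 <= e -> (forall i, (i < N)%N -> `|v i - w i| <= e) ->
  `|mcshane N v t - mcshane N w t| <= e.
Proof.
move=> e0; elim: N => [_|N IH h] /=; first by rewrite subrr normr0.
apply: dist_min_le; first by apply: IH => i iN; apply: h; exact: ltnW.
by rewrite opprD addrACA subrr addr0; exact: h.
Qed.

End Interpolation.

(** * Fixed points of the profile operator from finitely many nodes *)

Section FixedPoint.
Variable R : realType.
Local Notation mu := (@lebesgue_measure R).
Variable K : R -> R.
Hypothesis K0 : forall s, 0 <= K s.
Hypothesis iK : mu.-integrable setT (fun s => (K s)%:E).
Hypothesis K1 : \int[mu]_s K s = 1.
Variables (d a b Z L : R) (f g m E : R -> R).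
Hypotheses (a0 : 0 < a) (b0 : 0 < b) (Z0 : 0 < Z) (L0 : 0 <= L) (Lab : L <= a * b).
Hypothesis fL : forall x y, `|f x - f y| <= L * `|x - y|.
Hypothesis f0 : f 0 = 0.
Hypothesis g_uc : forall e : R, 0 < e -> exists2 r : R, 0 < r &
  forall x y, `|x - y| <= r -> `|g x - g y| <= e.
Hypothesis gZ : forall x, 0 <= g x <= f Z.
Hypotheses (cm : continuous m) (mZ : forall t, 0 <= m t <= f Z).
Hypotheses (cE : continuous E) (E0 : forall t, 0 <= E t).
Local Notation opK := (profile_op K d a b f).
Let Gam (p : R -> R) (t : R) := Num.max (g (p t)) (m t).
Hypothesis op_leE : forall p : R -> R, continuous p -> (forall s, 0 <= p s <= Z) ->
  (forall s, p s <= E s) -> forall t, opK p (Gam p) t <= E t.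

Let cg : continuous g.
Proof.
move=> x; apply/cvgrPdist_le => e /g_uc[r r0 gr]; near=> y.
by apply: gr; near: y; apply: cvgr_dist_le => //; exact: cvg_id.
Unshelve. all: by end_near. Qed.

Let admissible_Gam (p : R -> R) : continuous p -> (forall s, 0 <= p s <= Z) ->
  admissible Z f p (Gam p).
Proof.
move=> cp pZ; split=> //.
  apply: continuous_fun_max => // s.
  by apply: continuous_comp; [exact: cp|exact: cg].
move=> s; rewrite le_max ge_max; have /andP[-> ->] := gZ (p s).
by case/andP: (mZ s).
Qed.

Let top_uc (e : R) : 0 < e -> exists2 r : R, 0 < r & forall p1 p2 : R -> R,
  continuous p1 -> (forall s, 0 <= p1 s <= Z) ->
  continuous p2 -> (forall s, 0 <= p2 s <= Z) ->
  (forall s, `|p1 s - p2 s| <= r) ->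
  forall t, `|opK p1 (Gam p1) t - opK p2 (Gam p2) t| <= e.
Proof.
move=> e0; have ab0 : 0 < a * b by rewrite mulr_gt0.
have e1 : 0 < e * (a * b) / 2 by rewrite divr_gt0 // mulr_gt0.
have [r1 r10 gr] := g_uc e1.
have M0 : 0 < 2 * (a * b + L) + 1.
  by apply: ltr_wpDl => //; rewrite mulr_ge0 // addr_ge0 // ltW.
(* The local terms cost at most (a b + L) r2 <= e a b / 2, the convolution the other half. *)
pose r2 := e * (a * b) / (2 * (a * b + L) + 1).
have r20 : 0 < r2 by rewrite divr_gt0 // mulr_gt0.
have r2E : r2 * (2 * (a * b + L) + 1) = e * (a * b).
  by rewrite /r2 divfK // gt_eqF.
exists (Num.min r1 r2); first by rewrite lt_min r10.
move=> p1 p2 c1 p1Z c2 p2Z p12 t.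
have A1 := admissible_Gam c1 p1Z; have A2 := admissible_Gam c2 p2Z.
rewrite -[e](@mulfK _ (a * b)) ?gt_eqF //.
apply: (green_dist (B := a * b * Z)) => //.
- exact: (continuous_forcing K0 iK fL A1).
- exact: (forcing_itv K0 iK K1 d Lab fL f0 A1).
- exact: (continuous_forcing K0 iK fL A2).
- exact: (forcing_itv K0 iK K1 d Lab fL f0 A2).
move=> s; have := p12 s; rewrite le_min => /andP[h1 h2].
have hf := fL (p1 s) (p2 s).
have hc : `|conv K d (Gam p1) s - conv K d (Gam p2) s| <= e * (a * b) / 2.
  case: A1 => _ _ cq1 q1Z; case: A2 => _ _ cq2 q2Z.
  apply: (@conv_dist _ K K0 iK K1 d _ _ (f Z)) => //.
  - by move=> x; have /andP[h3 h4] := q1Z x; rewrite ger0_norm.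
  - by move=> x; have /andP[h3 h4] := q2Z x; rewrite ger0_norm.
  - move=> x; apply: dist_max_le; last by rewrite subrr normr0 ltW.
    by apply: gr; apply: (le_trans (p12 x)); rewrite ge_min lexx.
have hp : a * b * `|p1 s - p2 s| <= a * b * r2 by rewrite ler_wpM2l // ltW.
have hf' : `|f (p1 s) - f (p2 s)| <= L * r2.
  by apply: (le_trans hf); rewrite ler_wpM2l.
have hp' : `|a * b * p1 s - a * b * p2 s| <= a * b * r2.
  by rewrite -mulrBr normrM (gtr0_norm ab0).
move: hc hf' hp'; rewrite /forcing !ler_norml.
move=> /andP[u1 u2] /andP[v1 v2] /andP[w1 w2].
by apply/andP; split; nra.
Qed.

(** Brouwer's theorem acts on the values at the first [N] rationals through their McShane
    interpolant. The slope [Lam] is a Lipschitz constant of all images; hence data that nearly match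
    an image at the nodes have an interpolant that nearly matches it at any given point once [N] is
    large, and [profile_op_limit] applies. *)
Lemma profile_op_fixed_point : exists u : R -> R, [/\ forall t, 0 <= u t <= Z,
  forall t, u t <= E t,
  forall s t, `|u s - u t| <= (a + b) * Z * `|s - t| &
  u = opK u (fun t => Num.max (g (u t)) (m t))].
Proof.
pose Lam := (a + b) * Z.
have Lam0 : 0 < Lam by rewrite mulr_gt0 // addr_gt0.
pose P N v := mcshane Z Lam E N v.
have cP N v : continuous (P N v) by exact: continuous_mcshane.
have PZ N v : (forall i, 0 <= v i <= Z) -> forall s, 0 <= P N v s <= Z.
  move=> vZ s; apply/andP; split; last exact: mcshane_leZ.
  by apply: mcshane_ge0 => // i; case/andP: (vZ i).
have top_P N v : (forall i, 0 <= v i <= Z) ->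
    forall t, 0 <= opK (P N v) (Gam (P N v)) t <= Z.
  move=> vZ; apply: (profile_op_itv K0 iK K1 d a0 b0 Lab fL f0).
  by apply: admissible_Gam => //; exact: PZ.
have /choice[v vP] N : exists v : nat -> R, (forall i, 0 <= v i <= Z) /\
    forall i, (i < N)%N ->
      `|opK (P N v) (Gam (P N v)) (rat_seq R i) - v i| <= N.+1%:R^-1.
  have [|||v vZ vN] := @approx_brouwer R N Z
     (fun v i => opK (P N v) (Gam (P N v)) (rat_seq R i)) Z0 _ _ N.+1%:R^-1.
  - by move=> v vZ i; exact: top_P.
  - move=> e /top_uc[r r0 tr]; exists r => // v w vZ wZ vw i iN.
    apply: tr => //; [exact: PZ|exact: PZ|].
    by move=> s; apply: mcshane_dist => //; exact: ltW.
  - by rewrite invr_gt0.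
  by exists v.
pose p N := P N (v N); pose u N := opK (p N) (Gam (p N)).
have pA N : admissible Z f (p N) (Gam (p N)).
  by apply: admissible_Gam; [exact: cP|exact: (PZ N (v N) (proj1 (vP N)))].
have uZ N t : 0 <= u N t <= Z := top_P N (v N) (proj1 (vP N)) t.
have uE N t : u N t <= E t.
  apply: op_leE => [|s|s]; first exact: cP.
    exact: (PZ N (v N) (proj1 (vP N)) s).
  exact: mcshane_leE.
have uL N s t : `|u N s - u N t| <= Lam * `|s - t|.
  exact: (profile_op_lipschitz K0 iK K1 d a0 b0 Lab fL f0 (pA N)).
have [|||phi [u' [_ uu' u'Z u'L u'E]]] := @profile_op_limit _ K K0 iK K1 d a b Z L f a0 b0 Z0 Lab fL f0
   p (fun N => Gam (p N)) (fun t y => Num.max (g y) (m t)) pA.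
- move=> t; apply: continuous_fun_max => // x; exact: cst_continuous.
- move=> t; apply/cvgrPdist_le => e e0.
  have d0 : 0 < e / (4 * Lam) by rewrite divr_gt0 // mulr_gt0.
  have [i ti] := rat_seq_dense t d0.
  have {}ti : Lam * `|t - rat_seq R i| < e / 4.
    by rewrite mulrC -ltr_pdivlMr // (lt_le_trans ti) // -mulrA invfM.
  have [k ek] := exists_natr_gt (4 / e).
  near=> N.
  have [_ vi] := vP N.
  have iN : (i < N)%N by near: N; exact: nbhs_infty_gt.
  have N4 : N.+1%:R^-1 <= e / 4.
    rewrite -[leRHS]invrK lef_pV2 ?posrE ?invr_gt0 //; last by rewrite divr_gt0.
    rewrite invf_div; apply: ltW; apply: (lt_le_trans ek); rewrite ler_nat ltnS.
    by near: N; exact: nbhs_infty_ge.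
  have vi' j : (j < N)%N -> `|u N (rat_seq R j) - v N j| <= e / 4.
    by move=> jN; exact: le_trans (vi j jN) N4.
  have h1 : p N t <= v N i + Lam * `|t - rat_seq R i| by exact: mcshane_ub.
  (* The interpolant is the largest function below [Z], [E] and the cones over the data; the image
     lowered by e / 4 is below all of them. *)
  have h2 : u N t - e / 4 <= p N t.
    have /andP[u1 u2] := uZ N t.
    apply: mcshane_lb => [||j jN].
    - by apply: (le_trans _ u2); lra.
    - by apply: (le_trans _ (uE N t)); lra.
    - have := vi' j jN; have := uL N t (rat_seq R j).
      by rewrite !ler_norml => /andP[_ x2] /andP[_ x4]; lra.
  have := vi' i iN; have := uL N t (rat_seq R i).
  rewrite sub0r normrN !ler_norml -/(p N) -/(u N) => /andP[x1 x2] /andP[x3 _].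
  by apply/andP; split; lra.
- by move=> t; under eq_fun do rewrite subrr; exact: cvg_cst.
exists u'; split=> // t.
by apply: (cvgr_to_le (uu' t)); apply: nearW => k; exact: uE.
Unshelve. all: by end_near. Qed.

End FixedPoint.

(** * Behaviour of solutions at infinity *)

Section Penalization.
Variable R : realType.
Implicit Types (B T x e c : R) (z dz ddz : R -> R).

(* Penalizing [z] by a small parabola centred at a late point produces a genuine minimum at which z' is small and z'' almost nonnegative. *)
Lemma eventually_gt_of_ode z dz ddz B c T x e :
  (forall t : R, is_derive t 1 z (dz t)) -> (forall t : R, is_derive t 1 dz (ddz t)) ->
  (forall t, `|z t| <= B) -> 0 < e ->
  (forall t, T <= t -> z t <= x -> ddz t - c * dz t <= - e) ->
  exists T', forall t, T' <= t -> x < z t.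
Proof.
move=> zd dzd zB e0 zx.
have B0 : 0 <= B by apply: le_trans (zB 0).
have c0 : 0 <= `|c| by [].
pose M := (2 * B + 1) * (2 + 2 * `|c|).
have [n nM] := exists_natr_gt (M / e).
pose D : R := n.+1%:R.
have D1 : 1 <= D by rewrite (ler_nat _ 1 n.+1).
have D0 : 0 < D by lra.
have DM : M < e * D by rewrite mulrC -ltr_pdivrMr.
(* k D^2 = 2 B + 1 exceeds the oscillation of [z], which keeps the minimum inside the window; a
   large [D] makes both k and k D small compared with [e]. *)
pose k := (2 * B + 1) / D ^+ 2.
have kD : k * D ^+ 2 = 2 * B + 1 by rewrite divfK // expf_neq0 // gt_eqF.
have k0 : 0 < k by rewrite divr_gt0 // ?exprn_gt0 //; lra.
have kD1 : k * D * D = 2 * B + 1 by rewrite -kD; ring.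
have kDM : 2 * k + 2 * `|c| * (k * D) < e.
  have h1 : k <= k * D by rewrite ler_pMr.
  have h2 : k * D * (2 + 2 * `|c|) < e.
    rewrite -(ltr_pM2r D0); apply: le_lt_trans DM.
    by rewrite mulrAC kD1.
  by lra.
exists (T + D) => t tT; rewrite ltNge; apply/negP => ztx.
pose F s := z s + k * ((s - t) * (s - t)).
have dq (s : R) : is_derive s 1 (fun s : R => s - t) 1.
  by have := is_derive_funB (is_derive_fun_id s) (is_derive_fun_cst t s); rewrite subr0.
have Fd (s : R) : is_derive s 1 F (dz s + k * (2 * (s - t))).
  apply: (is_derive_eq (is_derive_funD (zd s)
    (is_derive_funZ k (is_derive_funM (dq s) (dq s))))); ring.
have Fdd (s : R) : is_derive s 1 (fun s => dz s + k * (2 * (s - t))) (ddz s + k * 2).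
  apply: (is_derive_eq (is_derive_funD (dzd s)
    (is_derive_funZ k (is_derive_funZ 2 (dq s))))); ring.
have [||t1 t1I Fmin] := @EVT_min _ F (t - D) (t + D).
- lra.
- by apply: continuous_subspaceT; exact: derive_continuous Fd.
have Ft : F t1 <= z t.
  have := Fmin t; rewrite {2}/F subrr mulr0 mulr0 addr0; apply.
  by rewrite in_itv /=; apply/andP; split; lra.
move: t1I; rewrite in_itv /= => /andP[t1a t1b].
have sq0 : 0 <= (t1 - t) * (t1 - t) by rewrite -expr2 sqr_ge0.
have zt1x : z t1 <= x.
  apply: le_trans ztx; apply: le_trans Ft.
  by rewrite /F lerDl mulr_ge0 // ltW.
have t1D : `|t1 - t| < D.
  rewrite ltNge; apply/negP => tD.
  have : D ^+ 2 <= (t1 - t) * (t1 - t).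
    by rewrite -expr2 -[leRHS]real_normK ?num_real // ler_sqr ?nnegrE // ltW.
  rewrite -(ler_pM2l k0) kD => h.
  have := zB t1; have := zB t; rewrite !ler_norml => /andP[_ h1] /andP[h2 _].
  by move: Ft; rewrite /F; lra.
have [||df ddf] := @local_min_derive _ F _ _ t1 (D - `|t1 - t|) _ Fd Fdd.
- by rewrite subr_gt0.
- move=> s hs; apply: Fmin; rewrite in_itv /= -ler_distl.
  rewrite (_ : s - t = (s - t1) + (t1 - t)); last by ring.
  by rewrite (le_trans (ler_normD _ _)) //; lra.
have := zx t1 _ zt1x; have -> : T <= t1 by lra.
move=> /(_ isT); apply/negP; rewrite -ltNge.
have dzt : c * dz t1 <= 2 * `|c| * (k * D).
  have dzE : dz t1 = 2 * k * (t - t1) by lra.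
  have -> : c * dz t1 = 2 * k * (c * (t - t1)) by rewrite dzE; ring.
  have -> : 2 * `|c| * (k * D) = 2 * k * (`|c| * D) by ring.
  rewrite ler_pM2l; last by lra.
  apply: (le_trans (ler_norm _)); rewrite normrM ler_wpM2l //.
  by rewrite distrC ltW.
by move: ddf kDM; lra.
Qed.

End Penalization.

(** * Convolution with the kernel near +oo *)

Section KernelTail.
Variable R : realType.
Local Notation mu := (@lebesgue_measure R).
Variable K : R -> R.
Hypothesis K0 : forall s, 0 <= K s.
Hypothesis iK : mu.-integrable setT (fun s => (K s)%:E).
Hypothesis K1 : \int[mu]_s K s = 1.
Variable d : R.

Lemma integrable_kernel_itv r : mu.-integrable `[- r, r] (fun s => (K s)%:E).
Proof. by apply: integrableS iK. Qed.

Lemma kernel_mass_window e : 0 < e ->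
  exists2 r, 0 <= r & 1 - e <= \int[mu]_(s in `[- r, r]) K s.
Proof.
move=> e0.
have : \int[mu]_s (K s * \1_(`[- n%:R, n%:R]) s) @[n --> \oo] -->
       \int[mu]_s (K s * 1).
  apply: (@weight_integral_cvg _ setT K _ _ _
    (fun n => \1_(`[- n%:R, n%:R])) (fun=> 1) 1) => //.
  - by move=> n s _; rewrite indicE; case: (_ \in _); rewrite ?normr1 ?normr0.
  - move=> s _; apply/cvgrPdist_le => e' e'0; near=> n.
    rewrite indicE mem_set ?subrr ?normr0 ?ltW //= in_itv /= -ler_norml.
    apply: ltW; apply: (lt_le_trans (archi_boundP (normr_ge0 s))).
    by rewrite ler_nat; near: n; exact: nbhs_infty_ge.
rewrite (_ : \int[mu]_s (K s * 1) = 1); last first.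
  by rewrite -[RHS]K1; apply: eq_Rintegral => s _; rewrite mulr1.
move=> /cvgrPdist_le /(_ e e0) [n _ /(_ n (leqnn n)) /=].
rewrite ler_norml => /andP[_ h]; exists n%:R => //.
rewrite Rintegral_mkcond.
have -> : \int[mu]_x (K \_ `[(- n%:R), n%:R]) x =
          \int[mu]_s (K s * \1_(`[- n%:R, n%:R]) s).
  apply: eq_Rintegral => s _; rewrite patchE indicE.
  by case: (_ \in _); rewrite ?mulr1 ?mulr0.
lra.
Unshelve. all: by end_near. Qed.

Lemma conv_ge_window (q w : R -> R) Q B r t :
  continuous q -> (forall s, 0 <= q s <= Q) ->
  measurable_fun (`[- r, r]%classic : set R) w -> (forall s, `|s| <= r -> `|w s| <= B) ->
  (forall s, `|s| <= r -> w s <= q (t - s - d)) ->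
  \int[mu]_(s in `[- r, r]) (K s * w s) <= conv K d q t.
Proof.
move=> cq qQ mw wB wq.
have qB s : `|q s| <= Q by have /andP[h1 h2] := qQ s; rewrite ger0_norm.
have rP s : (`[- r, r]%classic : set R) s -> `|s| <= r by rewrite /= in_itv /= -ler_norml.
apply: (@le_trans _ _ (\int[mu]_(s in `[- r, r]) (K s * q (t - s - d)))).
  apply: (@le_weight_integral _ _ K _ _ _ _ _ B Q) => //.
  - exact: integrable_kernel_itv.
  - by move=> s /rP; exact: wB.
  - by apply: continuous_bounded_measurable; exact: continuous_conv_arg.
  - by move=> s /rP; exact: wq.
have iq : mu.-integrable setT (fun s => (K s * q (t - s - d))%:E).
  apply: (@integrable_weightM _ _ _ _ _ _ Q) => //.
  by apply: continuous_bounded_measurable; exact: continuous_conv_arg.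
rewrite /conv /Rintegral fine_le //.
- by apply: integrable_fin_num => //; exact: integrableS iq.
- exact: integrable_fin_num.
- apply: ge0_subset_integral => //; first exact: (measurable_int mu).
  by move=> s _; rewrite lee_fin mulr_ge0 //; case/andP: (qQ (t - s - d)).
Qed.

Lemma conv_tail_ge (q : R -> R) Q T gam e :
  continuous q -> (forall s, 0 <= q s <= Q) -> 0 <= gam ->
  (forall s, T <= s -> gam <= q s) -> 0 < e ->
  exists T', forall t, T' <= t -> gam - e <= conv K d q t.
Proof.
move=> cq qQ g0 qg e0.
(* At level [gam], losing the mass e / (gam + 1) costs at most [e]; the 1 covers gam = 0. *)
have e1 : 0 < e / (gam + 1) by rewrite divr_gt0 // ltr_wpDl.
have [r r0 rm] := kernel_mass_window e1.
exists (T + r + d) => t tT.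
have h : \int[mu]_(s in `[- r, r]) (K s * gam) <= conv K d q t.
  apply: (@conv_ge_window q (fun=> gam) Q `|gam| r t cq qQ) => // s.
  by rewrite ler_norml => /andP[_ h]; apply: qg; lra.
apply: le_trans h; rewrite weight_integral_cst //; last exact: integrable_kernel_itv.
have : (1 - e / (gam + 1)) * gam <= \int[mu]_(s in `[- r, r]) K s * gam.
  by rewrite ler_wpM2r.
apply: le_trans; rewrite mulrBl mul1r lerD2l lerN2 mulrAC ler_pdivrMr ?ltr_wpDl //.
by rewrite ler_wpM2l ?ltW // ltrDl.
Qed.

Lemma conv_tail_le (q : R -> R) Q T gam e :
  continuous q -> (forall s, 0 <= q s <= Q) -> gam <= Q ->
  (forall s, T <= s -> q s <= gam) -> 0 < e ->
  exists T', forall t, T' <= t -> conv K d q t <= gam + e.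
Proof.
move=> cq qQ gQ qg e0.
have cQ : continuous (fun s => Q - q s).
  by move=> s; apply: cvgB; [exact: cvg_cst|exact: cq].
have [||||T' T'P] := @conv_tail_ge (fun s => Q - q s) Q T (Q - gam) e cQ.
- by move=> s; have /andP[h1 h2] := qQ s; apply/andP; split; lra.
- by rewrite subr_ge0.
- by move=> s /qg; lra.
- by [].
exists T' => t /T'P.
have -> : conv K d (fun s => Q - q s) t = Q - conv K d q t.
  rewrite -[X in _ = X - _](conv_cst iK K1 d Q t) /conv -RintegralB //.
  - by apply: eq_Rintegral => s _; rewrite mulrBr.
  - exact: (@integrable_weightM _ _ _ _ iK (fun=> Q) `|Q|).
  - apply: (@integrable_weightM _ _ _ _ iK (fun s => q (t - s - d)) Q) => //.
      by apply: continuous_bounded_measurable; exact: continuous_conv_arg.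
    by move=> s _; have /andP[h1 h2] := qQ (t - s - d); rewrite ger0_norm.
lra.
Qed.

End KernelTail.

(** Convexity of u |-> exp (u w): at u = a >= 0 it lies above its secant through u = -1 and u =
    0. *)
Lemma expR_secant (R : realType) (a w : R) : 0 <= a ->
  1 + a * (1 - expR (- w)) <= expR (a * w).
Proof.
move=> a0; apply: le_trans (expR_ge1Dx (a * w)).
rewrite lerD2l ler_wpM2l // lerBlDr -lerBlDl.
by have := expR_ge1Dx (- w); lra.
Qed.

(** * Logarithmic slope of small solutions and decay at -oo *)

Section Dichotomy.
Variable R : realType.
Local Notation mu := (@lebesgue_measure R).
Variable K : R -> R.
Hypothesis K0 : forall s, 0 <= K s.
Hypothesis iK : mu.-integrable setT (fun s => (K s)%:E).
Hypothesis K1 : \int[mu]_s K s = 1.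
Variables (c d Lam Q fp0 gp0 z0 : R) (f g : R -> R).
Hypotheses (Lam0 : 0 < Lam) (fp00 : 0 < fp0) (fgp0 : fp0 < gp0) (z00 : 0 < z0).
Hypothesis cg : continuous g.
Hypothesis gQ : forall x, 0 <= g x <= Q.
Hypothesis f_near0 : forall e : R, 0 < e -> exists2 r : R, 0 < r &
  forall x : R, 0 <= x <= r -> f x <= (fp0 + e) * x.
Hypothesis g_near0 : forall e : R, 0 < e -> exists2 r : R, 0 < r &
  forall x : R, 0 <= x <= r -> (gp0 - e) * x <= g x.
Hypothesis iKz : mu.-integrable setT (fun s => (K s * expR (- (z0 * s)))%:E).
Hypothesis chi_z0 : z0 ^+ 2 - c * z0 - fp0 +
  gp0 * expR (- (z0 * d)) * \int[mu]_s (K s * expR (- (z0 * s))) <= 0.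

(** Convexity of the Laplace transform at z <= 0 < z0: the value at z lies above the secant through
    0 and z0, and the value at z0 is controlled by [chi_z0]. The window is there because the
    integral over the whole line may diverge at z. *)
Lemma laplace_window_neg (r z m : R) : z <= 0 ->
  m = \int[mu]_(s in `[- r, r]) K s ->
  gp0 * (m + (- z / z0) * m) - (- z / z0) * (fp0 + c * z0 - z0 ^+ 2) <=
  gp0 * \int[mu]_(s in `[- r, r]) (K s * expR (- z * (s + d))).
Proof.
have aux (x y u v : R) : x - y - u + v <= 0 -> v <= u + y - x by lra.
move=> z_le0 mE; set a := - z / z0.
have a0 : 0 <= a by rewrite divr_ge0 // ?oppr_ge0 // ltW.
have gp00 : 0 < gp0 by exact: lt_trans fgp0.
have iKr : mu.-integrable `[- r, r] (fun s => (K s)%:E) := integrable_kernel_itv iK r.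
have mX k : measurable_fun (`[- r, r]%classic : set R) (fun s => expR (k * (s + d))).
  apply: continuous_bounded_measurable => s.
  exact: (@continuous_shift _ (fun u => expR (k * u)) d (@continuous_expZ _ k) s).
have bE k s : (`[- r, r]%classic : set R) s ->
    `|expR (k * (s + d))| <= expR (`|k| * (r + `|d|)).
  rewrite /= in_itv /= -ler_norml => sr.
  rewrite ger0_norm ?expR_ge0 // ler_expR (le_trans (ler_norm _)) // normrM.
  by rewrite ler_wpM2l // (le_trans (ler_normD _ _)) // lerD2r.
have iE k : mu.-integrable `[- r, r] (fun s => (K s * expR (k * (s + d)))%:E).
  by apply: integrable_weightM (bE k).
pose I0 := \int[mu]_(s in `[- r, r]) (K s * expR (- z0 * (s + d))).
have I0le : gp0 * I0 <= fp0 + c * z0 - z0 ^+ 2.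
  have : gp0 * I0 <= gp0 * (expR (- (z0 * d)) * \int[mu]_s (K s * expR (- (z0 * s)))).
    rewrite ler_pM2l // -RintegralZl //.
    have -> : I0 = \int[mu]_(s in `[- r, r])
        (expR (- (z0 * d)) * (K s * expR (- (z0 * s)))).
      apply: eq_Rintegral => s _; rewrite [in RHS]mulrCA -expRD.
      by congr (_ * expR _); ring.
    have iz : mu.-integrable setT
        (fun s => (expR (- (z0 * d)) * (K s * expR (- (z0 * s))))%:E).
      exact: integrable_funZ.
    rewrite /Rintegral fine_le //.
    - by apply: integrable_fin_num => //; apply: integrableS iz.
    - exact: integrable_fin_num.
    apply: ge0_subset_integral => //.
      exact: (measurable_int mu).
    by move=> s _; rewrite lee_fin !mulr_ge0 ?expR_ge0.
  by move=> h; apply: (le_trans h); apply: aux; rewrite mulrA.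
have zE s : - z * (s + d) = a * (z0 * (s + d)).
  by rewrite mulrA /a divfK // gt_eqF.
have key : m + a * (m - I0) <= \int[mu]_(s in `[- r, r]) (K s * expR (- z * (s + d))).
  have -> : m + a * (m - I0) =
      \int[mu]_(s in `[- r, r]) (K s * (1 + a * (1 - expR (- z0 * (s + d))))).
    have iB : mu.-integrable `[- r, r]
        (fun s => (K s - K s * expR (- z0 * (s + d)))%:E).
      by apply: integrable_funB => //; exact: iE.
    have -> : m - I0 = \int[mu]_(s in `[- r, r]) (K s - K s * expR (- z0 * (s + d))).
      by rewrite mE RintegralB //; exact: iE.
    rewrite -RintegralZl // mE -RintegralD //; last exact: integrable_funZ.
    by apply: eq_Rintegral => s _; ring.
  apply: (@le_weight_integral _ _ K _ _ iKr _ _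
    (1 + a * (1 + expR (`|- z0| * (r + `|d|)))) (expR (`|- z| * (r + `|d|)))) => //.
  - apply: measurable_funD => //; apply: measurable_funM => //.
    exact: measurable_funB.
  - move=> s sr; rewrite (le_trans (ler_normD _ _)) // normr1 lerD2l normrM.
    rewrite (ger0_norm a0) ler_wpM2l // (le_trans (ler_normB _ _)) // normr1 lerD2l.
    exact: bE.
  - exact: bE.
  - by move=> s _; rewrite zE mulNr; exact: expR_secant.
have : gp0 * (m + a * (m - I0)) <=
       gp0 * \int[mu]_(s in `[- r, r]) (K s * expR (- z * (s + d))).
  by rewrite ler_pM2l.
apply: le_trans.
have : a * (gp0 * I0) <= a * (fp0 + c * z0 - z0 ^+ 2) by rewrite ler_wpM2l.
clearbody I0 a; lra.
Qed.

Lemma kernel_mass_le1 r : \int[mu]_(s in `[- r, r]) K s <= 1.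
Proof.
rewrite -K1 /Rintegral fine_le //.
- by apply: integrable_fin_num => //; exact: integrable_kernel_itv.
- exact: integrable_fin_num.
- apply: ge0_subset_integral => //; first exact: (measurable_int mu).
  by move=> s _; rewrite lee_fin.
Qed.

Lemma laplace_window_pos (r z m : R) : 0 <= z ->
  m = \int[mu]_(s in `[- r, r]) K s ->
  m * (1 - z * (r + `|d|)) <=
  \int[mu]_(s in `[- r, r]) (K s * expR (- z * (s + d))).
Proof.
move=> z_ge0 mE; rewrite mE -weight_integral_cst //; last exact: integrable_kernel_itv.
have sB s : (`[- r, r]%classic : set R) s -> `|s + d| <= r + `|d|.
  by rewrite /= in_itv /= -ler_norml => h; rewrite (le_trans (ler_normD _ _)) // lerD2r.
apply: (@le_weight_integral _ _ K _ _ _ _ _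
  `|1 - z * (r + `|d|)| (expR (z * (r + `|d|)))) => //.
- exact: integrable_kernel_itv.
- apply: continuous_bounded_measurable => s.
  exact: (@continuous_shift _ (fun u => expR (- z * u)) d (@continuous_expZ _ (- z)) s).
- move=> s /sB; rewrite ler_norml => /andP[h1 h2].
  rewrite ger0_norm ?expR_ge0 // ler_expR mulNr -mulrN ler_wpM2l //; lra.
- move=> s /sB; rewrite ler_norml => /andP[h1 h2].
  apply: le_trans (expR_ge1Dx _); rewrite lerD2l mulNr lerN2.
  by rewrite ler_wpM2l.
Qed.

(* A Gaussian of logarithmic slope [z] touching a small solution from below satisfies the linearized inequality chi(z) <= 0 up to small errors, which excludes z <= eps since chi is convex, positive at 0 and nonpositive at z0. *)
Lemma touching_slope : exists k eps B del : R,
  [/\ 0 < k, 0 < eps, 0 <= B, 0 < del &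
   forall (y : R -> R) (t1 dy1 ddy1 z : R), continuous y ->
   0 < y t1 -> dy1 = z * y t1 -> (z ^+ 2 - 2 * k) * y t1 <= ddy1 ->
   ddy1 = c * dy1 + f (y t1) - conv K d (fun s => g (y s)) t1 ->
   (forall x, `|x| <= B -> y (t1 - x) <= del) ->
   (forall x, `|x| <= B -> y t1 * expR (- (z * x) - k * x ^+ 2) <= y (t1 - x)) ->
   eps < z].
Proof.
have D0 : 0 < gp0 - fp0 by rewrite subr_gt0.
have fp0' : 0 < fp0 := fp00.
have gp00 : 0 < gp0 by exact: lt_trans fgp0.
(* The gap gp0 - fp0 pays for all errors: linearization and lost kernel mass ([eta]) take at most
   half of it, the Gaussian ([k]) a quarter, a positive slope up to [eps] at most an eighth. *)
pose eta := (gp0 - fp0) / (2 * (gp0 + 2)).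
have eta0 : 0 < eta by rewrite divr_gt0 // mulr_gt0 //; lra.
have etaE : 2 * eta * (gp0 + 2) = gp0 - fp0.
  by rewrite /eta; field; rewrite gt_eqF //; lra.
clearbody eta.
have eta1 : eta < 1 by rewrite -(ltr_pM2r (_ : 0 < gp0 + 2)); lra.
have gg0 : 0 < gp0 * gp0 by rewrite mulr_gt0.
have etag : eta < gp0 by rewrite -(ltr_pM2r (_ : 0 < gp0 + 2)); lra.
have [r r0 rm] := kernel_mass_window K0 iK K1 eta0.
set m := (X in _ <= X) in rm.
have m1 : m <= 1 by exact: kernel_mass_le1.
pose B := r + `|d|.
have B0 : 0 <= B by rewrite addr_ge0.
have B2 : 0 <= gp0 * B ^+ 2 by rewrite mulr_ge0 ?sqr_ge0 // ltW.
pose k := (gp0 - fp0) / (4 * (2 + gp0 * B ^+ 2)).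
have k0 : 0 < k by rewrite divr_gt0 // mulr_gt0 //; lra.
have kE : 2 * k + gp0 * (k * B ^+ 2) = (gp0 - fp0) / 4.
  by rewrite /k; field; rewrite gt_eqF //; lra.
clearbody k.
have cB0 : 0 <= `|c| + gp0 * B by rewrite addr_ge0 // mulr_ge0 // ltW.
pose eps := (gp0 - fp0) / (8 * (`|c| + gp0 * B + 1)).
have eps0 : 0 < eps by rewrite divr_gt0 // mulr_gt0 //; lra.
have epsE : (`|c| + gp0 * B + 1) * eps = (gp0 - fp0) / 8.
  by rewrite /eps; field; rewrite gt_eqF //; lra.
clearbody eps.
have [r1 r10 fr] := f_near0 eta0; have [r2 r20 gr] := g_near0 eta0.
exists k, eps, B, (Num.min r1 r2); split=> //; first by rewrite lt_min r10.
move=> y t1 dy1 ddy1 z cy y1 dyE ddyge ddyE ysmall ytouch.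
rewrite ltNge; apply/negP => zeps.
have ygt x : `|x| <= B -> 0 < y (t1 - x).
  by move=> /ytouch; apply: lt_le_trans; rewrite mulr_gt0 // expR_gt0.
have y1s : y t1 <= r1.
  have := ysmall 0; rewrite normr0 subr0 => /(_ B0)/le_trans; apply.
  by rewrite ge_min lexx.
have f1 : f (y t1) <= (fp0 + eta) * y t1 by apply: fr; rewrite (ltW y1) y1s.
pose ek := expR (- (k * B ^+ 2)).
have ek1 : ek <= 1 by rewrite expR_le1 oppr_le0 mulr_ge0 ?sqr_ge0 // ltW.
have ekge : 1 - k * B ^+ 2 <= ek := expR_ge1Dx _.
have ek0 : 0 < ek := expR_gt0 _.
(* [A] stands for gp0 on the window: [eta] comes from the linearization of [g], and [ek] is the
   smallest value of the Gaussian factor. *)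
pose A := (gp0 - eta) * ek.
have A0 : 0 < A by rewrite mulr_gt0 // subr_gt0.
have Ag : A <= gp0.
  have : A <= (gp0 - eta) * 1 by rewrite ler_wpM2l // subr_ge0 ltW.
  by lra.
pose J := \int[mu]_(s in `[- r, r]) (K s * expR (- z * (s + d))).
have mz : measurable_fun (`[- r, r]%classic : set R) (fun s => expR (- z * (s + d))).
  apply: continuous_bounded_measurable => s.
  exact: (@continuous_shift _ (fun u => expR (- z * u)) d (@continuous_expZ _ (- z)) s).
have sB s : `|s| <= r -> `|s + d| <= B.
  by move=> h; rewrite (le_trans (ler_normD _ _)) // lerD2r.
have bz s : `|s| <= r -> `|expR (- z * (s + d))| <= expR (`|z| * B).
  move=> /sB h; rewrite ger0_norm ?expR_ge0 // ler_expR (le_trans (ler_norm _)) //.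
  by rewrite normrM normrN ler_wpM2l.
have convge : A * y t1 * J <= conv K d (fun s => g (y s)) t1.
  have -> : A * y t1 * J =
      \int[mu]_(s in `[- r, r]) (K s * (A * y t1 * expR (- z * (s + d)))).
    rewrite -RintegralZl //.
      by apply: eq_Rintegral => s _; rewrite mulrCA.
    apply: (integrable_weightM _ (integrable_kernel_itv iK r) mz
      (B := expR (`|z| * B))) => // s.
    by rewrite /= in_itv /= -ler_norml; exact: bz.
  apply: (@conv_ge_window _ K K0 iK d _ _ Q (A * y t1 * expR (`|z| * B))).
  - by move=> s; apply: continuous_comp; [exact: cy|exact: cg].
  - by move=> s; exact: gQ.
  - exact: measurable_funM.
  - move=> s sr; rewrite normrM (ger0_norm (mulr_ge0 (ltW A0) (ltW y1))).
    by apply: ler_wpM2l; [rewrite mulr_ge0 // ltW|exact: bz].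
  move=> s /sB sd; have -> : t1 - s - d = t1 - (s + d) by ring.
  apply: (@le_trans _ _ ((gp0 - eta) * y (t1 - (s + d)))); last first.
    apply: gr; rewrite (ltW (ygt _ sd)) /= (le_trans (ysmall _ sd)) //.
    by rewrite ge_min lexx orbT.
  rewrite /A -!mulrA ler_wpM2l ?subr_ge0 ?(ltW etag) //.
  apply: le_trans (ytouch _ sd).
  rewrite mulrCA ler_wpM2l ?(ltW y1) // /ek -expRD ler_expR addrC mulNr lerD2l.
  rewrite lerN2 ler_wpM2l ?(ltW k0) // -[leLHS]real_normK ?num_real //.
  by rewrite ler_sqr // nnegrE.
have Am : (gp0 - fp0) / 4 <= A * m - fp0 - eta - 2 * k.
  have h1 : (gp0 - eta) * (1 - k * B ^+ 2) <= A.
    by rewrite ler_wpM2l // subr_ge0 ltW.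
  have h2 : A * (1 - eta) <= A * m by rewrite ler_wpM2l // ltW.
  have h3 : (gp0 - eta) * (1 - k * B ^+ 2) * (1 - eta) <= A * (1 - eta).
    by rewrite ler_wpM2r // subr_ge0 ltW.
  have kB0 : 0 <= k * B ^+ 2 by rewrite mulr_ge0 ?sqr_ge0 // ltW.
  have h4 : (gp0 - eta) * (1 - eta) - gp0 * (k * B ^+ 2) <=
            (gp0 - eta) * (1 - k * B ^+ 2) * (1 - eta).
    have : (gp0 - eta) * (1 - eta) <= gp0 by nra.
    by move=> h; have := ler_wpM2r kB0 h; lra.
  have eta20 : 0 <= eta * eta by rewrite mulr_ge0 // ltW.
  have h5 : (gp0 - fp0) / 2 <= (gp0 - eta) * (1 - eta) - fp0 - eta by lra.
  lra.
have S0 : 0 < z ^+ 2 - 2 * k - c * z - fp0 - eta + A * J.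
  case: (leP z 0) => [z_le0|z_gt0].
    have := @laplace_window_neg r z m z_le0 erefl.
    rewrite -/J; set W := fp0 + c * z0 - z0 ^+ 2; set al := - z / z0 => hJ.
    have al0 : 0 <= al by rewrite divr_ge0 // ?oppr_ge0 // ltW.
    have zE : z = - (al * z0) by rewrite /al divfK ?opprK // gt_eqF.
    have W0 : 0 <= W.
      have : 0 <= gp0 * expR (- (z0 * d)) * \int[mu]_s (K s * expR (- (z0 * s))).
        by rewrite !mulr_ge0 ?expR_ge0 ?(ltW gp00) // Rintegral_ge0 // => s _;
          rewrite mulr_ge0 ?expR_ge0.
      by move: chi_z0; rewrite /W; lra.
    have hAJ : A * (m + al * m) - al * W <= A * J.
      have th0 : 0 <= A / gp0 by rewrite divr_ge0 // ltW.
      have th1 : A / gp0 <= 1 by rewrite ler_pdivrMr // mul1r.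
      have h := ler_wpM2l th0 hJ.
      have e1 : A / gp0 * (gp0 * J) = A * J by rewrite mulrA divfK // gt_eqF.
      have e2 : A / gp0 * (gp0 * (m + al * m) - al * W) =
                A * (m + al * m) - A / gp0 * (al * W).
        by rewrite mulrBr mulrA divfK // gt_eqF.
      have h' : A / gp0 * (al * W) <= 1 * (al * W).
        by rewrite ler_wpM2r // mulr_ge0.
      by rewrite e1 e2 in h; lra.
    (* With z = - al z0 the terms in [c] cancel. What remains is (al z0)^2 + al z0^2 + al (A m -
       fp0) plus the quantity bounded below in [Am]. *)
    have q0 : 0 <= (al * z0) ^+ 2 + al * z0 ^+ 2.
      by rewrite addr_ge0 ?sqr_ge0 // mulr_ge0 ?sqr_ge0.
    have q1 : 0 <= al * (A * m - fp0) by rewrite mulr_ge0 //; lra.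
    rewrite zE sqrrN; move: hAJ; rewrite /W; nra.
  have hJ := @laplace_window_pos r z m (ltW z_gt0) erefl.
  rewrite -/J -/B in hJ.
  have h1 : A * (m * (1 - z * B)) <= A * J by rewrite ler_wpM2l // ltW.
  have m0 : 0 <= m by apply: le_trans rm; rewrite subr_ge0 ltW.
  have Am1 : A * m <= gp0.
    have : A * m <= A * 1 by rewrite ler_wpM2l // ltW.
    by lra.
  have zB : z * B <= eps * B by rewrite ler_wpM2r.
  have h2 : A * m * (z * B) <= gp0 * (eps * B).
    by apply: ler_pM => //; rewrite mulr_ge0 // ltW.
  have h3 : c * z <= `|c| * eps.
    apply: (le_trans (ler_norm _)); rewrite normrM (gtr0_norm z_gt0).
    by rewrite ler_wpM2l.
  have h4 := sqr_ge0 z.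
  have h5 : A * (m * (1 - z * B)) = A * m - A * m * (z * B) by ring.
  lra.
have := mulr_gt0 S0 y1; apply/negP; rewrite -leNgt.
have -> : (z ^+ 2 - 2 * k - c * z - fp0 - eta + A * J) * y t1 =
  (z ^+ 2 - 2 * k) * y t1 - c * (z * y t1) - (fp0 + eta) * y t1 + A * y t1 * J.
  by ring.
rewrite ddyE dyE in ddyge; lra.
Qed.

Definition positive_profile (y dy ddy : R -> R) : Prop :=
  [/\ forall t : R, is_derive t 1 y (dy t), forall t : R, is_derive t 1 dy (ddy t),
      forall t, 0 < y t, forall t, `|dy t| <= Lam * y t &
      forall t, ddy t = c * dy t + f (y t) - conv K d (fun s => g (y s)) t].

(** The bound on y' makes exp (Lam t) y nondecreasing and exp (- Lam t) y nonincreasing; the sign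
    [b] treats both at once. *)
Lemma harnack (y dy : R -> R) : (forall t : R, is_derive t 1 y (dy t)) ->
  (forall t, `|dy t| <= Lam * y t) ->
  forall s t, y s <= y t * expR (Lam * `|t - s|).
Proof.
move=> yd dyL.
have mono b (b1 : b = 1 \/ b = -1) u v : u <= v ->
    b * (expR (b * Lam * u) * y u) <= b * (expR (b * Lam * v) * y v).
  move=> uv.
  have Fd (t : R) : is_derive t 1 (fun t : R => b * (expR (b * Lam * t) * y t))
      (expR (b * Lam * t) * (b * b * Lam * y t + b * dy t)).
    apply: (is_derive_eq (is_derive_funZ b
      (is_derive_funM (is_derive_expZ (b * Lam) t) (yd t)))); ring.
  apply: (derive_ge0_le Fd) => // t _.
  rewrite mulr_ge0 ?expR_ge0 //.
  have := dyL t; rewrite ler_norml => /andP[h1 h2].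
  by case: b1 => ->; lra.
have div_exp (u v p q : R) : expR u * p <= expR v * q -> p <= q * expR (v - u).
  move=> h; rewrite -(ler_pM2l (expR_gt0 u)) (le_trans h) // le_eqVlt expRB.
  by apply/orP; left; apply/eqP; field; rewrite gt_eqF // expR_gt0.
move=> s t; case: (leP s t) => [st|/ltW ts].
  have := mono 1 (or_introl erefl) s t st; rewrite !mul1r => /div_exp.
  by rewrite -mulrBr ger0_norm ?subr_ge0.
have := mono (-1) (or_intror erefl) t s ts.
rewrite !mulN1r lerN2 => /div_exp.
by rewrite -mulrBr mulNr -mulrN opprB distrC ger0_norm ?subr_ge0.
Qed.

(** Let [yh t] be the minimum over s of y(s) exp (k (s - t)^2), which is comparable to y(t). At a
    minimizer t1 a Gaussian of logarithmic slope 2 k (t - t1) touches y from below, so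
    [touching_slope] gives t - t1 >= tau. Testing the same t1 at t - tau shows that [yh] shrinks by
    the factor exp (- k tau^2) with each step tau to the left. *)
Lemma left_decay : exists d1 C rho : R, [/\ 0 < d1, 0 < C, 0 < rho &
  forall y dy ddy, positive_profile y dy ddy ->
  forall s t, s <= t -> y t <= d1 -> y s <= C * expR (- (rho * (t - s)))].
Proof.
have [k [eps [B [del [k0 eps0 B0 del0 slope]]]]] := touching_slope.
have L0 : 0 < Lam := Lam0.
(* Beyond distance [Rr] the factor exp (k (s - t)^2) outweighs the Harnack loss exp (Lam |s - t|),
   so the minimum is attained within [Rr]. *)
pose Rr := (Lam + 1) / k.
have kRr : k * Rr = Lam + 1 by rewrite /Rr mulrC divfK // gt_eqF.
have Rr0 : 0 < Rr by rewrite divr_gt0 //; lra.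
clearbody Rr.
pose tau := eps / (2 * k).
have tau0 : 0 < tau by rewrite divr_gt0 // mulr_gt0.
have tauE : 2 * k * tau = eps by rewrite /tau mulrC divfK // gt_eqF // mulr_gt0.
clearbody tau.
(* By Harnack, [y t <= d2] makes y at most [del] on the whole window of [touching_slope], and
   [yh t <= d1] implies [y t <= d2]. *)
pose d2 := del * expR (- (Lam * (Rr + B))).
pose d1 := d2 * expR (- (Lam * Rr)).
have d10 : 0 < d1 by rewrite !mulr_gt0 // expR_gt0.
exists d1, (d1 * expR (Lam * (tau + Rr) + k * tau ^+ 2)), (k * tau).
split=> //; try by rewrite ?mulr_gt0 ?expR_gt0.
move=> y dy ddy [yd dyd y0 dyL ode].
have hk := harnack yd dyL.
have cy : continuous y := derive_continuous yd.
pose F t s := y s * expR (k * (s - t) ^+ 2).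
have Ftt t : F t t = y t by rewrite /F subrr expr2 !mulr0 expR0 mulr1.
have dsq (t s : R) : is_derive s 1 (fun s : R => k * (s - t) ^+ 2) (2 * k * (s - t)).
  have h1 := is_derive_funB (is_derive_fun_id s) (is_derive_fun_cst t s).
  apply: (is_derive_eq (is_derive_funZ k (is_derive_funM h1 h1))); ring.
have dex (t s : R) : is_derive s 1 (fun s : R => expR (k * (s - t) ^+ 2))
    (expR (k * (s - t) ^+ 2) * (2 * k * (s - t))).
  exact: (is_derive_fun_comp (is_derive_expR _) (dsq t s)).
have Fd (t s : R) : is_derive s 1 (F t)
    (expR (k * (s - t) ^+ 2) * (dy s + 2 * k * (s - t) * y s)).
  apply: (is_derive_eq (is_derive_funM (yd s) (dex t s))); ring.
have /choice[th thP] t : exists t1, `|t1 - t| <= Rr /\ forall s, F t t1 <= F t s.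
  have cF : {within `[t - Rr, t + Rr], continuous (F t)}.
    by apply: continuous_subspaceT; exact: derive_continuous (Fd t).
  have [|t1 t1I t1min] := EVT_min _ cF; first lra.
  move: t1I; rewrite in_itv /= -ler_distl => t1R.
  exists t1; split=> // s; case: (leP `|s - t| Rr) => [sR|/ltW Rs].
    by apply: t1min; rewrite in_itv /= -ler_distl.
  apply: (@le_trans _ _ (F t t)).
    by apply: t1min; rewrite in_itv /=; apply/andP; split; lra.
  rewrite Ftt /F (le_trans (hk t s)) //.
  rewrite ler_wpM2l ?(ltW (y0 _)) // ler_expR -[X in _ <= k * X]real_normK ?num_real //.
  rewrite expr2 mulrA ler_wpM2r // (@le_trans _ _ (k * Rr)) //; first by rewrite kRr; lra.
  by rewrite ler_wpM2l // ltW.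
pose yh t := F t (th t).
have yh0 t : 0 < yh t by rewrite mulr_gt0 ?expR_gt0.
have yth t : y (th t) <= yh t.
  rewrite /yh /F ler_peMr ?(ltW (y0 _)) // -expR0 ler_expR mulr_ge0 ?sqr_ge0 //.
  exact: ltW.
have yyh t : y t <= yh t * expR (Lam * Rr).
  apply: (le_trans (hk t (th t))); apply: ler_pM => //; rewrite ?expR_ge0 ?(ltW (y0 _)) //.
  by rewrite ler_expR ler_wpM2l ?(ltW L0) //; case: (thP t).
have yhy t : yh t <= y t.
  by have [_ /(_ t)] := thP t; rewrite Ftt.
have step t : y t <= d2 -> yh (t - tau) <= expR (- (k * tau ^+ 2)) * yh t.
  move=> yt; have [t1R t1min] := thP t.
  set t1 := th t in t1R t1min *.
  have Fdd (s : R) : is_derive s 1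
     (fun s => expR (k * (s - t) ^+ 2) * (dy s + 2 * k * (s - t) * y s))
     (expR (k * (s - t) ^+ 2) * (2 * k * (s - t) * (dy s + 2 * k * (s - t) * y s) +
       ddy s + 2 * k * y s + 2 * k * (s - t) * dy s)).
    have h1 := is_derive_funB (is_derive_fun_id s) (is_derive_fun_cst t s).
    have h2 := is_derive_funM (is_derive_funZ (2 * k) h1) (yd s).
    apply: (is_derive_eq (is_derive_funM (dex t s) (is_derive_funD (dyd s) h2))); ring.
  have [df ddf] := @local_min_derive _ (F t) _ _ t1 1 ltr01 (Fd t) Fdd (fun s _ => t1min s).
  have dyE : dy t1 = 2 * k * (t - t1) * y t1.
    move: df => /eqP; rewrite mulf_eq0 gt_eqF ?expR_gt0 //= => /eqP h.
    by lra.
  have ddyE : ((2 * k * (t - t1)) ^+ 2 - 2 * k) * y t1 <= ddy t1.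
    move: ddf; rewrite pmulr_rge0 ?expR_gt0 // dyE; lra.
  have small x : `|x| <= B -> y (t1 - x) <= del.
    move=> xB; apply: (le_trans (hk _ t)).
    apply: (@le_trans _ _ (d2 * expR (Lam * (Rr + B)))).
      apply: ler_pM; rewrite ?expR_ge0 ?(ltW (y0 _)) // ler_expR ler_wpM2l ?(ltW L0) //.
      rewrite (_ : t - (t1 - x) = (t - t1) + x); last by ring.
      by rewrite (le_trans (ler_normD _ _)) // lerD // distrC.
    by rewrite /d2 -mulrA -expRD addNr expR0 mulr1.
  have touch x : `|x| <= B ->
      y t1 * expR (- (2 * k * (t - t1) * x) - k * x ^+ 2) <= y (t1 - x).
    move=> _; have := t1min (t1 - x); rewrite /F => h.
    rewrite -(ler_pM2r (expR_gt0 (k * (t1 - x - t) ^+ 2))) -[leLHS]mulrA -expRD.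
    apply: le_trans h; rewrite le_eqVlt; apply/orP; left; apply/eqP.
    by congr (_ * expR _); ring.
  have z_eps := slope y t1 (dy t1) (ddy t1) _ cy (y0 t1) dyE ddyE (ode t1) small touch.
  have tt1 : tau <= t - t1.
    by rewrite -(ler_pM2l (_ : 0 < 2 * k)) ?mulr_gt0 // tauE ltW.
  have [_ /(_ t1) h] := thP (t - tau).
  apply: (le_trans h); rewrite /yh /F -/t1 [leRHS]mulrCA ler_wpM2l ?(ltW (y0 _)) //.
  rewrite -expRD ler_expR.
  have : k * (2 * tau * tau) <= k * (2 * tau * (t - t1)).
    by rewrite ler_wpM2l ?(ltW k0) // ler_wpM2l // mulr_ge0 // ltW.
  rewrite -/t1; lra.
have iter n t : yh t <= d1 ->
    yh (t - n%:R * tau) <= expR (- (k * tau ^+ 2 * n%:R)) * yh t.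
  move=> yt; elim: n => [|n IH]; first by rewrite mul0r subr0 mulr0 oppr0 expR0 mul1r.
  have yn : yh (t - n%:R * tau) <= d1.
    apply: (le_trans IH); apply: le_trans yt; rewrite ler_piMl ?(ltW (yh0 _)) //.
    by rewrite expR_le1 oppr_le0 !mulr_ge0 ?sqr_ge0 // ltW.
  have yn' : y (t - n%:R * tau) <= d2.
    apply: (le_trans (yyh _)).
    apply: (@le_trans _ _ (d1 * expR (Lam * Rr))); first by rewrite ler_wpM2r ?expR_ge0.
    by rewrite /d1 -mulrA -expRD addNr expR0 mulr1.
  rewrite -natr1 (_ : t - (n%:R + 1) * tau = t - n%:R * tau - tau); last by ring.
  apply: (le_trans (step _ yn')).
  have -> : expR (- (k * tau ^+ 2 * (n%:R + 1))) =
      expR (- (k * tau ^+ 2)) * expR (- (k * tau ^+ 2 * n%:R)).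
    by rewrite -expRD; congr expR; ring.
  by rewrite -[leRHS]mulrA ler_wpM2l ?expR_ge0.
move=> s t st yt; have yht : yh t <= d1 by exact: le_trans yt.
have q0 : 0 <= (t - s) / tau by rewrite divr_ge0 ?subr_ge0 // ltW.
(* The distance is covered by whole steps tau; the remainder costs one more Harnack factor, which is
   absorbed in the constant C. *)
have /andP[n1 n2] := truncn_itv q0; set n := Num.truncn _ in n1 n2.
move: n1 n2; rewrite ler_pdivlMr // ltr_pdivrMr // -natr1 => n1 n2.
apply: (le_trans (hk s (t - n%:R * tau))).
have sn : `|t - n%:R * tau - s| <= tau by rewrite ger0_norm; lra.
apply: (@le_trans _ _ (yh (t - n%:R * tau) * expR (Lam * Rr) * expR (Lam * tau))).
  apply: ler_pM; rewrite ?expR_ge0 ?(ltW (y0 _)) //.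
  by rewrite ler_expR ler_wpM2l // ltW.
rewrite -mulrA -expRD.
apply: (@le_trans _ _ (expR (- (k * tau ^+ 2 * n%:R)) * d1 * expR (Lam * Rr + Lam * tau))).
  rewrite ler_wpM2r ?expR_ge0 // (le_trans (iter n t yht)) // ler_wpM2l ?expR_ge0 //.
rewrite (mulrC _ d1) -[leLHS]mulrA -[leRHS]mulrA -!expRD ler_wpM2l ?(ltW d10) //.
rewrite ler_expR.
have : k * tau * (t - s) <= k * tau * ((n%:R + 1) * tau).
  by rewrite ler_wpM2l ?mulr_ge0 ?(ltW k0) ?(ltW tau0) // ltW.
lra.
Qed.

End Dichotomy.

(** * Lower and upper limits at +oo *)

Section Fluctuation.
Variable R : realType.
Local Notation mu := (@lebesgue_measure R).
Variable K : R -> R.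
Hypothesis K0 : forall s, 0 <= K s.
Hypothesis iK : mu.-integrable setT (fun s => (K s)%:E).
Hypothesis K1 : \int[mu]_s K s = 1.
Variables (c d Z Q : R) (f g : R -> R).
Hypothesis fmono : forall x y, x <= y -> f x <= f y.
Variables (y dy ddy q : R -> R).
Hypothesis yd : forall t : R, is_derive t 1 y (dy t).
Hypothesis dyd : forall t : R, is_derive t 1 dy (ddy t).
Hypothesis yZ : forall t, 0 <= y t <= Z.
Hypothesis ode : forall t, ddy t = c * dy t + f (y t) - conv K d q t.
Hypotheses (cq : continuous q) (qQ : forall t, 0 <= q t <= Q).

(** At late times with y <= x the equation makes y'' - c y' at most f x - gam plus a small error,
    hence negative by a fixed amount, and [eventually_gt_of_ode] applies. *)
Lemma fluctuation_lower T gam x : 0 <= gam -> (forall t, T <= t -> gam <= q t) ->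
  f x < gam -> exists T', forall t, T' <= t -> x < y t.
Proof.
move=> gam0 qgam fx; have e0 : 0 < (gam - f x) / 2 by rewrite divr_gt0 // subr_gt0.
have [T1 convT] := conv_tail_ge K0 iK K1 d cq qQ gam0 qgam e0.
apply: (@eventually_gt_of_ode _ y dy ddy Z c T1 x ((gam - f x) / 2)) => //.
  by move=> t; have /andP[h1 h2] := yZ t; rewrite ger0_norm.
move=> t /convT h /fmono h'; rewrite ode; lra.
Qed.

Lemma fluctuation_upper T gam x : gam <= Q -> (forall t, T <= t -> q t <= gam) ->
  gam < f x -> exists T', forall t, T' <= t -> y t < x.
Proof.
move=> gamQ qgam fx; have e0 : 0 < (f x - gam) / 2 by rewrite divr_gt0 // subr_gt0.
have [T1 convT] := conv_tail_le K0 iK K1 d cq qQ gamQ qgam e0.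
have [|||T' T'P] := @eventually_gt_of_ode _ (fun t => - y t) (fun t => - dy t)
  (fun t => - ddy t) Z c T1 (- x) ((f x - gam) / 2)
  (fun t => is_derive_funN (yd t)) (fun t => is_derive_funN (dyd t)).
- by move=> t; have /andP[h1 h2] := yZ t; rewrite normrN ger0_norm.
- by [].
- move=> t /convT h; rewrite lerN2 => /fmono h'; rewrite ode; lra.
by exists T' => t /T'P; rewrite ltrN2.
Qed.

Hypothesis f0 : f 0 = 0.
Hypothesis fL : exists2 L, 0 <= L & forall x y, `|f x - f y| <= L * `|x - y|.
Hypothesis g_uc : forall e : R, 0 < e -> exists2 r : R, 0 < r &
  forall x y, `|x - y| <= r -> `|g x - g y| <= e.

Lemma f_slack x gam : f x < gam -> exists2 x', x < x' & f x' < gam.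
Proof.
move=> fx; have [L L0 fLip] := fL.
have e0 : 0 < (gam - f x) / (2 * (L + 1)).
  by rewrite divr_gt0 ?subr_gt0 // mulr_gt0 // ltr_wpDl.
exists (x + (gam - f x) / (2 * (L + 1))); first by rewrite ltrDl.
have := fLip (x + (gam - f x) / (2 * (L + 1))) x.
rewrite addrAC subrr add0r (gtr0_norm e0) => h.
have h1 := le_trans (ler_norm _) h.
have h2 : L * ((gam - f x) / (2 * (L + 1))) <= (gam - f x) / 2.
  rewrite (_ : (gam - f x) / 2 = (L + 1) * ((gam - f x) / (2 * (L + 1)))).
    by rewrite ler_wpM2r ?(ltW e0) // lerDl.
  by field; rewrite gt_eqF // ltr_wpDl.
by move: h1 h2 fx; set w := _ / (2 * (L + 1)); clearbody w; lra.
Qed.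

Lemma f_slack_left x gam : gam < f x -> exists2 x', x' < x & gam < f x'.
Proof.
move=> fx; have [L L0 fLip] := fL.
have e0 : 0 < (f x - gam) / (2 * (L + 1)).
  by rewrite divr_gt0 ?subr_gt0 // mulr_gt0 // ltr_wpDl.
exists (x - (f x - gam) / (2 * (L + 1))); first by rewrite gtrBl.
have := fLip x (x - (f x - gam) / (2 * (L + 1))).
rewrite subKr (gtr0_norm e0) => h.
have h1 := le_trans (ler_norm _) h.
have h2 : L * ((f x - gam) / (2 * (L + 1))) <= (f x - gam) / 2.
  rewrite (_ : (f x - gam) / 2 = (L + 1) * ((f x - gam) / (2 * (L + 1)))).
    by rewrite ler_wpM2r ?(ltW e0) // lerDl.
  by field; rewrite gt_eqF // ltr_wpDl.
by move: h1 h2 fx; set w := _ / (2 * (L + 1)); clearbody w; lra.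
Qed.

Let low := [set x | exists T, forall t, T <= t -> x <= y t].
Let upp := [set x | exists T, forall t, T <= t -> y t <= x].

Lemma y_limits : exists m M, [/\ 0 <= m <= M, M <= Z,
  (forall e, 0 < e -> exists T, forall t, T <= t -> m - e <= y t <= M + e),
  (forall x T, (forall t, T <= t -> x <= y t) -> x <= m) &
  (forall x T, (forall t, T <= t -> y t <= x) -> M <= x)].
Proof.
have low0 : low 0 by exists 0 => t _; case/andP: (yZ t).
have uppZ : upp Z by exists 0 => t _; case/andP: (yZ t).
have low_le_upp x x' : low x -> upp x' -> x <= x'.
  move=> [T TP] [T' T'P]; apply: (@le_trans _ _ (y (Num.max T T'))).
    by apply: TP; rewrite le_max lexx.
  by apply: T'P; rewrite le_max lexx orbT.
have slow : has_sup low.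
  by split; [exists 0|exists Z => x /low_le_upp; apply].
have iupp : has_inf upp.
  by split; [exists Z|exists 0 => x; exact: low_le_upp].
exists (sup low), (inf upp); split.
- apply/andP; split; first exact: (ub_le_sup slow.2).
  apply: ge_sup; first by exists 0.
  move=> x lx; apply: lb_le_inf; first by exists Z.
  by move=> x'; exact: low_le_upp.
- exact: (ge_inf iupp.2).
- move=> e e0.
  have [x [T TP] xs] := sup_adherent e0 slow.
  have [x' [T' T'P] xi] := inf_adherent e0 iupp.
  exists (Num.max T T') => t; rewrite ge_max => /andP[/TP h1 /T'P h2].
  by rewrite (le_trans (ltW xs) h1) (le_trans h2 (ltW xi)).
- by move=> x T TP; apply: (ub_le_sup slow.2); exists T.
- by move=> x T TP; apply: (ge_inf iupp.2); exists T.
Qed.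

(** If the lower limit m were at most zeta1, then f m < g on [m, Z]: up to zeta1 because f < g
    there, beyond it because g >= g zeta1. Then [fluctuation_lower] would push y above a level
    larger than m. The inequality g(y) <= q covers profiles with a source as well. *)
Lemma persistence zeta1 x0 T : 0 < zeta1 -> zeta1 < Z ->
  (forall x, 0 < x <= zeta1 -> f x < g x) ->
  (forall x, zeta1 <= x <= Z -> g zeta1 <= g x) ->
  (forall t, g (y t) <= q t) -> (forall x, 0 <= g x) ->
  0 < x0 -> (forall t, T <= t -> x0 <= y t) ->
  exists2 b, zeta1 < b & exists T', forall t, T' <= t -> b <= y t.
Proof.
move=> z10 z1Z fg gz1 gq g0 x00 yx0.
have [m [M [/andP[m0 mM] MZ mMP mlow _]]] := y_limits.
have mpos : 0 < m by apply: lt_le_trans x00 _; exact: mlow yx0.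
case: (ltP zeta1 m) => [z1m|mz1].
  exists ((zeta1 + m) / 2); first by lra.
  have e0 : 0 < (m - zeta1) / 2 by rewrite divr_gt0 // subr_gt0.
  have [T' T'P] := mMP _ e0; exists T' => t /T'P/andP[h _]; lra.
have mZ : m <= Z by lra.
have fgm x : m <= x <= Z -> f m < g x.
  move=> /andP[mx xZ]; case: (leP x zeta1) => [xz1|/ltW z1x].
    by apply: (le_lt_trans (fmono mx)); apply: fg; rewrite xz1 andbT; lra.
  apply: (@lt_le_trans _ _ (g zeta1)); last by apply: gz1; rewrite z1x.
  by apply: (le_lt_trans (fmono mz1)); apply: fg; rewrite z10 lexx.
have cg : continuous g.
  move=> x; apply/cvgrPdist_le => e /g_uc[r r0 gr]; near=> x'.
  by apply: gr; near: x'; apply: cvgr_dist_le => //; exact: cvg_id.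
have [xm xmI gmin] := EVT_min mZ (continuous_subspaceT cg).
have fm : f m < g xm by apply: fgm; move: xmI; rewrite in_itv.
have e0 : 0 < (g xm - f m) / 2 by rewrite divr_gt0 // subr_gt0.
(* Late values of y may still lie slightly below m; uniform continuity of [g] absorbs this. *)
have [r r0 gr] := g_uc e0.
have [T1 T1P] := mMP _ r0.
have qlow t : T1 <= t -> g xm - (g xm - f m) / 2 <= q t.
  move=> /T1P/andP[h _]; apply: le_trans (gq t).
  have /andP[y0 yZt] := yZ t.
  case: (leP m (y t)) => [my|ym].
    have := gmin (y t); rewrite in_itv /= my yZt => /(_ isT); lra.
  have : `|y t - m| <= r by rewrite ler0_norm ?opprB; lra.
  move=> /gr; rewrite ler_norml => /andP[h1 _].
  have := gmin m; rewrite in_itv /= lexx mZ => /(_ isT); lra.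
have fm' : f m < g xm - (g xm - f m) / 2 by lra.
have [x' mx' fx'] := f_slack fm'.
have gm0 : 0 <= g xm - (g xm - f m) / 2 by have := fmono m0; rewrite f0; lra.
have [T2 T2P] := fluctuation_lower gm0 qlow fx'.
have : x' <= m by apply: (mlow _ T2) => t /T2P/ltW.
lra.
Unshelve. all: by end_near. Qed.

(** If g > f m on all of [m, M], the delayed term would eventually exceed f m by a fixed amount and
    [fluctuation_lower] would raise the lower limit; dually for M. *)
Lemma limits_fluctuate : (forall t, q t = g (y t)) ->
  exists m M, [/\ 0 <= m <= M, M <= Z,
  (forall e, 0 < e -> exists T, forall t, T <= t -> m - e <= y t <= M + e),
  (forall x T, (forall t, T <= t -> x <= y t) -> x <= m) &
  (exists2 s1, m <= s1 <= M & g s1 <= f m) /\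
  (exists2 s2, m <= s2 <= M & f M <= g s2)].
Proof.
move=> qg; have [m [M [/andP[m0 mM] MZ mMP mlow Mupp]]] := y_limits.
have cg : continuous g.
  move=> x; apply/cvgrPdist_le => e /g_uc[r r0 gr]; near=> x'.
  by apply: gr; near: x'; apply: cvgr_dist_le => //; exact: cvg_id.
have close r : 0 < r -> exists T, forall t, T <= t ->
    exists2 x, m <= x <= M & `|y t - x| <= r.
  move=> r0; have [T TP] := mMP _ r0; exists T => t /TP/andP[h1 h2].
  case: (leP (y t) m) => [ym|my].
    exists m; first by rewrite lexx.
    by rewrite ler0_norm; lra.
  case: (leP (y t) M) => [yM|My].
    by exists (y t); [rewrite (ltW my) yM|rewrite subrr normr0 ltW].
  exists M; first by rewrite lexx mM.
  by rewrite ger0_norm; lra.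
exists m, M; split=> //; first by rewrite m0.
split.
  have [xm xmI gmin] := EVT_min mM (continuous_subspaceT cg).
  exists xm; first by move: xmI; rewrite in_itv.
  rewrite leNgt; apply/negP => fm.
  have e0 : 0 < (g xm - f m) / 2 by rewrite divr_gt0 // subr_gt0.
  have [r r0 gr] := g_uc e0; have [T1 T1P] := close _ r0.
  have qlow t : T1 <= t -> g xm - (g xm - f m) / 2 <= q t.
    move=> /T1P[x xI /gr]; rewrite qg ler_norml => /andP[h1 _].
    by have := gmin x; rewrite in_itv /= => /(_ xI); lra.
  have fm' : f m < g xm - (g xm - f m) / 2 by lra.
  have [x' mx' fx'] := f_slack fm'.
  have gm0 : 0 <= g xm - (g xm - f m) / 2 by have := fmono m0; rewrite f0; lra.
  have [T2 T2P] := fluctuation_lower gm0 qlow fx'.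
  have : x' <= m by apply: (mlow _ T2) => t /T2P/ltW.
  lra.
have [xM xMI gmax] := EVT_max mM (continuous_subspaceT cg).
exists xM; first by move: xMI; rewrite in_itv.
rewrite leNgt; apply/negP => fM.
have e0 : 0 < (f M - g xM) / 2 by rewrite divr_gt0 // subr_gt0.
have [r r0 gr] := g_uc e0; have [T1 T1P] := close _ r0.
(* The minimum with [Q] meets the side condition of [fluctuation_upper]. *)
have qupp t : T1 <= t -> q t <= Num.min (g xM + (f M - g xM) / 2) Q.
  move=> /T1P[x xI /gr]; rewrite le_min; have /andP[_ ->] := qQ t.
  rewrite andbT qg ler_norml => /andP[_ h1].
  by have := gmax x; rewrite in_itv /= => /(_ xI); lra.
have fM' : Num.min (g xM + (f M - g xM) / 2) Q < f M.
  by rewrite gt_min; apply/orP; left; lra.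
have [x' Mx' fx'] := f_slack_left fM'.
have gQ : Num.min (g xM + (f M - g xM) / 2) Q <= Q by rewrite ge_min lexx orbT.
have [T2 T2P] := fluctuation_upper gQ qupp fx'.
have : M <= x' by apply: (Mupp _ T2) => t /T2P/ltW.
lra.
Unshelve. all: by end_near. Qed.

End Fluctuation.

(** * Interval maps with a globally attracting fixed point *)

Section IntervalMap.
Variable R : realType.
Variables (Z kappa r0 : R) (G : R -> R).
Hypothesis cG : continuous G.
Hypothesis G0 : G 0 = 0.
Hypothesis GZ : forall x : R, 0 < x <= Z -> 0 < G x <= Z.
Hypothesis Gfix : forall x : R, 0 < x <= Z -> G x = x -> x = kappa.
Hypotheses (k0 : 0 < kappa <= Z) (Gk : G kappa = kappa).
Hypothesis G_iter : forall x : R, 0 < x <= Z -> iter n G x @[n --> \oo] --> kappa.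
Hypotheses (r00 : 0 < r0) (Gr0 : forall x : R, 0 < x <= r0 -> x < G x).

(** A crossing of the diagonal to the left of [kappa] would be a second positive fixed point. *)
Lemma above_diagonal (H : R -> R) : continuous H ->
  (forall x, 0 < x <= Z -> H x = x -> x = kappa) ->
  (forall e, 0 < e -> exists2 x, 0 < x < e & x < H x) ->
  forall x, 0 < x < kappa -> x < H x.
Proof.
move=> cH Hfix Hsmall x /andP[x0 xk]; rewrite ltNge; apply/negP => Hx.
have [x' /andP[x'0 x'x] Hx'] := Hsmall x x0.
have cD : {within `[x', x], continuous (fun s => H s - s)}.
  by apply: continuous_subspaceT => s; apply: cvgB; [exact: cH|exact: cvg_id].
have [|s sI /eqP] := IVT (v := 0) (ltW x'x) cD.
  by rewrite ge_min le_max /= !subr_le0 !subr_ge0 Hx (ltW Hx') !orbT.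
rewrite subr_eq0 => /eqP Hs; move: sI; rewrite in_itv /= => /andP[s1 s2].
have /andP[_ kZ] := k0.
have sZ : 0 < s <= Z by rewrite (lt_le_trans x'0 s1) /=; lra.
by have := Hfix s sZ Hs; lra.
Qed.

Lemma G_above x : 0 < x < kappa -> x < G x.
Proof.
apply: above_diagonal => // e e0; exists (Num.min e r0 / 2).
  have : 0 < Num.min e r0 by rewrite lt_min e0.
  have : Num.min e r0 <= e by rewrite ge_min lexx.
  by move=> h1 h2; apply/andP; split; lra.
apply: Gr0; have : 0 < Num.min e r0 by rewrite lt_min e0.
have : Num.min e r0 <= r0 by rewrite ge_min lexx orbT.
by move=> h1 h2; apply/andP; split; have := r00; lra.
Qed.

(** A fixed point s of G^2 recurs at every even step of its own orbit, which tends to [kappa]; so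
    there are no 2-cycles. Near 0, [G_above] is applied twice. *)
Lemma GG_above x : 0 < x < kappa -> x < G (G x).
Proof.
apply: (@above_diagonal (fun s => G (G s))).
- by move=> s; apply: continuous_comp; exact: cG.
- move=> s sZ GGs; have := G_iter sZ => h.
  have it2 n : iter (n * 2) G s = s.
    by elim: n => [//|n IH]; rewrite mulSn iterD IH /= GGs.
  have h2 : iter (n * 2) G s @[n --> \oo] --> kappa.
    apply: (cvg_comp _ _ _ h); apply/cvgnyPge => k; near=> n.
    by rewrite muln2 -addnn; apply: leq_trans (leq_addr _ _); near: n;
      exact: nbhs_infty_ge.
  have h3 : iter (n * 2) G s @[n --> \oo] --> s.
    rewrite (_ : (fun n => _) = (fun=> s)); first exact: cvg_cst.
    by apply: funext.
  exact: (cvg_unique _ h3 h2).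
move=> e e0; have /andP[kk0 kZ] := k0.
have : \forall x \near (0 : R), G x < kappa.
  have c0 : G x @[x --> (0 : R)] --> (0 : R) by rewrite -[X in _ --> X]G0; exact: cG.
  exact: (cvgr_lt _ c0).
move=> /nbhs_ballP[d /= d0 dP].
have p0 : 0 < Num.min (Num.min e kappa) d by rewrite !lt_min e0 kk0.
set p := Num.min _ _ in p0.
have pe : p <= e by rewrite !ge_min lexx.
have pk : p <= kappa by rewrite !ge_min lexx orbT.
have pd : p <= d by rewrite !ge_min lexx orbT.
clearbody p.
have p2 : 0 < p / 2 < kappa by apply/andP; split; lra.
exists (p / 2); first by apply/andP; split; lra.
have Gp := G_above p2.
have Gpk : G (p / 2) < kappa.
  apply: dP; rewrite /ball /= sub0r normrN gtr0_norm; lra.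
apply: (lt_trans Gp); apply: G_above; rewrite Gpk andbT.
by apply: lt_trans Gp; case/andP: p2.
Unshelve. all: by end_near. Qed.

Lemma G_below x : kappa < x <= Z -> G x < x.
Proof.
move=> /andP[kx xZ]; have /andP[kk0 kZ] := k0; rewrite ltNge; apply/negP => Gx.
have Z0 : 0 < Z <= Z by rewrite lexx andbT; lra.
have cD : {within `[x, Z], continuous (fun s => G s - s)}.
  by apply: continuous_subspaceT => s; apply: cvgB; [exact: cG|exact: cvg_id].
have [|s sI /eqP] := IVT (v := 0) xZ cD.
  have /andP[_ GZZ] := GZ Z0.
  by rewrite ge_min le_max /= !subr_le0 !subr_ge0 Gx GZZ orbT.
rewrite subr_eq0 => /eqP Hs; move: sI; rewrite in_itv /= => /andP[s1 s2].
have sZ : 0 < s <= Z by apply/andP; split; lra.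
by have := Gfix sZ Hs; lra.
Qed.

(* [m, M] is contained in its image under G; as G^2 lies above the diagonal to the left of kappa, this forces m = M = kappa. *)
Lemma covered_interval_trivial m M s1 s2 : 0 < m -> M <= Z ->
  m <= s1 <= M -> G s1 <= m -> m <= s2 <= M -> M <= G s2 -> m = kappa /\ M = kappa.
Proof.
move=> m0 MZ /andP[ms1 s1M] Gs1 /andP[ms2 s2M] Gs2.
have ks1 : kappa <= s1.
  rewrite leNgt; apply/negP => s1k.
  have /G_above : 0 < s1 < kappa by rewrite s1k andbT; lra.
  lra.
have ks2 : s2 <= kappa.
  rewrite leNgt; apply/negP => s2k.
  have /G_below : kappa < s2 <= Z by rewrite s2k /=; lra.
  lra.
(* Here G kappa <= s1 <= G s2. For s in [s2, kappa] with G s = s1 one gets G (G s) <= m <= s, so s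
   is not strictly below [kappa]. *)
have [|s sI Gs] := IVT (v := s1) ks2 (continuous_subspaceT cG).
  by rewrite ge_min le_max Gk ks1 orbT (le_trans s1M Gs2).
move: sI; rewrite in_itv /= => /andP[ss sk].
have sE : s = kappa.
  apply/eqP; rewrite eq_le sk leNgt /=; apply/negP => s_lt.
  have /GG_above : 0 < s < kappa by rewrite s_lt andbT; lra.
  rewrite Gs; lra.
have s1E : s1 = kappa by rewrite -Gs sE Gk.
have mE : m = kappa.
  by apply/eqP; rewrite eq_le; apply/andP; split; [lra|rewrite -Gk -s1E].
split=> //; have s2E : s2 = kappa by apply/eqP; rewrite eq_le ks2 -mE.
by apply/eqP; rewrite eq_le; apply/andP; split; [rewrite -Gk -s2E|lra].
Qed.

End IntervalMap.

(** * Critical speeds *)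

Section Reflection.
Variable R : realType.
Local Notation mu := (@lebesgue_measure R).

Let mopp : measurable_fun setT (-%R : R -> measurableTypeR R).
Proof. exact: (@oppr_measurable R setT). Qed.

Lemma ge0_integral_reflect (F : R -> \bar R) : measurable_fun setT F ->
  (forall x, (0 <= F x)%E) -> (\int[mu]_x F (- x)%R = \int[mu]_x F x)%E.
Proof.
move=> mF F0.
transitivity (\int[pushforward mu (-%R : R -> measurableTypeR R)]_x F x)%E.
  by rewrite ge0_integral_pushforward.
by apply: eq_measure_integral => A mA _; exact: lebesgue_measureN.
Qed.

Lemma integrable_reflect (F : R -> R) : mu.-integrable setT (fun s => (F s)%:E) ->
  mu.-integrable setT (fun s => (F (- s))%:E).
Proof.
move=> /integrableP[/measurable_EFinP mF Foo]; apply/integrableP; split.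
  by apply/measurable_EFinP; exact: (measurableT_comp mF mopp).
rewrite (@ge0_integral_reflect (fun s => `|(F s)%:E|%E)) //.
by apply/measurable_EFinP; apply: measurableT_comp.
Qed.

Lemma Rintegral_reflect (F : R -> R) : mu.-integrable setT (fun s => (F s)%:E) ->
  \int[mu]_s F (- s) = \int[mu]_s F s.
Proof.
move=> iF; congr fine; have mF : measurable_fun setT (fun s => (F s)%:E).
  exact: measurable_int iF.
transitivity (\int[pushforward mu (-%R : R -> measurableTypeR R)]_x (F x)%:E)%E.
  by rewrite integral_pushforward //; exact: integrable_reflect.
by apply: eq_measure_integral => A mA _; exact: lebesgue_measureN.
Qed.

End Reflection.

Section Characteristic.
Variable R : realType.
Local Notation mu := (@lebesgue_measure R).
Variable K : R -> R.
Hypothesis K0 : forall s, 0 <= K s.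
Hypothesis iK : mu.-integrable setT (fun s => (K s)%:E).
Hypothesis K1 : \int[mu]_s K s = 1.
Variables (fp0 gp0 h : R).
Hypotheses (h0 : 0 <= h) (fp00 : 0 < fp0) (fgp0 : fp0 < gp0).

Let lap z : R := \int[mu]_s (K s * expR (- (z * s))).

Lemma lap_ge0 z : 0 <= lap z.
Proof. by apply: Rintegral_ge0 => s _; rewrite mulr_ge0 ?expR_ge0. Qed.

Lemma chi1_le_c z c c' : 0 < z -> c <= c' ->
  chi1 K fp0 gp0 h z c' <= chi1 K fp0 gp0 h z c.
Proof.
move=> z0 cc'; have gp00 : 0 < gp0 by exact: lt_trans fgp0.
rewrite /chi1 -/(lap z) lerD //.
  by rewrite !lerD2r lerD2l lerN2 ler_wpM2r // ltW.
apply: ler_wpM2r; first exact: lap_ge0.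
rewrite ler_wpM2l ?(ltW gp00) // ler_expR lerN2.
by rewrite ler_wpM2r // ler_wpM2l // ltW.
Qed.

Lemma limn_einf_le (u : (\bar R)^nat) x : (\forall n \near \oo, (u n <= x)%E) ->
  (limn_einf u <= x)%E.
Proof.
move=> ux; rewrite limn_einf_lim; apply: lime_le; first exact: is_cvg_einfs.
near=> n; apply: (@le_trans _ _ (u n)); last by near: n.
by apply: ereal_inf_lbound; exists n => /=.
Unshelve. all: by end_near. Qed.

(* Fatou's lemma shows that the domain and the sign condition pass to the limit, so that a root survives at the critical speed itself. *)
Lemma chi1_limit (z e : nat -> R) (zl el : R) :
  z n @[n --> \oo] --> zl -> e n @[n --> \oo] --> el ->
  (forall n, chi_dom K (z n)) -> (forall n, chi1 K fp0 gp0 h (z n) (e n) <= 0) ->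
  chi_dom K zl /\ chi1 K fp0 gp0 h zl el <= 0.
Proof.
move=> zc ec zdom zchi; have gp00 : 0 < gp0 by exact: lt_trans fgp0.
(* Fatou's lemma gives only lower semicontinuity of the transform, so chi_1 <= 0 is rewritten as lap
   <= U with U continuous. *)
pose U x y := (fp0 + y * x - x ^+ 2) * expR (x * y * h) / gp0.
have lapU x y : chi1 K fp0 gp0 h x y <= 0 <-> lap x <= U x y.
  rewrite /chi1 -/(lap x) /U.
  have -> : (lap x <= (fp0 + y * x - x ^+ 2) * expR (x * y * h) / gp0) =
            (gp0 * expR (- (x * y * h)) * lap x <= fp0 + y * x - x ^+ 2).
    rewrite ler_pdivlMr // -(ler_pM2r (expR_gt0 (- (x * y * h)))).
    rewrite -[X in _ <= X]mulrA -expRD subrr expR0 mulr1.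
    by congr (_ <= _); ring.
  by split; lra.
have Uc : U (z n) (e n) @[n --> \oo] --> U zl el.
  rewrite /U; apply: cvgMl; apply: cvgM.
    apply: cvgB; last by under eq_fun do rewrite expr2; rewrite expr2; exact: cvgM.
    by apply: cvgD; [exact: cvg_cst|exact: cvgM].
  apply: (@cvg_comp _ _ _ (fun n => z n * e n * h) expR _ (nbhs (zl * el * h)));
    last exact: continuous_expR.
  by apply: cvgMl; exact: cvgM.
have mW x : measurable_fun setT (fun s => (K s * expR (- (x * s)))%:E).
  apply/measurable_EFinP; apply: measurable_funM.
    by apply/measurable_EFinP; exact: measurable_int iK.
  under eq_fun do rewrite -mulNr.
  by apply: continuous_bounded_measurable => s; exact: continuous_expZ.
have fat : (\int[mu]_s (K s * expR (- (zl * s)))%:E <= (U zl el)%:E)%E.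
  apply/lee_addgt0Pr => d d0.
  have W0 n s : setT s -> (0 <= (K s * expR (- (z n * s)))%:E)%E.
    by move=> _; rewrite lee_fin mulr_ge0 ?expR_ge0.
  have := fatou mu measurableT (fun n => mW (z n)) W0.
  rewrite (_ : (\int[mu]_x limn_einf _)%E =
      (\int[mu]_s (K s * expR (- (zl * s)))%:E)%E); last first.
    apply: eq_integral => s _.
    have cs : (K s * expR (- (z n * s)))%:E @[n --> \oo] --> (K s * expR (- (zl * s)))%:E.
      apply: cvg_EFin; first exact: nearW.
      apply: cvgMr.
      apply: (@cvg_comp _ _ _ (fun n => - (z n * s)) expR _ (nbhs (- (zl * s))));
        last exact: continuous_expR.
      by apply: cvgN; apply: cvgMl.
    by rewrite is_cvg_limn_einfE; [exact/cvg_lim|apply/cvg_ex; eexists; exact: cs].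
  move=> hf; apply: (le_trans hf); apply: limn_einf_le.
  have : \forall n \near \oo, U (z n) (e n) <= U zl el + d.
    by apply: (cvgr_le _ Uc); rewrite ltrDl.
  apply: filterS => n Un.
  have fin : (\int[mu]_s (K s * expR (- (z n * s)))%:E)%E \is a fin_num.
    by apply: integrable_fin_num => //; exact: zdom.
  rewrite -(fineK fin) -EFinD lee_fin; apply: le_trans Un.
  exact/lapU.
have dom : chi_dom K zl.
  apply/integrableP; split; first exact: mW.
  apply: le_lt_trans (ltry (U zl el)).
  under eq_integral do rewrite gee0_abs ?lee_fin ?mulr_ge0 ?expR_ge0 //.
  exact: fat.
split=> //; apply/lapU; rewrite -lee_fin.
rewrite /lap /Rintegral fineK //; by apply: integrable_fin_num => //; exact: dom.
Qed.

(** A root at a speed below c + 1/(n + 1) gives, by [chi1_le_c], some z_n > 0 with chi_1(z_n, c +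
    1/(n + 1)) <= 0. The z_n are bounded since the quadratic part is then nonpositive, and their
    limit is not 0 since chi_1(0, c) = gp0 - fp0 > 0. *)
Lemma c_star_plus_root c : (c_star_plus K fp0 gp0 h <= c%:E)%E ->
  exists z, [/\ 0 < z, chi_dom K z & chi1 K fp0 gp0 h z c <= 0].
Proof.
move=> cs; have gp00 : 0 < gp0 by exact: lt_trans fgp0.
pose e (n : nat) : R := c + n.+1%:R^-1.
have /choice[z zP] n : exists z, [/\ 0 < z, chi_dom K z & chi1 K fp0 gp0 h z (e n) <= 0].
  have : (c_star_plus K fp0 gp0 h < (e n)%:E)%E.
    by apply: (le_lt_trans cs); rewrite lte_fin ltrDl invr_gt0.
  move=> /ereal_inf_lt[_ [c' [z [z0 [zd zc]]] <-]]; rewrite lte_fin => c'e.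
  by exists z; split=> //; rewrite -zc chi1_le_c // ltW.
pose M := `|c| + fp0 + 2.
have zM n t : `|(fun n (_ : R) => z n) n t| <= M.
  have [z0 _] := zP n; rewrite gtr0_norm // /chi1 -/(lap _) => zc.
  have l0 : 0 <= gp0 * expR (- (z n * e n * h)) * lap (z n).
    by rewrite !mulr_ge0 ?expR_ge0 ?lap_ge0 // ltW.
  have en : e n <= `|c| + 1.
    by rewrite lerD // ?ler_norm // invf_le1 // (ler_nat _ 1).
  have ez : e n * z n <= (`|c| + 1) * z n by rewrite ler_wpM2r // ltW.
  rewrite leNgt; apply/negP => Mz.
  have c0 : 0 <= `|c| by [].
  have : M * z n < z n ^+ 2 by rewrite expr2 ltr_pM2r.
  have f0 : fp0 * 1 <= fp0 * z n.
    by rewrite ler_wpM2l ?(ltW fp00) //; move: Mz; rewrite /M; have := fp00; lra.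
  rewrite /M; move: zc; lra.
(* Bolzano-Weierstrass for numbers, seen as constant functions. *)
have [|phi [u [phik uP]]] := equilipschitz_subsequence ltr01 zM.
  by move=> n s t; rewrite subrr normr0 mul1r.
have ec : e (phi k) @[k --> \oo] --> c.
  rewrite -[X in _ --> X]addr0 /e; apply: cvgD; first exact: cvg_cst.
  have phioo : phi k @[k --> \oo] --> \oo.
    by apply/cvgnyPge => m; near=> k; apply: leq_trans (phik k);
      near: k; exact: nbhs_infty_ge.
  exact: (cvg_comp _ _ phioo (@cvg_harmonic R)).
have [|| dom chi] := @chi1_limit (z \o phi) (e \o phi) (u 0) c (uP 0) ec.
- by move=> n; case: (zP (phi n)).
- by move=> n; case: (zP (phi n)).
exists (u 0); split=> //.
have u0 : 0 <= u 0.
  by apply: (cvgr_to_ge (uP 0)); apply: nearW => k; case: (zP (phi k)) => /ltW.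
rewrite lt_neqAle u0 andbT eq_sym; apply/negP => /eqP uE.
move: chi; rewrite uE /chi1 expr2 !mulr0 !mul0r oppr0 expR0 mulr1.
have -> : \int[mu]_s (K s * expR (- (0 * s))) = 1.
  by rewrite -[RHS]K1; apply: eq_Rintegral => s _; rewrite mul0r oppr0 expR0 mulr1.
by have := fgp0; lra.
Unshelve. all: by end_near. Qed.

(** By convexity in z, this would contradict chi_1(0, c) = gp0 - fp0 > 0. It shows that no speed
    satisfies both c <= c_*^- and c >= c_*^+. *)
Lemma chi1_no_two_signs c z1 z2 : z1 < 0 -> 0 < z2 ->
  chi_dom K z1 -> chi_dom K z2 ->
  chi1 K fp0 gp0 h z1 c <= 0 -> chi1 K fp0 gp0 h z2 c <= 0 -> False.
Proof.
move=> z10 z20 d1 d2 c1 c2; have gp00 : 0 < gp0 by exact: lt_trans fgp0.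
have f0 := fp00.
pose eta := (gp0 - fp0) / (2 * gp0).
have fg : 0 < gp0 - fp0 by rewrite subr_gt0.
have eta0 : 0 < eta by rewrite divr_gt0 // mulr_gt0.
have etaE : 2 * (gp0 * eta) = gp0 - fp0 by rewrite /eta; field; rewrite gt_eqF.
clearbody eta.
have [r r0 rm] := kernel_mass_window K0 iK K1 eta0.
have c2' : z2 ^+ 2 - c * z2 - fp0 + gp0 * expR (- (z2 * (c * h))) *
    \int[mu]_s (K s * expR (- (z2 * s))) <= 0 by rewrite mulrA.
have := @laplace_window_neg _ K K0 iK c (c * h) fp0 gp0 z2 fp00 fgp0 z20 d2 c2' r z1 _ (ltW z10) erefl.
set m := \int[mu]_(s in _) K s in rm *.
set a := - z1 / z2; set J := \int[mu]_(s in _) _ => hJ.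
have a0 : 0 < a by rewrite divr_gt0 // oppr_gt0.
have z1E : z1 = - (a * z2) by rewrite /a divfK ?opprK // gt_eqF.
have Jle : gp0 * J <= gp0 * expR (- (z1 * c * h)) * lap z1.
  rewrite -mulrA ler_pM2l // -RintegralZl //.
  have -> : J = \int[mu]_(s in `[- r, r])
      (expR (- (z1 * c * h)) * (K s * expR (- (z1 * s)))).
    apply: eq_Rintegral => s _; rewrite [in RHS]mulrCA -expRD.
    by congr (_ * expR _); ring.
  have iz : mu.-integrable setT
      (fun s => (expR (- (z1 * c * h)) * (K s * expR (- (z1 * s))))%:E).
    exact: integrable_funZ.
  rewrite /Rintegral fine_le //.
  - by apply: integrable_fin_num => //; apply: integrableS iz.
  - exact: integrable_fin_num.
  - apply: ge0_subset_integral => //; first exact: (measurable_int mu).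
    by move=> s _; rewrite lee_fin !mulr_ge0 ?expR_ge0.
move: c1; rewrite /chi1 -/(lap z1) => c1.
have gm : fp0 <= gp0 * m.
  have : gp0 * (1 - eta) <= gp0 * m by rewrite ler_pM2l.
  by lra.
have am : a * fp0 <= a * (gp0 * m) by rewrite ler_pM2l.
have q0 : 0 < a * z2 ^+ 2 by rewrite mulr_gt0 // exprn_gt0.
have q1 : 0 <= z1 ^+ 2 by rewrite sqr_ge0.
have zc : c * z1 = - (a * (c * z2)) by rewrite z1E; ring.
clearbody J m a; lra.
Qed.

End Characteristic.

Section CharacteristicReflection.
Variable R : realType.
Local Notation mu := (@lebesgue_measure R).
Variable K : R -> R.
Hypothesis iK : mu.-integrable setT (fun s => (K s)%:E).
Variables (fp0 gp0 h : R).

Lemma chi_dom_reflect z : chi_dom K z -> chi_dom (fun s => K (- s)) (- z).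
Proof.
move=> /integrable_reflect; apply: eq_integrable => // s _.
by rewrite mulrN mulNr.
Qed.

Lemma chi1_reflect z c : chi_dom K z ->
  chi1 (fun s => K (- s)) fp0 gp0 h (- z) (- c) = chi1 K fp0 gp0 h z c.
Proof.
move=> zd; rewrite /chi1 sqrrN !mulrNN; congr (_ + _ * _).
rewrite -[RHS]Rintegral_reflect //; apply: eq_Rintegral => s _.
by congr (_ * expR _); ring.
Qed.

Lemma c_star_plus_reflect :
  (c_star_plus (fun s => K (- s)) fp0 gp0 h <= - c_star_minus K fp0 gp0 h)%E.
Proof.
rewrite leeNr; apply: ge_ereal_sup => _ [c [z [z0 [zd zc]]] <-].
rewrite leeNr; apply: ereal_inf_lbound; exists (- c) => //=.
exists (- z); split; first by rewrite oppr_gt0.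
by split; [exact: chi_dom_reflect|rewrite chi1_reflect].
Qed.

End CharacteristicReflection.

(** * Existence of profiles *)

Section Existence.
Variable R : realType.
Local Notation mu := (@lebesgue_measure R).
Variable K : R -> R.
Hypothesis K0 : forall s, 0 <= K s.
Hypothesis iK : mu.-integrable setT (fun s => (K s)%:E).
Hypothesis K1 : \int[mu]_s K s = 1.
Variables (c d Z L fp0 gp0 z0 zeta1 : R) (f g : R -> R).
Hypotheses (Z0 : 0 < Z) (L0 : 0 <= L) (fp00 : 0 < fp0) (fgp0 : fp0 < gp0).
Hypotheses (z00 : 0 < z0) (zeta10 : 0 < zeta1) (zeta1Z : zeta1 < Z).
Hypothesis fL : forall x y, `|f x - f y| <= L * `|x - y|.
Hypothesis f0 : f 0 = 0.
Hypothesis fmono : forall x y, x <= y -> f x <= f y.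
Hypothesis fZ0 : 0 < f Z.
Hypothesis f_lin : forall x, 0 <= x <= Z -> fp0 * x <= f x.
Hypothesis f_near0 : forall e : R, 0 < e -> exists2 r : R, 0 < r &
  forall x : R, 0 <= x <= r -> f x <= (fp0 + e) * x.
Hypothesis g_uc : forall e : R, 0 < e -> exists2 r : R, 0 < r &
  forall x y, `|x - y| <= r -> `|g x - g y| <= e.
Hypothesis gZ : forall x, 0 <= g x <= f Z.
Hypothesis g_lin : forall x, 0 <= x <= Z -> g x <= gp0 * x.
Hypothesis g_near0 : forall e : R, 0 < e -> exists2 r : R, 0 < r &
  forall x : R, 0 <= x <= r -> (gp0 - e) * x <= g x.
Hypothesis fg : forall x, 0 < x <= zeta1 -> f x < g x.
Hypothesis gz1 : forall x, zeta1 <= x <= Z -> g zeta1 <= g x.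
Hypothesis iKz : mu.-integrable setT (fun s => (K s * expR (- (z0 * s)))%:E).
Hypothesis chi_z0 : z0 ^+ 2 - c * z0 - fp0 +
  gp0 * expR (- (z0 * d)) * \int[mu]_s (K s * expR (- (z0 * s))) <= 0.

Let cg : continuous g.
Proof.
move=> x; apply/cvgrPdist_le => e /g_uc[r r0 gr]; near=> y.
by apply: gr; near: y; apply: cvgr_dist_le => //; exact: cvg_id.
Unshelve. all: by end_near. Qed.

Let gp00 : 0 < gp0. Proof. exact: lt_trans fgp0. Qed.

(** Take b = a + c with a large: z0 < b makes [green_le_exp] available at z0, and the coefficients a
    b - L and a b - fp0 are nonnegative. *)
Lemma exists_rates : exists a b : R,
  [/\ 0 < a, z0 < b, b - a = c, L <= a * b & fp0 <= a * b].
Proof.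
have := L0; have := fp00; have := z00; have := ler_norm (- c).
rewrite normrN => h1 h2 h3 h4.
pose a := `|c| + L + fp0 + z0 + 1.
have a1 : 1 <= a by rewrite /a; have := normr_ge0 c; lra.
have ac : 1 + L + fp0 + z0 <= a + c by rewrite /a; lra.
have ab : a + c <= a * (a + c) by rewrite ler_peMl //; lra.
exists a, (a + c); clearbody a; split; lra.
Qed.

Variables a b : R.
Hypotheses (a0 : 0 < a) (zb : z0 < b) (bac : b - a = c).
Hypotheses (Lab : L <= a * b) (fab : fp0 <= a * b).
Local Notation opK := (profile_op K d a b f).

Let b0 : 0 < b. Proof. exact: lt_trans zb. Qed.

(* Keeps the approximate profiles from vanishing at +oo while leaving [expR (z0 * t)] a supersolution. *)
Definition source (n : nat) (t : R) : R :=
  Num.min (f Z / n.+1%:R) (gp0 * expR (z0 * t)).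

Lemma continuous_source n : continuous (source n).
Proof.
apply: continuous_fun_min => t; first exact: cst_continuous.
by apply: cvgMr; exact: continuous_expZ.
Qed.

Lemma source_itv n t : 0 <= source n t <= f Z / n.+1%:R.
Proof.
rewrite le_min ge_min lexx /= andbT divr_ge0 ?(ltW fZ0) //=.
by rewrite mulr_ge0 ?expR_ge0 // ltW.
Qed.

Lemma source_leZ n t : 0 <= source n t <= f Z.
Proof.
have /andP[-> h] := source_itv n t; apply: (le_trans h).
by rewrite ler_pdivrMr // ler_peMr ?(ltW fZ0) // (ler_nat _ 1).
Qed.

Let Gam n (p : R -> R) t := Num.max (g (p t)) (source n t).

Lemma admissible_source n (p : R -> R) : continuous p -> (forall s, 0 <= p s <= Z) ->
  admissible Z f p (Gam n p).
Proof.
move=> cp pZ; split=> //.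
  apply: continuous_fun_max; last exact: continuous_source.
  by move=> s; apply: continuous_comp; [exact: cp|exact: cg].
move=> s; rewrite le_max ge_max; have /andP[-> ->] := gZ (p s).
by case/andP: (source_leZ n s).
Qed.

(** The delayed term, source included, is at most gp0 exp (z0 s). Then chi_1 <= 0 at z0 bounds the
    forcing by (a + z0)(b - z0) exp (z0 s), and this coefficient is the inverse of the eigenvalue in
    [green_le_exp]. *)
Lemma profile_op_le_exp n (p : R -> R) : continuous p -> (forall s, 0 <= p s <= Z) ->
  (forall s, p s <= expR (z0 * s)) -> forall t, opK p (Gam n p) t <= expR (z0 * t).
Proof.
move=> cp pZ pE t; have A := admissible_source n cp pZ.
have az : 0 < (a + z0) * (b - z0) by rewrite mulr_gt0 ?subr_gt0 // addr_gt0.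
have hb := forcing_itv K0 iK K1 d Lab fL f0 A.
have := @green_le_exp _ a b a0 b0 _ (a * b * Z) (continuous_forcing K0 iK fL A) hb
  ((a + z0) * (b - z0)) z0 t (ltW az) _ zb.
rewrite divff ?gt_eqF // mul1r; apply; first by have := a0; have := z00; lra.
move=> s; have [_ _ cq qZ] := A.
have convle : conv K d (Gam n p) s <= expR (z0 * s) *
    (gp0 * expR (- (z0 * d)) * \int[mu]_x (K x * expR (- (z0 * x)))).
  rewrite mulrA -RintegralZl //; apply: le_Rintegral => //.
  - apply: (@integrable_weightM _ _ _ _ iK (fun x => Gam n p (s - x - d)) (f Z)) => //.
      by apply: continuous_bounded_measurable; exact: continuous_conv_arg.
    by move=> x _; have /andP[h1 h2] := qZ (s - x - d); rewrite ger0_norm.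
  - exact: integrable_funZ.
  move=> x _; rewrite mulrCA ler_wpM2l //.
  have -> : expR (z0 * s) * (gp0 * expR (- (z0 * d))) * expR (- (z0 * x)) =
            gp0 * expR (z0 * (s - x - d)).
    have -> : z0 * (s - x - d) = z0 * s + - (z0 * d) + - (z0 * x) by ring.
    by rewrite !expRD; ring.
  rewrite /Gam ge_max; apply/andP; split; last by rewrite ge_min lexx orbT.
  by apply: (le_trans (g_lin (pZ _))); rewrite ler_wpM2l ?(ltW gp00).
have pf : a * b * p s - f (p s) <= (a * b - fp0) * expR (z0 * s).
  apply: (@le_trans _ _ ((a * b - fp0) * p s)).
    by have := f_lin (pZ s); lra.
  by rewrite ler_wpM2l ?subr_ge0.
have E0 := expR_ge0 (z0 * s).
have := ler_wpM2l E0 chi_z0; rewrite mulr0 => chiE.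
rewrite /forcing; apply: (le_trans (lerD pf convle)).
have -> : (a + z0) * (b - z0) * expR (z0 * s) =
  (a * b - fp0) * expR (z0 * s) - expR (z0 * s) * (z0 ^+ 2 - c * z0 - fp0).
  by rewrite -bac; ring.
by rewrite lerD2l; move: chiE; rewrite mulrDr; lra.
Qed.

Lemma approximate_wave n : exists y : R -> R, [/\ forall t, 0 <= y t <= Z,
  forall t, y t <= expR (z0 * t), continuous y & y = opK y (Gam n y)].
Proof.
have [y [yZ yE yL yT]] := @profile_op_fixed_point _ K K0 iK K1 d a b Z L f g (source n)
  (fun t => expR (z0 * t)) a0 b0 Z0 L0 Lab fL f0 g_uc gZ (@continuous_source n)
  (source_leZ n) (@continuous_expZ _ z0) (fun t => expR_ge0 _) (@profile_op_le_exp n).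
by exists y; split=> //; exact: lipschitz_continuous yL.
Qed.

Let ode_of_fixed_point (y q : R -> R) : y = opK y q -> admissible Z f y q ->
  let dy := profile_op_derivative K d a b f y q in
  let ddy := fun t => c * dy t + f (y t) - conv K d q t in
  [/\ forall t : R, is_derive t 1 y (dy t), forall t : R, is_derive t 1 dy (ddy t) &
      forall t, `|dy t| <= (a + b) * y t].
Proof.
move=> yT A dy ddy; split=> t.
- by rewrite {1}yT; exact: (profile_op_derive K0 iK K1 d a0 b0 Lab fL f0 A).
- have h := profile_op_derive2 K0 iK K1 d a0 b0 Lab fL f0 A t.
  by apply: (is_derive_eq h); rewrite bac -yT /ddy /dy /forcing; ring.
- by have := profile_op_harnack K0 iK K1 d a0 b0 Lab fL f0 A t; rewrite -yT.
Qed.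

(** Towards -oo the bound exp (z0 t) brings y below [del]. Towards +oo the source equals f Z / (n +
    1), which lifts y above a small level x0 with f x0 below that value; [persistence] then lifts it
    above zeta1 >= del. *)
Lemma approximate_wave_crosses n (y : R -> R) del : (forall t, 0 <= y t <= Z) ->
  (forall t, y t <= expR (z0 * t)) -> continuous y -> y = opK y (Gam n y) ->
  0 < del -> del <= zeta1 -> exists t, y t = del.
Proof.
move=> yZ yE cy yT del0 delz.
have A := admissible_source n cy yZ; have [_ _ cq qZ] := A.
have [yd dyd _] := ode_of_fixed_point yT A.
set dy := profile_op_derivative _ _ _ _ _ _ _ in yd dyd.
pose ddy := fun t => c * dy t + f (y t) - conv K d (Gam n y) t.
pose gam := f Z / n.+1%:R.
have gam0 : 0 < gam by rewrite divr_gt0.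
have [T TP] : exists T, forall t, T <= t -> gam <= Gam n y t.
  have : \forall x \near +oo, expR (- (z0 * x)) < gp0 / gam.
    by apply: (cvgr_lt _ (cvg_expNZ z00)); rewrite divr_gt0.
  move=> /filter_ex[T Tp]; exists T => t Tt; rewrite /Gam le_max /source -/gam.
  apply/orP; right; rewrite le_min lexx /=.
  have h : expR (- (z0 * t)) <= gp0 / gam.
    apply: ltW; apply: le_lt_trans Tp; rewrite ler_expR lerN2.
    by rewrite ler_wpM2l // ltW.
  move: h; rewrite ler_pdivlMr // -(ler_pM2l (expR_gt0 (z0 * t))).
  by rewrite mulrA -expRD subrr expR0 mul1r mulrC.
pose x0 := gam / (2 * (L + 1)).
have x00 : 0 < x0 by rewrite divr_gt0 // mulr_gt0 // ltr_wpDl.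
have fx0 : f x0 < gam.
  have h1 : f x0 <= L * x0.
    have := fL x0 0; rewrite f0 !subr0 (gtr0_norm x00).
    exact: le_trans (ler_norm _).
  have h2 : 2 * (L * x0 + x0) = gam.
    rewrite /x0; field; rewrite gt_eqF //; exact: ltr_wpDl.
  have h3 : 0 <= L * x0 by rewrite mulr_ge0 // ltW.
  clearbody x0 gam; lra.
have [T1 T1P] := fluctuation_lower K0 iK K1 fmono yd dyd yZ (fun t => erefl) cq qZ
  (ltW gam0) TP fx0.
have gq t : g (y t) <= Gam n y t by rewrite le_max lexx.
have g0 x : 0 <= g x by case/andP: (gZ x).
have [bb z1bb [T2 T2P]] := @persistence _ K K0 iK K1 c d Z (f Z) f g fmono y dy ddy
  (Gam n y) yd dyd yZ (fun t => erefl) cq qZ f0 (ex_intro2 _ _ L L0 fL) g_uc zeta1 x0 T1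
  zeta10 zeta1Z fg gz1 gq g0 x00 (fun t h => ltW (T1P t h)).
have : \forall x \near +oo, expR (- (z0 * x)) < del.
  by apply: (cvgr_lt _ (cvg_expNZ z00)).
move=> /filter_ex[t1 t1P].
have yt1 : y (- t1) < del by apply: le_lt_trans t1P; rewrite -mulrN.
have t12 : - t1 <= Num.max T2 (- t1) by rewrite le_max lexx orbT.
have yt2 : del <= y (Num.max T2 (- t1)).
  by apply: (le_trans delz); apply/ltW/(lt_le_trans z1bb)/T2P; rewrite le_max lexx.
have [|t _ tE] := IVT t12 (continuous_subspaceT cy) (v := del); last by exists t.
by rewrite ge_min le_max (ltW yt1) yt2 orbT.
Qed.

Theorem exists_profile : exists y dy ddy : R -> R,
  [/\ forall t : R, is_derive t 1 y (dy t), forall t : R, is_derive t 1 dy (ddy t),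
      continuous ddy, (forall t, 0 < y t <= Z) &
      (forall t, ddy t = c * dy t + f (y t) - conv K d (fun s => g (y s)) t)] /\
  (y t @[t --> -oo] --> (0 : R)) /\
  exists2 z, zeta1 < z & exists T, forall t, T <= t -> z <= y t.
Proof.
have ab0 : 0 < a + b by rewrite addr_gt0.
have [d1 [C [rho [d10 C0 rho0 decay]]]] := @left_decay _ K K0 iK K1 c d (a + b) (f Z)
  fp0 gp0 z0 f g ab0 fp00 fgp0 z00 cg gZ f_near0 g_near0 iKz chi_z0.
(* Below d1 the decay estimate applies, and up to zeta1 every approximate profile crosses the level;
   neither bound depends on [n]. *)
pose del := Num.min d1 zeta1.
have del0 : 0 < del by rewrite lt_min d10.
have deld : del <= d1 by rewrite ge_min lexx.
have delz : del <= zeta1 by rewrite ge_min lexx orbT.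
have /choice[y yP] n : exists y : R -> R, [/\ forall t, 0 <= y t <= Z, continuous y,
    y 0 = del & exists t0, y = opK y (fun t => Num.max (g (y t)) (source n (t + t0)))].
  have [y [yZ yE cy yT]] := approximate_wave n.
  have [t0 yt0] := approximate_wave_crosses yZ yE cy yT del0 delz.
  have A := admissible_source n cy yZ.
  exists (fun t => y (t + t0)); split=> //.
  - exact: continuous_shift.
  - by rewrite add0r.
  exists t0; apply: funext => t.
  transitivity (opK y (Gam n y) (t + t0)); first by rewrite -yT.
  rewrite /profile_op (@green_shift _ a b a0 b0 _ _ (continuous_forcing K0 iK fL A)
    (forcing_itv K0 iK K1 d Lab fL f0 A)).
  by congr (green a b _ t); apply: funext => s; rewrite /forcing conv_shift.
have /choice[t0 t0P] n : exists t0, y n = opK (y n)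
    (fun t => Num.max (g (y n t)) (source n (t + t0))) by case: (yP n).
pose q n t := Num.max (g (y n t)) (source n (t + t0 n)).
have yT n : opK (y n) (q n) = y n by rewrite [RHS]t0P.
have A n : admissible Z f (y n) (q n).
  have [yZ cy _ _] := yP n; split=> //.
    apply: continuous_fun_max.
      by move=> s; apply: continuous_comp; [exact: cy|exact: cg].
    exact/continuous_shift/continuous_source.
  move=> s; rewrite le_max ge_max; have /andP[-> ->] := gZ (y n s).
  by case/andP: (source_leZ n (s + t0 n)).
have [|||phi [u [phik yu uZ uL uT]]] := @profile_op_limit _ K K0 iK K1 d a b Z L f a0 b0 Z0 Lab fL f0
  y q (fun _ x => g x) A.
- by move=> _; exact: cg.
- by move=> t; under eq_fun => n do rewrite yT subrr; exact: cvg_cst.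
- move=> t; apply/cvgrPdist_le => e e0.
  have [k kP] := exists_natr_gt (f Z / e).
  near=> n.
  (* The shift [t0 n] is uncontrolled, but the bound on the source is uniform in time. *)
  have /andP[s0 sle] := source_itv n (t + t0 n).
  have sn : f Z / n.+1%:R <= e.
    rewrite ler_pdivrMr // mulrC -ler_pdivrMr //; apply: (le_trans (ltW kP)).
    by rewrite ler_nat ltnS; near: n; exact: nbhs_infty_ge.
  have /andP[g0 _] := gZ (y n t).
  rewrite sub0r normrN /q ger0_norm; last by rewrite subr_ge0 le_max lexx.
  rewrite lerBlDr ge_max; apply/andP; split; first by rewrite lerDr ltW.
  by have := le_trans sle sn; move: g0; lra.
have cu : continuous u := lipschitz_continuous uL.
have cf : continuous f := lipschitz_continuous fL.
have u0 : u 0 = del.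
  have y0 n : opK (y n) (q n) 0 = del by rewrite yT; case: (yP n).
  have h : opK (y (phi k)) (q (phi k)) 0 @[k --> \oo] --> del.
    rewrite (_ : (fun k => _) = (fun=> del)); first exact: cvg_cst.
    by apply: funext => k; exact: y0.
  exact: (cvg_unique _ (yu 0) h).
have uA : admissible Z f u (fun t => g (u t)).
  by split=> // s; apply: continuous_comp; [exact: cu|exact: cg].
have [ud udd uH] := ode_of_fixed_point uT uA.
set du := profile_op_derivative _ _ _ _ _ _ _ in ud udd uH.
pose ddu := fun t => c * du t + f (u t) - conv K d (fun s => g (u s)) t.
(* Harnack's inequality propagates u 0 = del > 0 to every t. *)
have upos t : 0 < u t.
  have := @harnack _ (a + b) u du ud uH 0 t.
  rewrite u0; case: (ltP 0 (u t)) => // ut; rewrite leNgt => /negP[].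
  apply: le_lt_trans del0; rewrite mulr_le0_ge0 ?expR_ge0 //.
have prof : positive_profile K c d (a + b) f g u du ddu by split.
have cq : continuous (fun t => g (u t)) by case: uA.
have gq t : 0 <= g (u t) <= f Z by exact: gZ.
exists u, du, ddu; split; [split=> //|split].
- move=> t; apply: cvgB.
    apply: cvgD; first by apply: cvgMr; exact: (derive_continuous udd).
    by apply: (@continuous_comp _ _ _ u f); [exact: cu|exact: cf].
  apply: (continuous_conv K0 iK (Q := f Z)) => // s.
  by have /andP[h1 h2] := gq s; rewrite ger0_norm.
- by move=> t; rewrite upos; case/andP: (uZ t).
- apply/cvgrPdist_lt => e e0.
  have : \forall x \near +oo, expR (- (rho * x)) < e / C.
    by apply: (cvgr_lt _ (cvg_expNZ rho0)); rewrite divr_gt0.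
  move=> [M [_ MP]]; exists (Num.min 0 (- M)); split; first exact: num_real.
  move=> t; rewrite lt_min => /andP[t0' tM].
  rewrite sub0r normrN gtr0_norm //.
  have := decay u du ddu prof t 0 (ltW t0'); rewrite u0 sub0r => /(_ deld) h.
  apply: (le_lt_trans h); rewrite mulrC -ltr_pdivlMr //; apply: MP.
  by rewrite ltrNr.
(* If u t <= d1 at a late t, the decay from t back to 0 would give u 0 < del. *)
have [T TP] : exists T, forall t, T <= t -> d1 <= u t.
  have : \forall x \near +oo, expR (- (rho * x)) < del / C.
    by apply: (cvgr_lt _ (cvg_expNZ rho0)); rewrite divr_gt0.
  move=> [M [_ MP]]; exists (Num.max 0 M + 1) => t tM.
  have Mt : M < t by apply: lt_le_trans tM; rewrite ltr_pwDr // le_max lexx orbT.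
  have t0' : 0 <= t.
    by apply: le_trans tM; rewrite addr_ge0 // le_max lexx.
  rewrite leNgt; apply/negP => /ltW ut.
  have := decay u du ddu prof 0 t t0' ut; rewrite u0 subr0 leNgt => /negP; apply.
  by rewrite mulrC -ltr_pdivlMr //; exact: MP.
exact: (@persistence _ K K0 iK K1 c d Z (f Z) f g fmono u du ddu
  (fun t => g (u t)) ud udd uZ (fun t => erefl) cq gq f0 (ex_intro2 _ _ L L0 fL) g_uc zeta1
  d1 T zeta10 zeta1Z fg gz1 (fun t => lexx _) (fun x => proj1 (andP (gZ x))) d10 TP).
Unshelve. all: by end_near. Qed.

End Existence.

(** * Truncation of the nonlinearities, and the theorem *)

Section Clip.
Variable R : realType.
Implicit Types x y Z : R.

(** Freezing f and g outside [0, Z] makes f globally Lipschitz and g uniformly continuous, without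
    changing the equation for profiles with values in [0, Z]. *)
Definition clip Z x := Num.min (Num.max x 0) Z.

Lemma clip_itv Z x : 0 <= Z -> 0 <= clip Z x <= Z.
Proof. by move=> Z0; rewrite /clip le_min Z0 le_max ge_min !lexx !orbT. Qed.

Lemma clip_id Z x : 0 <= x <= Z -> clip Z x = x.
Proof.
by move=> /andP[x0 xZ]; rewrite /clip (max_idPl x0) (min_idPl xZ).
Qed.

Lemma clip_mono Z x y : x <= y -> clip Z x <= clip Z y.
Proof.
move=> xy; rewrite /clip le_min !ge_min lexx orbT andbT.
by apply/orP; left; rewrite ge_max !le_max xy lexx !orbT.
Qed.

Lemma clip_lip Z x y : `|clip Z x - clip Z y| <= `|x - y|.
Proof.
wlog xy : x y / x <= y => [h|].
  by case: (leP x y) => [/h//|/ltW/h]; rewrite distrC (distrC x).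
rewrite ler0_norm ?subr_le0 ?clip_mono // ler0_norm ?subr_le0 // !opprB.
by rewrite /clip /Num.min /Num.max; repeat case: ifP => /=; lra.
Qed.

Lemma continuous_clip Z : continuous (clip Z).
Proof.
move=> x; apply/cvgrPdist_le => e e0; near=> y.
apply: (le_trans (clip_lip Z x y)); near: y.
by apply: cvgr_dist_le => //; exact: cvg_id.
Unshelve. all: by end_near. Qed.

Lemma heine_itv (g : R -> R) Z : continuous g -> forall e : R, 0 < e ->
  exists2 r : R, 0 < r & forall x y, 0 <= x <= Z -> `|x - y| <= r -> `|g x - g y| <= e.
Proof.
move=> cg e e0; have /compact_near_coveringP := @segment_compact R 0 Z.
move=> /(_ R (at_right 0) (fun r x => forall y, `|x - y| <= r -> `|g x - g y| <= e) _).
case.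
  move=> x _; have /cvgrPdist_le/(_ (e / 2)) := cg x.
  rewrite divr_gt0 // => /(_ isT)/nbhs_ballP[d /= d0 dP].
  near=> x' r => y /= xy.
  have x'd : `|x - x'| < d / 2.
    by near: x'; apply: cvgr_dist_lt; [exact: cvg_id|rewrite divr_gt0].
  have rd : r < d / 2 by near: r; apply: nbhs_right_lt; rewrite divr_gt0.
  have h1 : `|g x - g x'| <= e / 2 by apply: dP; rewrite /ball /=; lra.
  have h2 : `|g x - g y| <= e / 2.
    by apply: dP; rewrite /ball /=; have := ler_distD x' x y; lra.
  by have := ler_distD (g x) (g x') (g y); rewrite (distrC (g x') (g x)) /=; lra.
move=> d /= d0 dP; exists (d / 2); first by rewrite divr_gt0.
move=> x y xZ; apply: (dP (d / 2)) => //=; rewrite ?divr_gt0 //.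
by rewrite sub0r normrN gtr0_norm ?divr_gt0 //; lra.
Unshelve. all: by end_near. Qed.

Lemma right_deriv0_near (f : R -> R) l : f 0 = 0 -> right_deriv0 f l ->
  forall e : R, 0 < e -> exists2 r : R, 0 < r &
  forall x, 0 <= x <= r -> (l - e) * x <= f x <= (l + e) * x.
Proof.
move=> f0 /cvgrPdist_le h e /h[r /= r0 rP]; exists (r / 2); first by rewrite divr_gt0.
move=> x /andP[]; rewrite le_eqVlt => /predU1P[<- _|x0 xr].
  by rewrite !mulr0 f0 lexx.
have : `|l - f x / x| <= e.
  by have := rP x; rewrite /= f0 subr0; apply=> //; rewrite sub0r normrN gtr0_norm //; lra.
rewrite ler_norml => /andP[h1 h2].
by rewrite -(ler_pdivlMr _ _ x0) -(ler_pdivrMr _ _ x0); apply/andP; split; lra.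
Qed.

End Clip.

Lemma iter_lim_le (R : realType) (H : R -> R) (Z x k : R) : (forall s, H s <= Z) ->
  iter n H x @[n --> \oo] --> k -> k <= Z.
Proof.
move=> HZ Hk; apply: (cvgr_to_le Hk); near=> n.
have n0 : (0 < n)%N by near: n; exact: nbhs_infty_gt.
by rewrite -(prednK n0) iterS; exact: HZ.
Unshelve. all: by end_near. Qed.

(** * The wave that vanishes at -oo *)

Section RightWave.
Variable R : realType.
Local Notation mu := (@lebesgue_measure R).
Variables (h : R) (f g G : R -> R) (fp0 gp0 zeta1 Z : R).
Hypothesis h0 : 0 <= h.
Hypothesis F : condF f g fp0 gp0.
Hypothesis glin : forall s, 0 <= s -> g s <= gp0 * s.
Hypothesis flin : forall s, 0 <= s -> fp0 * s <= f s.
Hypothesis Z0 : 0 < Z.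
Hypothesis gsup : (sup_nonneg g < (f Z)%:E)%E.
Hypothesis GP : forall s, 0 <= s -> 0 <= G s /\ f (G s) = g s.
Hypotheses (z10 : 0 < zeta1) (z1Z : zeta1 < Z).
Hypothesis Gmin : forall s, zeta1 <= s <= Z -> G zeta1 <= G s.
Hypothesis Gup : forall s, 0 < s <= zeta1 -> s < G s.

Let fc x := f (clip Z x).
Let gc x := g (clip Z x).
Let Gc x := G (clip Z x).

Let f_inc x y : 0 <= x -> x < y -> f x < f y.
Proof. by have [_ [+ _]] := F; apply. Qed.

Let f_mono x y : 0 <= x -> x <= y -> f x <= f y.
Proof. by move=> x0; rewrite le_eqVlt => /predU1P[->//|/(f_inc x0)/ltW]. Qed.

Let f_lt x y : 0 <= y -> f x < f y -> x < y.
Proof. by move=> y0; rewrite !ltNge; apply: contra => /(f_mono y0). Qed.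

Let f_le x y : 0 <= y -> f x <= f y -> x <= y.
Proof. by move=> y0; rewrite !leNgt; apply: contra => /(f_inc y0). Qed.

Let f0 : f 0 = 0. Proof. by have [_ [_ [-> _]]] := F. Qed.
Let g0 : g 0 = 0. Proof. by have [_ [_ [_ [-> _]]]] := F. Qed.
Let fp00 : 0 < fp0. Proof. by have [_ [_ [_ [_ [_ [-> _]]]]]] := F. Qed.
Let fgp0 : fp0 < gp0.
Proof. by have [_ [_ [_ [_ [_ [_ [_ [_ [_ [_ ->]]]]]]]]]] := F. Qed.
Let f_right : right_deriv0 f fp0.
Proof. by have [_ [_ [_ [_ [+ _]]]]] := F. Qed.
Let g_right : right_deriv0 g gp0.
Proof. by have [_ [_ [_ [_ [_ [_ [_ [_ [_ [+ _]]]]]]]]]] := F. Qed.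
Let g_pos t : 0 < t -> 0 < g t.
Proof. by have [_ [_ [_ [_ [_ [_ [_ [_ [+ _]]]]]]]]] := F; apply. Qed.
Let g_cont : {within `[0, +oo[%classic, continuous g}.
Proof. by have [_ [_ [_ [_ [_ [_ [_ [+ _]]]]]]]] := F. Qed.

Let g_ge0 t : 0 <= t -> 0 <= g t.
Proof. by rewrite le_eqVlt => /predU1P[<-|/g_pos/ltW//]; rewrite g0. Qed.

Let g_lt t : 0 <= t -> g t < f Z.
Proof.
move=> t0; rewrite -lte_fin; apply: le_lt_trans gsup; apply: ereal_sup_ubound.
by exists t => //=; rewrite in_itv /= t0.
Qed.

Let ZZ : 0 <= Z := ltW Z0.
Let clip_ge0 x : 0 <= clip Z x. Proof. by have /andP[] := clip_itv x ZZ. Qed.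

Lemma lipschitz_clip_f : exists2 L, 0 <= L & forall x y, `|fc x - fc y| <= L * `|x - y|.
Proof.
have [fL _] := F; have [L LP] := fL Z; exists `|L| => // x y.
have /andP[x0 xZ] := clip_itv x ZZ; have /andP[y0 yZ] := clip_itv y ZZ.
apply: (le_trans (LP _ _ x0 xZ y0 yZ)).
apply: (@le_trans _ _ (`|L| * `|clip Z x - clip Z y|)).
  by rewrite ler_wpM2r ?ler_norm.
by rewrite ler_wpM2l ?clip_lip.
Qed.

Let fcm x y : x <= y -> fc x <= fc y.
Proof. by move=> /(clip_mono Z); apply: f_mono. Qed.

Let fcE x : 0 <= x <= Z -> fc x = f x. Proof. by move=> /clip_id; rewrite /fc => ->. Qed.
Let gcE x : 0 <= x <= Z -> gc x = g x. Proof. by move=> /clip_id; rewrite /gc => ->. Qed.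
Let GcE x : 0 <= x <= Z -> Gc x = G x. Proof. by move=> /clip_id; rewrite /Gc => ->. Qed.

Lemma continuous_clip_g : continuous gc.
Proof.
move=> x; have /subspace_continuousP cg := g_cont.
have := cg (clip Z x); rewrite /= in_itv /= clip_ge0 => /(_ isT) gx.
apply: cvg_comp gx; move=> A /=; rewrite /within /= => hA.
have := @continuous_clip R Z x _ hA; rewrite nbhs_simpl /=.
apply: filterS => y /=; apply; by rewrite in_itv /= clip_ge0.
Qed.

Lemma uniform_clip_g e : 0 < e -> exists2 r : R, 0 < r &
  forall x y, `|x - y| <= r -> `|gc x - gc y| <= e.
Proof.
move=> e0; have [r r0 rP] := @heine_itv R gc Z continuous_clip_g e e0.
exists r => // x y xy; have cc s : gc (clip Z s) = gc s.
  by rewrite /gc (clip_id (clip_itv s ZZ)).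
rewrite -(cc x) -(cc y); apply: rP; first exact: clip_itv.
exact: le_trans (clip_lip _ _ _) xy.
Qed.

Lemma clip_near0 (u : R -> R) l : u 0 = 0 -> right_deriv0 u l -> forall e : R, 0 < e ->
  exists2 r : R, 0 < r &
  forall x, 0 <= x <= r -> (l - e) * x <= u (clip Z x) <= (l + e) * x.
Proof.
move=> u0 ul e e0; have [r r0 rP] := right_deriv0_near u0 ul e0.
exists (Num.min r Z); first by rewrite lt_min r0.
move=> x /andP[x0]; rewrite le_min => /andP[xr xZ].
by rewrite clip_id ?x0 //; apply: rP; rewrite x0.
Qed.

(** By strict monotonicity of f, closeness of Gc y to Gc x follows from f (Gc x - e) < gc y < f (Gc
    x + e), an open condition on y. *)
Lemma continuous_clip_G : continuous Gc.
Proof.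
move=> x; apply/cvgrPdist_lt => e e0.
have [Gx0 fGx] := GP (clip_ge0 x).
have cgx := @continuous_clip_g x.
have low : \forall y \near x, Gc x - e < Gc y.
  (* f is increasing only on [0, +oo); if Gc x - e is negative, G >= 0 is enough. *)
  case: (ltP (Gc x - e) 0) => Gxe.
    by near=> y; apply: (lt_le_trans Gxe); case: (GP (clip_ge0 y)).
  near=> y; have [Gy0 fGy] := GP (clip_ge0 y).
  apply: f_lt => //; rewrite fGy; near: y; apply: (cvgr_gt _ cgx).
  by rewrite /gc -fGx; apply: f_inc => //; rewrite gtrBl.
have upp : \forall y \near x, Gc y < Gc x + e.
  near=> y; have [Gy0 fGy] := GP (clip_ge0 y).
  apply: f_lt; first by rewrite addr_ge0 // ltW.
  rewrite fGy; near: y; apply: (cvgr_lt _ cgx).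
  by rewrite /gc -fGx; apply: f_inc => //; rewrite ltrDl.
near=> y; have h1 : Gc x - e < Gc y by near: y.
have h2 : Gc y < Gc x + e by near: y.
by rewrite distrC ltr_norml; apply/andP; split; lra.
Unshelve. all: by end_near. Qed.

Lemma liminf_pinfty_gt (y : R -> R) x z T : x < z -> (forall t, T <= t -> z <= y t) ->
  (x%:E < liminf_pinfty y)%E.
Proof.
move=> xz yz; apply: (@lt_le_trans _ _ z%:E); first by rewrite lte_fin.
apply: (@le_trans _ _ (ereal_inf [set (y s)%:E | s in `[T, +oo[%classic])).
  apply: le_ereal_inf_tmp => _ [s /= + <-]; rewrite in_itv /= andbT => Ts.
  by rewrite lee_fin yz.
by apply: ereal_sup_ubound; exists T.
Qed.

Section Kernel.
Variable K : R -> R.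
Hypothesis K0 : forall s, 0 <= K s.
Hypothesis iK : mu.-integrable setT (fun s => (K s)%:E).
Hypothesis K1 : \int[mu]_s K s = 1.
Variable c : R.
Hypothesis cK : (c_star_plus K fp0 gp0 h <= c%:E)%E.

(** The integrability of the delayed term is returned too, because reflecting the wave changes
    variables in that integral. *)
Lemma right_wave : exists2 y : R -> R,
  forall t, mu.-integrable setT (fun s => (K s * g (y (t - s - c * h)))%:E) &
  [/\ semi_wavefront K f g c h y,
      (forall t, y t <= Z),
      y t @[t --> -oo] --> 0,
      (zeta1%:E < liminf_pinfty y)%E &
      forall kappa : R, 0 < kappa ->
           (forall s, 0 <= s -> (f s = g s <-> s = 0 \/ s = kappa)) ->
           (forall s, 0 < s <= Z -> iter n G s @[n --> \oo] --> kappa) ->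
      y t @[t --> +oo] --> kappa].
Proof.
have [z0 [z00 iKz chi_z0]] := c_star_plus_root K0 iK K1 h0 fp00 fgp0 cK.
have [L L0 fL] := lipschitz_clip_f.
have [a [b [a0 zb bac Lab fab]]] := exists_rates c L0 fp00 z00.
have z10' : 0 <= zeta1 := ltW z10.
have fc0 : fc 0 = 0 by rewrite fcE // lexx ZZ.
have fcZ : fc Z = f Z by rewrite fcE // lexx ZZ.
have fZ0 : 0 < fc Z by rewrite fcZ -f0; exact: f_inc.
have f_lin x : 0 <= x <= Z -> fp0 * x <= fc x.
  by move=> xI; rewrite fcE //; apply: flin; case/andP: xI.
have f_near e : 0 < e -> exists2 r : R, 0 < r &
    forall x : R, 0 <= x <= r -> fc x <= (fp0 + e) * x.
  by move=> /(clip_near0 f0 f_right)[r r0 rP]; exists r => // x /rP/andP[].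
have gZ x : 0 <= gc x <= fc Z by rewrite fcZ g_ge0 // ltW // g_lt.
have g_lin x : 0 <= x <= Z -> gc x <= gp0 * x.
  by move=> xI; rewrite gcE //; apply: glin; case/andP: xI.
have g_near e : 0 < e -> exists2 r : R, 0 < r &
    forall x : R, 0 <= x <= r -> (gp0 - e) * x <= gc x.
  by move=> /(clip_near0 g0 g_right)[r r0 rP]; exists r => // x /rP/andP[].
have fg x : 0 < x <= zeta1 -> fc x < gc x.
  move=> /andP[x0 xz]; have xI : 0 <= x <= Z by rewrite !ltW // (le_lt_trans xz).
  have [_ fG] := GP (ltW x0); rewrite fcE // gcE // -fG.
  by apply: f_inc; [exact: ltW|apply: Gup; rewrite x0].
have gz1 x : zeta1 <= x <= Z -> gc zeta1 <= gc x.
  move=> /andP[zx xZ]; have x0 := le_trans z10' zx.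
  rewrite !gcE ?x0 ?z10' ?(ltW z1Z) //.
  have [G1 <-] := GP z10'; have [_ <-] := GP x0.
  by apply: f_mono => //; apply: Gmin; rewrite zx.
have chi_z0' : z0 ^+ 2 - c * z0 - fp0 +
    gp0 * expR (- (z0 * (c * h))) * \int[mu]_s (K s * expR (- (z0 * s))) <= 0.
  by move: chi_z0; rewrite /chi1 mulrA.
have [y [dy [ddy [[yd dyd cddy yI ode] [yNoo [z zz [T yz]]]]]]] :=
  exists_profile K0 iK K1 Z0 L0 fp00 fgp0 z00 z10 z1Z fL fc0 fcm fZ0 f_lin f_near
    uniform_clip_g gZ g_lin g_near fg gz1 iKz chi_z0' a0 zb bac Lab fab.
have yI' t : 0 <= y t <= Z by have /andP[/ltW -> ->] := yI t.
have dyE : derive1 y = dy by apply: funext => t; exact: derive1_eq.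
have ddyE : derive1 dy = ddy by apply: funext => t; exact: derive1_eq.
have yZ t : y t <= Z by case/andP: (yI t).
have gcy : continuous (fun t => gc (y t)).
  move=> t; apply: continuous_comp; last exact: continuous_clip_g.
  exact: (derive_continuous yd).
have gQ t : 0 <= gc (y t) <= fc Z by exact: gZ.
exists y.
  move=> t; rewrite (_ : (fun s => _) = (fun s => (K s * gc (y (t - s - c * h)))%:E)).
    apply: (@integrable_weightM _ _ _ _ _ _ (fc Z)) => //.
      apply: continuous_bounded_measurable.
      exact: (@continuous_conv_arg R (c * h) (fun t => gc (y t))).
    by move=> s _; have /andP[h1 h2] := gQ (t - s - c * h); rewrite ger0_norm.
  by apply: funext => s; rewrite gcE.
split=> //.
- split=> //.
  + by move=> t; case/andP: (yI t).
  + by exists Z => t; rewrite ger0_norm //; case/andP: (yI' t).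
  + split; first by move=> t; case: (yd t).
    by split; [move=> t; rewrite dyE; case: (dyd t)|rewrite dyE ddyE].
  + move=> t; rewrite dyE ddyE ode fcE // /conv.
    have -> : \int[mu]_s (K s * gc (y (t - s - c * h))) =
        \int[mu]_s (K s * g (y (t - s - c * h))).
      by apply: eq_Rintegral => s _; rewrite gcE.
    by ring.
  + by left.
- exact: (liminf_pinfty_gt zz yz).
move=> kappa k0 fgk Gk.
have qq t : gc (y t) = gc (y t) by [].
have g_uc := uniform_clip_g.
have [m [M [/andP[m0 mM] MZ mMP mlow [[s1 s1I gs1] [s2 s2I gs2]]]]] :=
  limits_fluctuate K0 iK K1 fcm yd dyd yI' ode gcy gQ fc0
    (ex_intro2 _ _ L L0 fL) g_uc qq.
have zm : z <= m := mlow _ _ yz.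
have mpos : 0 < m by lra.
have GcP x : 0 <= Gc x /\ f (Gc x) = gc x by exact: GP.
have GcZ x : Gc x <= Z.
  by have [_ fGx] := GcP x; apply: f_le => //; rewrite fGx ltW // g_lt.
have GZ x : 0 < x <= Z -> 0 < Gc x <= Z.
  move=> /andP[x0 xZ]; rewrite GcZ andbT; have [Gx0 fGx] := GcP x.
  by apply: f_lt => //; rewrite f0 fGx gcE ?xZ ?ltW // g_pos.
have Gfix x : 0 < x <= Z -> Gc x = x -> x = kappa.
  move=> /andP[x0 xZ] Gx; have [_] := GcP x.
  by rewrite Gx gcE ?xZ ?ltW // => /(fgk _ (ltW x0))[xE|//]; lra.
have G_iter x : 0 < x <= Z -> iter n Gc x @[n --> \oo] --> kappa.
  (* Orbits that start in (0, Z] stay there, so clipping does not alter them. *)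
  move=> xI; suff E n : iter n Gc x = iter n G x /\ 0 < iter n G x <= Z.
    rewrite (_ : (fun n => _) = (fun n => iter n G x)); first exact: Gk.
    by apply: funext => n; case: (E n).
  elim: n => [//|n [IH /andP[h1 h2]]] /=.
  have I : 0 <= iter n G x <= Z by rewrite h2 (ltW h1).
  by rewrite IH (GcE I); split=> //; rewrite -(GcE I); apply: GZ; rewrite h1.
have kZ : 0 < kappa <= Z.
  rewrite k0 /=; have ZI : 0 < Z <= Z by rewrite Z0 lexx.
  exact: iter_lim_le GcZ (G_iter _ ZI).
have Gk0 : Gc kappa = kappa.
  have /andP[_ kZ2] := kZ; have k0' : 0 <= kappa := ltW k0.
  have kI : 0 <= kappa <= Z by rewrite k0'.
  have [Gk0 fGk] := GcP kappa.
  have fgkk : f kappa = g kappa by apply: (proj2 (fgk _ k0')); right.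
  have fE : f (Gc kappa) = f kappa by rewrite fGk (gcE kI) fgkk.
  by apply/eqP; rewrite eq_le (f_le k0') ?fE ?lexx // (f_le Gk0) // fE.
have G0 : Gc 0 = 0.
  have [Gx fGx] := GcP 0; apply/eqP; rewrite eq_le Gx andbT; apply: f_le => //.
  by rewrite fGx gcE ?lexx ?ZZ // g0 f0.
have Gr0 x : 0 < x <= zeta1 -> x < Gc x.
  move=> /andP[x0 xz]; rewrite GcE; first by apply: Gup; rewrite x0.
  by rewrite !ltW // (le_lt_trans xz).
have Gs1 : Gc s1 <= m.
  have [Gx fGx] := GcP s1; apply: f_le => //.
  by rewrite fGx (le_trans gs1) // fcE // m0 (le_trans mM).
have Gs2 : M <= Gc s2.
  have [Gx fGx] := GcP s2; apply: f_le => //; rewrite fGx (le_trans _ gs2) // fcE //.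
  by rewrite MZ (le_trans m0).
have [mE ME] := covered_interval_trivial continuous_clip_G G0 GZ Gfix kZ Gk0 G_iter
  z10 Gr0 mpos MZ s1I Gs1 s2I Gs2.
apply/cvgrPdist_le => e e0; have [T' T'P] := mMP e e0.
exists T'; split; first exact: num_real.
move=> t /= /ltW/T'P; rewrite mE ME => /andP[h1 h2].
by rewrite distrC ler_norml; apply/andP; split; lra.
Unshelve. all: by end_near. Qed.

End Kernel.
End RightWave.

(** * Reflection of waves *)

Section Reflection.
Variable R : realType.
Local Notation mu := (@lebesgue_measure R).

Lemma semi_wavefront_reflect (K f g : R -> R) (c h : R) (y : R -> R) :
  (forall t, mu.-integrable setT (fun s => (K s * g (y (t - s - c * h)))%:E)) ->
  semi_wavefront K f g c h y ->
  semi_wavefront (fun s => K (- s)) f g (- c) h (fun t => y (- t)).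
Proof.
move=> iKg [y0 [M yM] [dy [ddy cddy]] TW ylim].
have yd (t : R) : is_derive t 1 y (derive1 y t) by rewrite derive1E; exact: derivableP.
have dyd (t : R) : is_derive t 1 (derive1 y) (derive1 (derive1 y) t).
  by rewrite [derive1 (derive1 y) t]derive1E; exact: derivableP.
set phi := fun t => y (- t).
have phid (t : R) : is_derive t 1 phi (- derive1 y (- t)) by exact: is_derive_reflect.
have phi1 : derive1 phi = (fun t => - derive1 y (- t)).
  by apply: funext => t; exact: derive1_eq.
have phidd (t : R) : is_derive t 1 (derive1 phi) (derive1 (derive1 y) (- t)).
  rewrite phi1; apply: (is_derive_eq (is_derive_funN (is_derive_reflect dyd t))).
  by rewrite opprK.
have phi2 : derive1 (derive1 phi) = (fun t => derive1 (derive1 y) (- t)).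
  by apply: funext => t; exact: derive1_eq.
split.
- by move=> t; exact: y0.
- by exists M => t; exact: yM.
- split; first by move=> t; case: (phid t).
  by split; [move=> t; case: (phidd t)|rewrite phi2; exact: continuous_reflect].
- move=> t; rewrite phi2 phi1 -[RHS](TW (- t)); congr (_ + _); last first.
    rewrite -(Rintegral_reflect (iKg (- t))); apply: eq_Rintegral => s _.
    by rewrite /phi; congr (K _ * g (y _)); ring.
  by rewrite /phi; ring.
- by case: ylim => /=; [right|left]; [exact/cvgNy_compNP|exact/cvgy_compNP].
Qed.

Lemma liminf_reflect (y : R -> R) :
  (liminf_pinfty y <= liminf_ninfty (fun t => y (- t)%R))%E.
Proof.
apply: ge_ereal_sup => _ [t _ <-]; apply: ereal_sup_ubound; exists (- t)%R => //.
congr ereal_inf; apply/seteqP; split=> x /= [s + <-]; rewrite in_itv /= ?andbT => hs.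
  by exists (- s)%R => //; rewrite in_itv /= lerNr hs.
exists (- s)%R; last by rewrite opprK.
by rewrite in_itv /= lerN2.
Qed.

End Reflection.

Unset Implicit Arguments.

Theorem theorem5p2 (R : realType) (h : R) (K f g G : R -> R)
  (fp0 gp0 zeta1 zeta2 : R) :
  0 <= h ->
  (forall s, 0 <= K s) ->
  (@lebesgue_measure R).-integrable setT (fun s => (K s)%:E) ->
  (\int[@lebesgue_measure R]_s (K s)%:E = 1%:E)%E ->
  condF f g fp0 gp0 ->
  (forall s, 0 <= s -> g s <= gp0 * s) ->
  (forall s, 0 <= s -> fp0 * s <= f s) ->
  0 < zeta2 ->
  (sup_nonneg g < (f zeta2)%:E)%E ->
  (* G = f^{-1} o g on [0, oo) *)
  (forall s, 0 <= s -> 0 <= G s /\ f (G s) = g s) ->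
  0 < zeta1 -> zeta1 < zeta2 ->
  (forall s, zeta1 <= s <= zeta2 -> zeta1 <= G s <= zeta2) ->
  (forall s, zeta1 <= s <= zeta2 -> G zeta1 <= G s) ->
  (forall s, 0 < s <= zeta1 -> s < G s) ->
  forall c : R,
  ((c%:E <= c_star_minus K fp0 gp0 h)%E \/ (c_star_plus K fp0 gp0 h <= c%:E)%E) ->
  exists phi : R -> R,
    [/\ semi_wavefront K f g c h phi,
        (forall t, phi t <= zeta2),
        ((c%:E <= c_star_minus K fp0 gp0 h)%E ->
           (phi t @[t --> +oo] --> 0) /\ (zeta1%:E < liminf_ninfty phi)%E),
        ((c_star_plus K fp0 gp0 h <= c%:E)%E ->
           (phi t @[t --> -oo] --> 0) /\ (zeta1%:E < liminf_pinfty phi)%E) &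
        (forall kappa : R,
           0 < kappa ->
           (forall s, 0 <= s -> (f s = g s <-> s = 0 \/ s = kappa)) ->
           (forall s, 0 < s <= zeta2 -> iter n G s @[n --> \oo] --> kappa) ->
           ((c%:E <= c_star_minus K fp0 gp0 h)%E -> phi t @[t --> -oo] --> kappa) /\
           ((c_star_plus K fp0 gp0 h <= c%:E)%E -> phi t @[t --> +oo] --> kappa))].
Proof.
move=> h0 K0 iK K1e F glin flin Z0 gsup GP z10 z1Z _ Gmin Gup c cc.
have K1 : \int[@lebesgue_measure R]_s K s = 1 by rewrite /Rintegral K1e.
have [_ [_ [_ [_ [_ [fp00 [_ [_ [_ [_ fgp0]]]]]]]]]] := F.
pose Kr s := K (- s).
have Kr0 s : 0 <= Kr s by exact: K0.
have iKr : (@lebesgue_measure R).-integrable setT (fun s => (Kr s)%:E).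
  exact: integrable_reflect.
have Kr1 : \int[@lebesgue_measure R]_s Kr s = 1 by rewrite Rintegral_reflect.
have KrK : (fun s => Kr (- s)) = K by apply: funext => s; rewrite /Kr opprK.
have minus_plus : (c%:E <= c_star_minus K fp0 gp0 h)%E ->
    (c_star_plus Kr fp0 gp0 h <= (- c)%:E)%E.
  move=> cm; apply: le_trans (c_star_plus_reflect K fp0 gp0 h) _.
  by rewrite EFinN leeN2.
(* The two ranges of speeds are disjoint, so each wave has to satisfy only the clauses of its own
   side. *)
have one_sided : (c%:E <= c_star_minus K fp0 gp0 h)%E ->
    (c_star_plus K fp0 gp0 h <= c%:E)%E -> False.
  move=> /minus_plus cm cp.
  have [z2 [z20 dz2 xz2]] := c_star_plus_root K0 iK K1 h0 fp00 fgp0 cp.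
  have [z1 [z10' dz1 xz1]] := c_star_plus_root Kr0 iKr Kr1 h0 fp00 fgp0 cm.
  have dz1' := chi_dom_reflect dz1.
  have z10N : - z1 < 0 by rewrite oppr_lt0.
  have xz1' : chi1 K fp0 gp0 h (- z1) c <= 0.
    by rewrite -KrK -[c]opprK chi1_reflect.
  rewrite KrK in dz1'.
  exact: (chi1_no_two_signs K0 iK K1 fp00 fgp0 z10N z20 dz1' dz2 xz1' xz2).
case: cc => [cm|cp]; last first.
  have [y _ [wy yZ yNoo yinf ykappa]] :=
    right_wave h0 F glin flin Z0 gsup GP z10 z1Z Gmin Gup K0 iK K1 cp.
  exists y; split=> //.
    by move=> cm; case: (one_sided cm cp).
  move=> kappa k0 fgk Gk; split; last by move=> _; exact: ykappa.
  by move=> cm; case: (one_sided cm cp).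
(* For c <= c_*^-, the mirrored kernel at speed - c has a wave vanishing at -oo; read backwards, it
   is the required one. *)
have [y iKg [wy yZ yNoo yinf ykappa]] :=
  right_wave h0 F glin flin Z0 gsup GP z10 z1Z Gmin Gup Kr0 iKr Kr1 (minus_plus cm).
exists (fun t => y (- t)); split.
- by have := semi_wavefront_reflect iKg wy; rewrite KrK opprK.
- by move=> t; exact: yZ.
- move=> _; split; first exact/cvgNy_compNP.
  exact: lt_le_trans yinf (liminf_reflect y).
- by move=> cp; case: (one_sided cm cp).
- move=> kappa k0 fgk Gk; split; last by move=> cp; case: (one_sided cm cp).
  by move=> _; apply/cvgy_compNP; exact: ykappa.
Qed.
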